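(* Let $\alpha>-1$, let $n\ge 2$ be an integer, and let $\phi(w)=aw+b$ be an affine symbol, where $a>0$ and $\operatorname{Re}(b)\ge 0$. Then the composition operator $C_\phi$ is $n$-supercyclic on $\mathcal{A}^2_\alpha(\mathbb{C}_+)$ if and only if $\phi$ is hyperbolic of type II.
   Context: $\mathbb{C}_+=\{z\in\mathbb{C}:\operatorname{Re}(z)>0\}$ is the open right half-plane. For $\alpha>-1$, the weighted Bergman space $\mathcal{A}^2_\alpha(\mathbb{C}_+)$ is the Hilbert space of all holomorphic functions $f$ on $\mathbb{C}_+$ with finite norm $\|f\|=\left(\int_{\mathbb{C}_+}|f(x+iy)|^2x^\alpha\,dx\,dy\right)^{1/2}$. An affine symbol is a map $\phi:\mathbb{C}_+\to\mathbb{C}_+$, $\phi(w)=aw+b$ with $a>0$ and $\operatorname{Re}(b)\ge 0$; the composition operator $C_\phi f=f\circ\phi$ is then a bounded operator on $\mathcal{A}^2_\alpha(\mathbb{C}_+)$. An affine symbol is of hyperbolic type if $a\neq 1$ (and is a hyperbolic automorphism if additionally $\operatorname{Re}(b)=0$); a symbol of hyperbolic type is of type I if $a\in(0,1)$ and of type II if $a\in(1,\infty)$. For $n\ge 2$, a linear operator $T$ on a separable Banach space $\mathcal{X}$ is $n$-supercyclic if there is an $n$-dimensional linear subspace $E\subset\mathcal{X}$ whose orbit $\bigcup_{k\in\mathbb{N}}T^k(E)$ is dense in $\mathcal{X}$, where $\mathbb{N}$ is the set of non-negative integers.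
   Formalization: ''Hyperbolic of type II'' is read as a > 1 and Re(b) > 0, excluding hyperbolic automorphisms (Re(b) = 0); with them included the claim is false, e.g. for φ(w) = 2w, where the composition operator is a multiple of a unitary and not n-supercyclic. *)

(* Defs.v *)
From HB Require Import structures.
From mathcomp Require Import all_boot all_order all_algebra complex.
From mathcomp Require Import all_classical all_reals all_analysis.
From mathcomp Require Import ring lra.
Set Implicit Arguments.
Unset Strict Implicit.
Unset Printing Implicit Defensive.
Import Order.TTheory GRing.Theory Num.Theory.
Import numFieldNormedType.Exports Normc measurable_realfun.

Local Open Scope classical_set_scope.
Local Open Scope complex_scope.
Local Open Scope ring_scope.

Section HalfPlane.
Variable R : realType.
Local Notation C := R[i]^o.

Definition half_plane := {z : C | 0 < complex.Re z}.

(* Extension by 0 to the plane; only its values on the open half-plane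
   matter below. *)
Definition ext0 (f : half_plane -> C) (z : C) : C := oapp f 0 (insub z).

(* [derivable] over the scalar field [R[i]]: existence of the complex
   derivative. *)
Definition holomorphic (f : half_plane -> C) :=
  forall z : half_plane, derivable (ext0 f) (val z) 1.

Definition right_half : set (R * R) := [set p | 0 < p.1].

(* The square of the norm, as an extended real. *)
Definition bergman_int (alpha : R) (f : half_plane -> C) : \bar R :=
  (\int[lebesgue_measure \x lebesgue_measure]_(p in right_half)
     (normc (ext0 f (p.1 +i* p.2)) ^+ 2 * p.1 `^ alpha)%:E)%E.

Lemma normcE' (z : C) : `|z| = (normc z)%:C. Proof. by []. Qed.

Lemma normc_ge0 (z : C) : 0 <= normc z.
Proof. by case: z => x y; exact: sqrtr_ge0. Qed.

Lemma ext0E f (z : C) (zP : 0 < complex.Re z) : ext0 f z = f (exist _ z zP).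
Proof.
rewrite /ext0; case: insubP => /= [u _ uz|]; last by rewrite zP.
by congr f; exact: val_inj.
Qed.

Lemma ext0_lin (k : C) f g : ext0 (k *: f + g) = k *: ext0 f + ext0 g.
Proof.
apply/funext => z; rewrite /ext0.
change (oapp (k *: f + g) 0 (insub z) =
  k *: oapp f 0 (insub z) + oapp g 0 (insub z)).
by case: insubP => //= _; rewrite scaler0 addr0.
Qed.

Lemma holomorphic0 : holomorphic 0.
Proof.
move=> z; rewrite (_ : ext0 0 = cst 0); first exact: derivable_cst.
by apply/funext => w; rewrite /ext0; case: insubP.
Qed.

Lemma holomorphic_lin (k : C) f g :
  holomorphic f -> holomorphic g -> holomorphic (k *: f + g).
Proof.
move=> hf hg z; rewrite ext0_lin.
by apply: derivableD => //; apply: derivableZ.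
Qed.

Lemma normc_hline (x x' y : R) : normc ((x +i* y) - (x' +i* y)) = `|x - x'|.
Proof. by rewrite /= subrr expr0n /= addr0 sqrtr_sqr. Qed.

Lemma normc_Complex (x y : R) : normc (x +i* y) <= `|x| + `|y|.
Proof.
rewrite /= -(@ler_pXn2r _ 2) ?nnegrE ?sqrtr_ge0 ?addr_ge0//.
rewrite sqr_sqrtr ?addr_ge0 ?sqr_ge0//.
rewrite -(real_normK (num_real x)) -(real_normK (num_real y)).
have := normr_ge0 x; have := normr_ge0 y; nra.
Qed.

Lemma cvg_normc (T : Type) (F : set_system T) (FF : Filter F) (u : T -> C) (l : C) :
  u @ F --> l -> normc (u x) @[x --> F] --> normc l.
Proof.
move=> ul; apply/cvgrPdist_lt => e e0.
have e0' : 0 < e%:C :> C by rewrite ltcR.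
move/cvgrPdist_lt : ul => /(_ _ e0'); apply: filterS => t.
rewrite normcE' ltcR; apply: le_lt_trans.
have h (z w : C) : normc z - normc w <= normc (z - w).
  by rewrite lerBlDr -{1}(subrK w z); exact: le_normcD.
have hC : normc (l - u t) = normc (u t - l) by rewrite -opprB; exact: normcN.
by rewrite ler_norml h lerNl opprB hC h.
Qed.

Lemma cvg_Complex (x y : R) :
  ((p.1 +i* p.2) : C) @[p --> (x, y)] --> ((x +i* y) : C).
Proof.
apply/cvgrPdist_lt => -[e e'] e0.
have := e0; rewrite ltcE /= => /andP[/eqP ee' {}e0]; subst e'.
near=> p; rewrite normcE' ltcR.
have -> : (x +i* y) - (p.1 +i* p.2) = (x - p.1) +i* (y - p.2) :> C by [].
apply: le_lt_trans (normc_Complex _ _) _.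
rewrite (splitr e) ltrD//; near: p.
- have : p.1 @[p --> (x, y)] --> x by exact: cvg_fst.
  by move/cvgrPdist_lt; apply; rewrite divr_gt0.
- have : p.2 @[p --> (x, y)] --> y by exact: cvg_snd.
  by move/cvgrPdist_lt; apply; rewrite divr_gt0.
Unshelve. all: by end_near. Qed.

Lemma holomorphic_cvg f (x y : R) : holomorphic f -> 0 < x ->
  normc (ext0 f (p.1 +i* p.2)) @[p --> (x, y)] --> normc (ext0 f (x +i* y)).
Proof.
move=> hf x0; apply: cvg_normc.
have cf : {for (x +i* y : C), continuous (ext0 f)}.
  apply: differentiable_continuous; apply/derivable1_diffP.
  exact: (hf (exist _ (x +i* y) x0)).
exact: (cvg_comp (fun p : R * R => (p.1 +i* p.2) : C) (ext0 f)
  (@cvg_Complex x y) cf).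
Qed.

Lemma measurable_right_half : measurable right_half.
Proof.
rewrite (_ : right_half = `]0, +oo[%classic `*` setT).
  by apply: measurableX => //; exact: measurable_itv.
by apply/seteqP; split=> -[x y]; rewrite /right_half /= in_itv /= andbT//; case.
Qed.

(* [y] rounded down to a multiple of [1 / (n + 1)], for [- n <= y] *)
Let grid (n k : nat) : R := k%:R / n.+1%:R - n%:R.
Let idx (n : nat) (y : R) : nat := Num.truncn ((y + n%:R) * n.+1%:R).

Let cvg_grid (y : R) : grid n (idx n y) @[n --> \oo] --> y.
Proof.
apply/cvgrPdist_lt => e e0; near=> n.
have yn : 0 <= (y + n%:R) * n.+1%:R.
  rewrite mulr_ge0//.
  have : `|y| <= n%:R by near: n; exact: nbhs_infty_ger.
  by rewrite ler_norml => /andP[+ _]; rewrite -subr_ge0 opprK.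
have /andP[h1 h2] := truncn_itv yn.
have n0 : 0 < n.+1%:R :> R by [].
rewrite /grid /idx; set t := Num.truncn _ in h1 h2 *.
have -> : y - (t%:R / n.+1%:R - n%:R) = ((y + n%:R) * n.+1%:R - t%:R) / n.+1%:R.
  by rewrite mulrBl mulfK ?gt_eqF// opprB addrA.
rewrite ger0_norm ?divr_ge0// ?subr_ge0//.
apply: (@le_lt_trans _ _ (n.+1%:R^-1)).
  rewrite ler_pdivrMr// mulVf ?pnatr_eq0// lerBlDr.
  by rewrite nat1r ltW.
by near: n; exact: near_infty_natSinv_lt (PosNum e0).
Unshelve. all: by end_near. Qed.

Let cvg_pairR (T : Type) (F : set_system T) (FF : Filter F) (u v : T -> R)
    (x y : R) : u @ F --> x -> v @ F --> y ->
  (u t, v t) @[t --> F] --> ((x, y) : R * R).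
Proof. exact: cvg_pair. Qed.

Lemma measurable_normc_ext0 f : holomorphic f ->
  measurable_fun right_half (fun p : R * R => normc (ext0 f (p.1 +i* p.2))).
Proof.
move=> hf.
pose h n (p : R * R) := normc (ext0 f (p.1 +i* grid n (idx n p.2))).
apply: (@measurable_fun_cvg _ _ _ _ h) => [n|[x y] /= x0]; last first.
  apply: (cvg_comp (fun n => (x, grid n (idx n y))) _ _
    (@holomorphic_cvg f x y hf x0)).
  by apply: cvg_pairR; [exact: cvg_cst|exact: cvg_grid].
pose E k := right_half `&` (setT `*` [set y | idx n y = k]).
have mE k : measurable (E k).
  apply: measurableI; first exact: measurable_right_half.
  apply: measurableX => //; apply: is_interval_measurable.
  move=> a b /= ak bk z /andP[az zb]; apply/eqP; rewrite eqn_leq.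
  rewrite -{1}bk -ak /idx.
  by rewrite !le_truncn// ler_wpM2r// lerD2r.
have -> : right_half = \bigcup_k E k.
  apply/seteqP; split=> [p p0|p [k _ []//]].
  by exists (idx n p.2).
apply/(measurable_fun_bigcup _ mE) => k.
apply: (@eq_measurable_fun _ _ _ _ _
   ((fun x => normc (ext0 f (x +i* grid n k))) \o fst)).
  by move=> p; rewrite inE /E /h /= => -[_ [_ ->]].
apply: (@measurable_comp _ _ _ _ R R (`]0, +oo[%classic : set R)).
- exact: measurable_itv.
- by move=> _ [p [p0 _] <-]; rewrite /= in_itv/= andbT.
- apply: open_continuous_measurable_fun; first exact: interval_open.
  move=> x; rewrite inE /= in_itv/= andbT => x0.
  apply: (cvg_comp (fun x => (x, grid n k)) _ _
    (@holomorphic_cvg f x (grid n k) hf x0)).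
  by apply: cvg_pairR; [exact: cvg_id|exact: cvg_cst].
- exact: measurable_funTS measurable_fst.
Qed.

Local Notation leb2 := (lebesgue_measure \x lebesgue_measure)%E.
Let dens (alpha : R) f (p : R * R) : R :=
  normc (ext0 f (p.1 +i* p.2)) ^+ 2 * p.1 `^ alpha.

Let dens_ge0 alpha f p : 0 <= dens alpha f p.
Proof. by rewrite mulr_ge0 ?sqr_ge0 ?powR_ge0. Qed.

Let measurable_dens alpha f : holomorphic f ->
  measurable_fun right_half (EFin \o dens alpha f).
Proof.
move=> hf; apply/measurable_EFinP.
apply: (@measurable_funM _ _ _ _
  (fun p : R * R => normc (ext0 f (p.1 +i* p.2)) ^+ 2)
  (fun p : R * R => p.1 `^ alpha)).
  apply: (@measurable_funX _ _ _ _
    (fun p : R * R => normc (ext0 f (p.1 +i* p.2)))).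
  exact: measurable_normc_ext0.
apply: (measurableT_comp (measurable_powR alpha)).
exact: measurable_funTS measurable_fst.
Qed.

Lemma bergman_int_ge0 alpha f : (0 <= bergman_int alpha f)%E.
Proof. by apply: integral_ge0 => p _; rewrite lee_fin dens_ge0. Qed.

Lemma bergman_intZ alpha (k : C) f : holomorphic f ->
  bergman_int alpha (k *: f) = ((normc k ^+ 2)%:E * bergman_int alpha f)%E.
Proof.
move=> hf; rewrite /bergman_int -ge0_integralZl_EFin ?sqr_ge0//.
- apply: eq_integral => p; rewrite inE /right_half /= => p0.
  by rewrite -EFinM !ext0E mulrA -exprMn normcM.
- exact: measurable_right_half.
- by move=> p _; rewrite lee_fin dens_ge0.
- exact: measurable_dens.
Qed.

Lemma bergman_int0 alpha : bergman_int alpha 0 = 0%E.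
Proof.
have := bergman_intZ alpha 0 holomorphic0.
by rewrite scale0r normc0 expr0n /= mul0e.
Qed.

Lemma bergman_intD alpha f g (s t : R) : holomorphic f -> holomorphic g ->
  0 < s -> 0 < t ->
  (bergman_int alpha (f + g)%R <= (1 + t / s)%:E * bergman_int alpha f +
                                (1 + s / t)%:E * bergman_int alpha g)%E.
Proof.
move=> hf hg s0 t0.
have hfg : holomorphic (f + g)%R by rewrite -[f]scale1r; exact: holomorphic_lin.
have ts0 : 0 <= 1 + t / s by rewrite addr_ge0// divr_ge0// ltW.
have st0 : 0 <= 1 + s / t by rewrite addr_ge0// divr_ge0// ltW.
have mD := measurable_right_half.
rewrite /bergman_int -!ge0_integralZl_EFin//; last 4 first.
- by move=> p _; rewrite lee_fin dens_ge0.
- exact: measurable_dens.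
- by move=> p _; rewrite lee_fin dens_ge0.
- exact: measurable_dens.
rewrite -ge0_integralD//; last 4 first.
- by move=> p _; rewrite -EFinM lee_fin mulr_ge0// dens_ge0.
- by apply: measurable_funeM; exact: measurable_dens.
- by move=> p _; rewrite -EFinM lee_fin mulr_ge0// dens_ge0.
- by apply: measurable_funeM; exact: measurable_dens.
apply: (ge0_le_integral leb2 mD).
- by move=> p _; rewrite lee_fin dens_ge0.
- exact: measurable_dens.
- by apply: emeasurable_funD; apply: measurable_funeM; exact: measurable_dens.
move=> p p0; rewrite -!EFinM -EFinD lee_fin !ext0E !mulrA -mulrDl.
apply: ler_wpM2r; first exact: powR_ge0.
set u := normc (f _); set v := normc (g _).
have u0 : 0 <= u := normc_ge0 _.
have v0 : 0 <= v := normc_ge0 _.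
apply: (@le_trans _ _ ((u + v) ^+ 2)).
  rewrite ler_pXn2r ?nnegrE ?addr_ge0 ?normc_ge0//.
  exact: le_normcD.
rewrite -subr_ge0.
have -> : (1 + t / s) * u * u + (1 + s / t) * v * v - (u + v) ^+ 2 =
    (t * u - s * v) ^+ 2 / (s * t).
  by field; rewrite !gt_eqF.
by rewrite divr_ge0 ?sqr_ge0// mulr_ge0// ltW.
Qed.

Lemma bergman_int_eq0 alpha f : holomorphic f -> bergman_int alpha f = 0%E ->
  f = 0.
Proof.
move=> hf If0; apply/funext => -[[x y] z0]; apply/eqP/negPn/negP => fz0.
have mD := measurable_right_half.
have /= [A [mA A0 subA]] : ae_eq leb2 right_half (EFin \o dens alpha f) (cst 0%E).
  apply/ae_eq_integral_abs => //; first exact: measurable_dens.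
  rewrite -[RHS]If0; apply: eq_integral => p _.
  by rewrite gee0_abs// lee_fin dens_ge0.
have c0 : 0 < normc (ext0 f (x +i* y)).
  rewrite lt_neqAle normc_ge0 andbT eq_sym; apply: contra fz0 => /eqP.
  by move=> /eq0_normc; rewrite ext0E => ->.
have [e /= e0 He] : exists2 e : R, 0 < e &
    ball x e `*` ball y e `<=`
    [set p | 0 < p.1 /\ 0 < normc (ext0 f (p.1 +i* p.2))].
  have [[B1 B2] /= [[e1 e10 B1e] [e2 e20 B2e]] HB] :
      nbhs (x, y) [set p : R * R | 0 < p.1 /\
                                   0 < normc (ext0 f (p.1 +i* p.2))].
    apply: filterI.
      have c1 : p.1 @[p --> (x, y)] --> x by exact: cvg_fst.
      exact: (c1 _ (lt_nbhsr z0)).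
    exact: (@holomorphic_cvg f x y hf z0 _ (lt_nbhsr c0)).
  exists (Num.min e1 e2); first by rewrite lt_min e10.
  move=> p [/= p1 p2]; apply: HB; split => /=.
    by apply: B1e; apply: le_ball p1; rewrite ge_min lexx.
  by apply: B2e; apply: le_ball p2; rewrite ge_min lexx orbT.
have : (leb2 (ball x e `*` ball y e) <= leb2 A)%E.
  apply: le_measure; rewrite ?inE//.
    by apply: measurableX; exact: measurable_ball.
  move=> p /He[p0 fp0]; apply: subA => /= /(_ p0) /eqP.
  rewrite eqe /dens mulf_eq0 expf_eq0 /= gt_eqF//=.
  by rewrite gt_eqF// powR_gt0.
rewrite A0 product_measure1E; [|exact: measurable_ball|exact: measurable_ball].
change ((lebesgue_measure (ball x e) * lebesgue_measure (ball y e) <= 0)%E ->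
  False).
rewrite (lebesgue_measure_ball x (ltW e0)) (lebesgue_measure_ball y (ltW e0)).
rewrite -EFinM lee_fin leNgt.
by rewrite mulr_gt0// mulrn_wgt0.
Qed.

End HalfPlane.

Section Bergman.
Variables (R : realType) (alpha : R).

Definition bergman_pred : {pred half_plane R -> R[i]^o} :=
  fun f => `[< holomorphic f /\ (bergman_int alpha f < +oo)%E >].

Record bergman := Bergman {
  bergman_fun :> half_plane R -> R[i]^o;
  _ : bergman_fun \in bergman_pred }.

HB.instance Definition _ := [isSub for bergman_fun].
HB.instance Definition _ := [Choice of bergman by <:].

Lemma bergman_predP f : reflect
  (holomorphic f /\ (bergman_int alpha f < +oo)%E) (f \in bergman_pred).
Proof. exact: asboolP. Qed.

Lemma bergman_submod_closed : submod_closed bergman_pred.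
Proof.
split=> [|k f g /bergman_predP[hf If] /bergman_predP[hg Ig]].
  by apply/bergman_predP; rewrite bergman_int0; split=> //; exact: holomorphic0.
have h0 : holomorphic (0 : half_plane R -> R[i]^o) := @holomorphic0 R.
apply/bergman_predP; split; first exact: holomorphic_lin.
have hkf : holomorphic (k *: f) by rewrite -[_ *: _]addr0; exact: holomorphic_lin.
apply: le_lt_trans (bergman_intD alpha hkf hg (@ltr01 R) (@ltr01 R)) _.
rewrite bergman_intZ//.
by rewrite lte_add_pinfty// !lte_mul_pinfty ?mule_ge0 ?lee_fin ?sqr_ge0
  ?addr_ge0 ?divr_ge0 ?bergman_int_ge0.
Qed.

HB.instance Definition _ := GRing.isSubmodClosed.Build R[i]
  (half_plane R -> R[i]^o) bergman_pred bergman_submod_closed.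
HB.instance Definition _ := [SubChoice_isSubLmodule of bergman by <:].

Definition bergman_norm (f : bergman) : R[i] :=
  (Num.sqrt (fine (bergman_int alpha f)))%:C.

Let bergman_holo (f : bergman) : holomorphic f.
Proof. by have /bergman_predP[] := valP f. Qed.

Let bergman_fin (f : bergman) : bergman_int alpha f \is a fin_num.
Proof.
by have /bergman_predP[_ ?] := valP f; rewrite ge0_fin_numE// bergman_int_ge0.
Qed.

Let fine_bergman_ge0 (f : bergman) : 0 <= fine (bergman_int alpha f).
Proof. by rewrite fine_ge0// bergman_int_ge0. Qed.

Lemma bergman_normr0_eq0 (f : bergman) : bergman_norm f = 0 -> f = 0.
Proof.
move=> [/eqP]; rewrite sqrtr_eq0 => If.
apply/val_inj/(@bergman_int_eq0 _ alpha); first exact: bergman_holo.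
rewrite -(fineK (bergman_fin f)); congr EFin.
by apply/eqP; rewrite eq_le If fine_bergman_ge0.
Qed.

Lemma bergman_normrZ (k : R[i]) (f : bergman) :
  bergman_norm (k *: f) = `|k| * bergman_norm f.
Proof.
rewrite /bergman_norm [bergman_fun (k *: f)]/= bergman_intZ//.
rewrite fineM//= sqrtrM ?sqr_ge0// sqrtr_sqr ger0_norm ?normc_ge0//.
by rewrite rmorphM.
Qed.

Lemma bergman_ler_normD (f g : bergman) :
  bergman_norm (f + g) <= bergman_norm f + bergman_norm g.
Proof.
rewrite -rmorphD lecR.
set s := Num.sqrt (fine (bergman_int alpha f)).
set t := Num.sqrt (fine (bergman_int alpha g)).
have [s0|s0] := eqVneq s 0.
  have -> : f = 0 by apply: bergman_normr0_eq0; rewrite /bergman_norm -/s s0.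
  by rewrite add0r s0 add0r.
have [t0|t0] := eqVneq t 0.
  have -> : g = 0 by apply: bergman_normr0_eq0; rewrite /bergman_norm -/t t0.
  by rewrite addr0 t0 addr0.
have {}s0 : 0 < s by rewrite lt_neqAle eq_sym s0 sqrtr_ge0.
have {}t0 : 0 < t by rewrite lt_neqAle eq_sym t0 sqrtr_ge0.
rewrite -(@ler_pXn2r _ 2) ?nnegrE ?sqrtr_ge0 ?addr_ge0 ?sqrtr_ge0//.
rewrite sqr_sqrtr// -lee_fin fineK//.
apply: le_trans (bergman_intD alpha (@bergman_holo f) (@bergman_holo g) s0 t0) _.
rewrite -(fineK (bergman_fin f)) -(fineK (bergman_fin g)) -!EFinM -EFinD lee_fin.
rewrite -(sqr_sqrtr (fine_bergman_ge0 f)) -(sqr_sqrtr (fine_bergman_ge0 g)).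
rewrite -/s -/t le_eqVlt; apply/orP; left; apply/eqP.
by field; rewrite !gt_eqF.
Qed.

(* The completeness of this space is not needed to state n-supercyclicity. *)
HB.instance Definition _ := Lmodule_isNormed.Build R[i] bergman
  bergman_ler_normD bergman_normrZ bergman_normr0_eq0.

End Bergman.

Section Supercyclic.
Variables (K : numFieldType) (V : normedModType K).

Definition lin_independent (n : nat) (e : 'I_n -> V) :=
  forall c : 'I_n -> K, \sum_(i < n) c i *: e i = 0 -> forall i, c i = 0.

Definition lin_span (n : nat) (e : 'I_n -> V) : set V :=
  range (fun c : 'I_n -> K => \sum_(i < n) c i *: e i).

Definition subspace_of_dim (n : nat) (E : set V) :=
  exists2 e : 'I_n -> V, lin_independent e & E = lin_span e.

Definition n_supercyclic (n : nat) (T : V -> V) :=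
  exists2 E : set V, subspace_of_dim n E &
    dense (\bigcup_(k in [set: nat]) (iter k T @` E)).

End Supercyclic.

Section AffineSymbols.
Variable R : realType.
Implicit Types (a : R) (b : R[i]).

Lemma affine_half_plane a b (w : half_plane R) : 0 < a -> 0 <= complex.Re b ->
  0 < complex.Re (a%:C * val w + b).
Proof.
case: w b => -[x y] /= x0 [b1 b2] /= a0 hb.
by rewrite mul0r subr0 ltr_wpDr// mulr_gt0.
Qed.

Definition affine_symbol a b (a_gt0 : 0 < a) (b_ge0 : 0 <= complex.Re b)
    (w : half_plane R) : half_plane R :=
  exist _ (a%:C * val w + b) (affine_half_plane w a_gt0 b_ge0).

(* The default value 0 of [insubd] is irrelevant for affine symbols, since
   composition with them maps the Bergman space into itself. *)
Definition composition_op (alpha : R) (phi : half_plane R -> half_plane R)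
    (f : bergman alpha) : bergman alpha :=
  insubd 0 (bergman_fun f \o phi).

Definition hyperbolic a := a != 1.

Definition hyperbolic_automorphism a b := hyperbolic a /\ complex.Re b = 0.

(* Types I and II classify the hyperbolic symbols which are not automorphisms,
   according to whether the fixed point b / (1 - a) lies in the open right
   half-plane (0 < a < 1) or in the open left one (1 < a).  For a hyperbolic
   automorphism, the composition operator is a scalar multiple of a unitary
   operator, whatever the value of a. *)
Definition hyperbolic_typeII a b :=
  [/\ hyperbolic a, ~ hyperbolic_automorphism a b & 1 < a].

End AffineSymbols.

(* Main.v *)
(* Write S_s f = f(. + s) for s >= 0. Cauchy's theorem on vertical strips shows that
   S_s is a positive symmetric contraction, and C_phi is a multiple of an isometry
   composed with S_s for s = Re b.

   If a > 1 and Re b > 0, then C_phi is even supercyclic: it satisfies a hypercyclicity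
   criterion up to scalars, because S_s f tends to 0 as s grows, and because on the
   dense range of a suitable S_s the composition operator has right inverses whose
   norms grow at the rate at which the norms of the iterates of C_phi decay.

   If Re b = 0, or if a < 1, the value at a point of a vector of C_phi^k(E) is
   asymptotically negligible with respect to its norm, uniformly on E (the case
   a = 1, b = 0 being trivial).

   There remains a = 1, Re b > 0. For a finite-dimensional E, the log-convexity of the
   moments <S_(kt) f, f> implies that a fixed real polynomial in the shift by Re b
   is asymptotically small on C_phi^k(E), relative to the norm. If the orbit of E were
   dense this polynomial would vanish identically, which dilations forbid. *)

(* Two obstacles shape the proof. When alpha < 0 the weight x^alpha decreases, so comparing
   integrals directly does not show that shifts are contractions. That comes instead from convexity
   in the shift parameter together with a growth exponent below 1, and alpha > -1 enters there.
   Secondly, C_phi need not be invertible, so an orbit cannot simply be restarted from a later time.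
   The shifts are injective and symmetric, hence have dense range, and this replaces invertibility:
   if the orbit of E is dense, so is each of its tails, which makes asymptotic estimates in k
   usable. Symmetry also stands in for the spectral theorem. With sg k = S_(kt), the ratios of
   consecutive squared norms of sg k f increase to the top of the spectral support of f for sg 2.
   Approximate annihilation by a product of factors sg 2 - r says that the iterates of a
   finite-dimensional space concentrate near finitely many spectral values. Completeness and
   separability, used by the limit and Baire type arguments, rest on point evaluation estimates
   derived from Cauchy's formula. *)
Require Import Defs.
From HB Require Import structures.
From mathcomp Require Import all_boot all_order all_algebra complex.
From mathcomp Require Import all_classical all_reals all_analysis.
From mathcomp Require Import ring lra.
Set Implicit Arguments.
Unset Strict Implicit.
Unset Printing Implicit Defensive.
Import Order.TTheory GRing.Theory Num.Theory.
Import numFieldNormedType.Exports Normc measurable_realfun.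

Local Open Scope classical_set_scope.
Local Open Scope complex_scope.
Local Open Scope ring_scope.

(** * Complex numbers and complex derivatives *)

Section ComplexNorm.
Variable R : realType.
Implicit Types z w : R[i].

Lemma normc_real (x : R) : normc x%:C = `|x|.
Proof. by rewrite /= expr0n addr0 sqrtr_sqr. Qed.

Lemma normci : normc ('i : R[i]) = 1.
Proof. by rewrite /= expr0n expr1n add0r sqrtr1. Qed.

Lemma normc_ge_absRe z : `|complex.Re z| <= normc z.
Proof. by case: z => x y /=; rewrite -sqrtr_sqr ler_wsqrtr// lerDl sqr_ge0. Qed.

Lemma normc_ge_absIm z : `|complex.Im z| <= normc z.
Proof. by case: z => x y /=; rewrite -sqrtr_sqr ler_wsqrtr// lerDr sqr_ge0. Qed.

Lemma normcB_sym z w : normc (z - w) = normc (w - z).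
Proof. by rewrite -opprB normcN. Qed.

Lemma normcX z n : normc (z ^+ n) = normc z ^+ n.
Proof. by elim: n => [|n IH]; rewrite ?expr0 ?normc1// !exprS normcM IH. Qed.

Lemma normc_gt0 z : (0 < normc z) = (z != 0).
Proof.
rewrite lt_neqAle normc_ge0 andbT eq_sym; congr negb.
by apply/eqP/eqP => [/eq0_normc//|->]; exact: normc0.
Qed.

Lemma sqr_normcE z : normc z ^+ 2 = complex.Re z ^+ 2 + complex.Im z ^+ 2.
Proof. by case: z => x y /=; rewrite sqr_sqrtr// addr_ge0// sqr_ge0. Qed.

Lemma ReD z w : complex.Re (z + w) = complex.Re z + complex.Re w.
Proof. by case: z w => ? ? []. Qed.

Lemma ImD z w : complex.Im (z + w) = complex.Im z + complex.Im w.
Proof. by case: z w => ? ? []. Qed.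

Lemma ReB z w : complex.Re (z - w) = complex.Re z - complex.Re w.
Proof. by case: z w => ? ? []. Qed.

Lemma ImB z w : complex.Im (z - w) = complex.Im z - complex.Im w.
Proof. by case: z w => ? ? []. Qed.

Lemma ReM z w : complex.Re (z * w) =
  complex.Re z * complex.Re w - complex.Im z * complex.Im w.
Proof. by case: z w => ? ? []. Qed.

Lemma ImM z w : complex.Im (z * w) =
  complex.Re z * complex.Im w + complex.Im z * complex.Re w.
Proof. by case: z w => ? ? []. Qed.

Lemma cvg_Re (T : Type) (F : set_system T) (FF : Filter F) (u : T -> R[i]^o)
    (l : R[i]^o) : u @ F --> l ->
  complex.Re (u x) @[x --> F] --> complex.Re l.
Proof.
move=> ul; apply/cvgrPdist_lt => e e0.
have e0' : 0 < e%:C :> R[i]^o by rewrite ltcR.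
move/cvgrPdist_lt : ul => /(_ _ e0'); apply: filterS => t.
rewrite normcE' ltcR; apply: le_lt_trans.
by rewrite -ReB; exact: normc_ge_absRe.
Qed.

Lemma cvg_Im (T : Type) (F : set_system T) (FF : Filter F) (u : T -> R[i]^o)
    (l : R[i]^o) : u @ F --> l ->
  complex.Im (u x) @[x --> F] --> complex.Im l.
Proof.
move=> ul; apply/cvgrPdist_lt => e e0.
have e0' : 0 < e%:C :> R[i]^o by rewrite ltcR.
move/cvgrPdist_lt : ul => /(_ _ e0'); apply: filterS => t.
rewrite normcE' ltcR; apply: le_lt_trans.
by rewrite -ImB; exact: normc_ge_absIm.
Qed.

Lemma cvg_cplx (T : Type) (F : set_system T) (FF : Filter F) (u v : T -> R)
    (x y : R) : u @ F --> x -> v @ F --> y ->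
  ((u t +i* v t) : R[i]^o) @[t --> F] --> ((x +i* y) : R[i]^o).
Proof.
move=> ux vy.
exact: (cvg_comp (fun t => (u t, v t)) (fun p : R * R => (p.1 +i* p.2) : R[i]^o)
  (cvg_pair ux vy) (@cvg_Complex R x y)).
Qed.

Lemma cvgcP (T : Type) (F : set_system T) (FF : Filter F) (u : T -> R[i]^o)
    (l : R[i]^o) :
  u @ F --> l <-> forall e : R, 0 < e -> \forall t \near F, normc (u t - l) < e.
Proof.
split=> [/cvgrPdist_lt ul e e0|h].
  have e0' : 0 < e%:C :> R[i]^o by rewrite ltcR.
  by apply: filterS (ul _ e0') => t; rewrite normcE' ltcR normcB_sym.
apply/cvgrPdist_lt => -[e e'] e0.
have := e0; rewrite ltcE /= => /andP[/eqP ee' {}e0]; subst e'.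
by apply: filterS (h _ e0) => t; rewrite normcE' ltcR normcB_sym.
Qed.

Lemma nbhscP (z : R[i]^o) (P : set R[i]^o) :
  nbhs z P <-> exists2 d : R, 0 < d & forall w, normc (w - z) < d -> P w.
Proof.
split=> [/nbhs_ballP[[e e'] /= e0 h]|[d d0 h]].
  have := e0; rewrite ltcE /= => /andP[/eqP ee' {}e0]; subst e'.
  exists e => // w wz; apply: h; rewrite /ball/= /ball_ /=.
  by rewrite normcE' ltcR normcB_sym.
apply/nbhs_ballP; exists d%:C; rewrite /= ?ltcR// => w.
by rewrite /ball/= /ball_ /= normcE' ltcR normcB_sym => /h.
Qed.

End ComplexNorm.

Section ComplexDerivative.
Variable R : realType.
Local Notation C := R[i]^o.
Implicit Types f g : C -> C.

(* [derivable] over the field [R[i]], unfolded into inequalities between real numbers. *)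
Definition cdiff f (z : C) := exists l : R[i], forall e : R, 0 < e ->
  exists2 d : R, 0 < d & forall w : R[i], normc (w - z) < d ->
    normc (f w - f z - l * (w - z)) <= e * normc (w - z).

Lemma cdiffP f z : derivable f z 1 <-> cdiff f z.
Proof.
split.
  move=> /cvg_ex[/= l fl]; exists l => e e0.
  have e0' : 0 < e%:C :> C by rewrite ltcR.
  move/cvgrPdist_lt : fl => /(_ _ e0').
  move=> /nbhs_ballP[[d d'] /= d0 h].
  have := d0; rewrite ltcE /= => /andP[/eqP dd' {}d0]; subst d'.
  exists d => // w wz.
  have [->|wz0] := eqVneq w z; first by rewrite !subrr mulr0 subr0 normc0 mulr0.
  have wz0' : w - z != 0 by rewrite subr_eq0.
  have := h (w - z); rewrite /ball/= /ball_ /= sub0r normcE' normcN ltcR => /(_ wz wz0').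
  rewrite normcE' ltcR => hh.
  have -> : f w - f z - l * (w - z) =
     - (l - (w - z)^-1 *: (f ((w - z) *: (1 : C) + z) - f z)) * (w - z).
    rewrite [(w - z) *: (1 : C)]/GRing.scale/= mulr1 subrK.
    rewrite [(w - z)^-1 *: _]/GRing.scale/=.
    by field.
  by rewrite normcM normcN ler_wpM2r ?normc_ge0// ltW.
move=> [l h]; apply/cvg_ex; exists l; apply/cvgrPdist_le => -[e e'] e0.
have := e0; rewrite ltcE /= => /andP[/eqP ee' {}e0]; subst e'.
have [d d0 {}h] := h _ e0.
apply/nbhs_ballP; exists d%:C; rewrite /= ?ltcR// => w.
rewrite /ball/= /ball_ /= sub0r normcE' normcN ltcR => wd w0.
have := h (w + z); rewrite addrK => /(_ wd) hh.
rewrite normcE' lecR [w *: (1:C)]/GRing.scale/= mulr1 [w^-1 *: _]/GRing.scale/=.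
have -> : l - w^-1 * (f (w + z) - f z) = - (f (w + z) - f z - l * w) / w.
  by field.
rewrite normcM normcN normcV ler_pdivrMr// normc_gt0//.
Qed.

Lemma cdiff_cvg f z : cdiff f z -> f @ z --> f z.
Proof.
by move/cdiffP/derivable1_diffP => h; exact: differentiable_continuous.
Qed.

Lemma cdiff_cst (k : C) z : cdiff (fun=> k) z.
Proof. by apply/cdiffP; exact: derivable_cst. Qed.

Lemma cdiff_id z : cdiff id z.
Proof. by apply/cdiffP; exact: derivable_id. Qed.

Lemma cdiffD f g z : cdiff f z -> cdiff g z -> cdiff (fun w => f w + g w) z.
Proof.
by move=> /cdiffP hf /cdiffP hg; apply/cdiffP; exact: derivableD.
Qed.

Lemma cdiffB f g z : cdiff f z -> cdiff g z -> cdiff (fun w => f w - g w) z.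
Proof.
by move=> /cdiffP hf /cdiffP hg; apply/cdiffP; exact: derivableB.
Qed.

Lemma cdiffM f g z : cdiff f z -> cdiff g z -> cdiff (fun w => f w * g w) z.
Proof.
move=> /cdiffP hf /cdiffP hg; apply/cdiffP.
exact: (@derivableM R[i] C (f : C -> R[i]) (g : C -> R[i]) z 1 hf hg).
Qed.

Lemma cdiffV f z : f z != 0 -> cdiff f z -> cdiff (fun w => (f w)^-1) z.
Proof.
move=> fz /cdiffP hf; apply/cdiffP.
exact: (@derivableV R[i] C (f : C -> R[i]) z 1 fz hf).
Qed.

Lemma cdiffX f n z : cdiff f z -> cdiff (fun w => f w ^+ n) z.
Proof.
move=> hf; elim: n => [|n IH].
  by under [X in cdiff X]eq_fun do rewrite expr0; exact: cdiff_cst.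
by under [X in cdiff X]eq_fun do rewrite exprS; exact: cdiffM.
Qed.

Lemma cdiff_near f g z (d : R) : 0 < d ->
  (forall w, normc (w - z) < d -> f w = g w) -> cdiff f z -> cdiff g z.
Proof.
move=> d0 fg [l h]; exists l => e /h[d' d'0 {}h].
exists (Num.min d d'); first by rewrite lt_min d0.
move=> w; rewrite lt_min => /andP[wd wd'].
by rewrite -!fg ?subrr ?normc0//; exact: h.
Qed.

Lemma cdiff_affine f (a b : C) z : cdiff f (a * z + b) ->
  cdiff (fun w => f (a * w + b)) z.
Proof.
move=> [l h]; exists (a * l) => e e0.
have a1 : 0 < normc a + 1 by rewrite ltr_wpDl// normc_ge0.
have [|d d0 {}h] := h (e / (normc a + 1)); first exact: divr_gt0.
exists (d / (normc a + 1)); first exact: divr_gt0.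
move=> w; rewrite ltr_pdivlMr// => wd.
have E : (a * w + b) - (a * z + b) = a * (w - z) by ring.
have := h (a * w + b); rewrite E normcM.
have n0 := normc_ge0 (w - z).
have m0 := normc_ge0 a.
rewrite mulrA [l * a]mulrC => hh; apply: le_trans (hh _) _; first nra.
rewrite mulrA ler_wpM2r// -mulrA ger_pMr// mulrC ler_pdivrMr//; lra.
Qed.

(** Reflection: this makes z |-> conj(g(S - conj z)), the second factor in [contour],
    holomorphic. *)
Lemma cdiff_conj f z : cdiff f (conjc z) -> cdiff (fun w => conjc (f (conjc w))) z.
Proof.
move=> [l h]; exists (conjc l) => e /h[d d0 {}h]; exists d => // w wd.
have J (u : C) : normc (conjc u) = normc u.
  by case: u => x y /=; rewrite sqrrN.
have E : w - z = conjc (conjc w - conjc z) by rewrite rmorphB /= !conjcK.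
have := h (conjc w); rewrite -[X in normc X < _ -> _]conjcK J -E => /(_ wd).
by rewrite -[X in X <= _ -> _]J 2!rmorphB rmorphM/= -E -[X in e * X]J -E.
Qed.

End ComplexDerivative.

(** * Integrals along rectangles, Cauchy's formula, sub-mean value inequality *)

Section ComplexIntegral.
Variable R : realType.
Local Notation C := R[i]^o.
Local Notation leb := (@lebesgue_measure R).
Implicit Types (D : set R) (g h : R -> R[i]).

Definition cint D g : R[i] :=
  (\int[leb]_(x in D) complex.Re (g x)) +i* (\int[leb]_(x in D) complex.Im (g x)).

Definition cintegrable D g :=
  leb.-integrable D (EFin \o (fun x => complex.Re (g x))) /\
  leb.-integrable D (EFin \o (fun x => complex.Im (g x))).

(** The limits are two-sided even at the endpoints: the integrands come from functions continuous
    around the segment. *)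
Definition cseg (a b : R) (g : R -> R[i]) :=
  forall x, a <= x <= b -> (g : R -> C) @ x --> (g x : C).

Lemma seg_integrable (a b : R) (u : R -> R) :
  (forall x, a <= x <= b -> u @ x --> u x) -> leb.-integrable `[a, b] (EFin \o u).
Proof.
move=> cu; apply: continuous_compact_integrable; first exact: segment_compact.
by apply: continuous_in_subspaceT => x; rewrite inE/= in_itv/= => /cu.
Qed.

Lemma cseg_integrable a b g : cseg a b g -> cintegrable `[a, b] g.
Proof.
move=> cg; split; apply: seg_integrable => x /cg h.
- exact: (@cvg_Re R _ _ _ g).
- exact: (@cvg_Im R _ _ _ g).
Qed.

Lemma eq_cint D g h : (forall x, D x -> g x = h x) -> cint D g = cint D h.
Proof.
by move=> gh; congr Complex; apply: eq_Rintegral => x /set_mem /gh ->.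
Qed.

Lemma cintD D g h : measurable D -> cintegrable D g -> cintegrable D h ->
  cint D (fun x => g x + h x) = cint D g + cint D h.
Proof.
move=> mD [g1 g2] [h1 h2]; rewrite /cint /=.
under eq_Rintegral do rewrite ReD.
under [in X in _ +i* X]eq_Rintegral do rewrite ImD.
by rewrite !RintegralD.
Qed.

Lemma cintZ D (k : R[i]) g : measurable D -> cintegrable D g ->
  cint D (fun x => k * g x) = k * cint D g.
Proof.
move=> mD [g1 g2].
have iZ (r : R) (u : R -> R) : leb.-integrable D (EFin \o u) ->
    leb.-integrable D (EFin \o (fun x => r * u x)).
  move=> iu; rewrite (_ : EFin \o _ = (fun x => r%:E * (u x)%:E)%E).
    exact: integrableZl.
  by apply/funext => x /=; rewrite EFinM.
apply/eqP; rewrite eq_complex ReM ImM /=; apply/andP; split; apply/eqP.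
- under eq_Rintegral do rewrite ReM.
  by rewrite RintegralB ?RintegralZl//; exact: iZ.
- under eq_Rintegral do rewrite ImM.
  by rewrite RintegralD ?RintegralZl//; exact: iZ.
Qed.

Lemma cint_cst (a b : R) (k : R[i]) : a <= b ->
  cint `[a, b] (fun=> k) = k * (b - a)%:C.
Proof.
move=> ab; rewrite /cint !Rintegral_cst//.
rewrite /= lebesgue_measure_itv/= lte_fin; case: ltP => [_|ba] /=.
  by case: k => x y /=; simpc; congr Complex; ring.
have -> : b = a by apply/le_anti; rewrite ba.
by rewrite subrr !mulr0.
Qed.

Lemma Rint_split (a c b : R) (u : R -> R) : a <= c -> c <= b ->
  leb.-integrable `[a, b] (EFin \o u) ->
  \int[leb]_(x in `[a, b]) u x =
  \int[leb]_(x in `[a, c]) u x + \int[leb]_(x in `[c, b]) u x.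
Proof.
move=> ac cb iu.
have := @Rintegral_itvB R u (BLeft a) (BRight b) c iu.
rewrite !bnd_simp => /(_ ac cb) E.
rewrite -(Rintegral_itv_obnd_cbnd (r := c)); first by rewrite -E; ring.
by apply: integrableS iu => //; apply: subset_itvr; rewrite bnd_simp.
Qed.

Lemma cint_split (a c b : R) g : a <= c -> c <= b -> cintegrable `[a, b] g ->
  cint `[a, b] g = cint `[a, c] g + cint `[c, b] g.
Proof. by move=> ac cb [g1 g2]; rewrite /cint /= !(Rint_split ac cb). Qed.

Lemma Rint_bound (a b M : R) (u : R -> R) : a <= b ->
  leb.-integrable `[a, b] (EFin \o u) ->
  (forall x, a <= x <= b -> `|u x| <= M) ->
  `|\int[leb]_(x in `[a, b]) u x| <= M * (b - a).
Proof.
move=> ab iu uM; apply: le_trans (le_normr_Rintegral _ iu) _ => //.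
have -> : M * (b - a) = \int[leb]_(x in `[a, b]) M.
  rewrite Rintegral_cst//= lebesgue_measure_itv/= lte_fin.
  case: ltP => //= ba; have -> : b = a by apply/le_anti; rewrite ba.
  by rewrite subrr.
apply: le_Rintegral => //.
- exact: (integrable_abse iu).
- by apply: seg_integrable => x _; exact: cvg_cst.
Qed.

(* The factor 2 comes from bounding the real and imaginary parts separately. *)
Lemma cint_bound (a b M : R) g : a <= b -> cintegrable `[a, b] g ->
  (forall x, a <= x <= b -> normc (g x) <= M) ->
  normc (cint `[a, b] g) <= 2 * M * (b - a).
Proof.
move=> ab [g1 g2] gM; apply: le_trans (normc_Complex _ _) _.
have -> : 2 * M * (b - a) = M * (b - a) + M * (b - a) by ring.
apply: lerD; apply: Rint_bound => // x /gM; apply: le_trans.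
- exact: normc_ge_absRe.
- exact: normc_ge_absIm.
Qed.

Lemma csegM a b g h : cseg a b g -> cseg a b h -> cseg a b (fun x => g x * h x).
Proof.
by move=> cg ch x xab; apply: (@cvgM R[i] _ (nbhs x)); [exact: cg|exact: ch].
Qed.

Lemma csegZ a b (k : R[i]) g : cseg a b g -> cseg a b (fun x => k * g x).
Proof. by move=> cg; apply: (@csegM a b (fun=> k) g _ cg) => x _; exact: cvg_cst. Qed.

End ComplexIntegral.

(** * Goursat's theorem on rectangles *)

Section Goursat.
Variable R : realType.
Local Notation C := R[i]^o.
Implicit Types f g : C -> C.

Definition rect (x1 x2 y1 y2 : R) : set C :=
  [set z | x1 <= complex.Re z <= x2 /\ y1 <= complex.Im z <= y2].

Definition rcont f (x1 x2 y1 y2 : R) := forall z, rect x1 x2 y1 y2 z -> f @ z --> f z.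

(** The counterclockwise integral of f(z) dz along the boundary, with dz = dx on the horizontal
    edges and dz = i dy on the vertical ones. *)
Definition bd f (x1 x2 y1 y2 : R) : R[i] :=
  cint `[x1, x2] (fun x => f (x +i* y1)) - cint `[x1, x2] (fun x => f (x +i* y2)) +
  'i * (cint `[y1, y2] (fun y => f (x2 +i* y)) - cint `[y1, y2] (fun y => f (x1 +i* y))).

Lemma rcont_sub f x1 x2 y1 y2 u1 u2 v1 v2 :
  x1 <= u1 -> u2 <= x2 -> y1 <= v1 -> v2 <= y2 ->
  rcont f x1 x2 y1 y2 -> rcont f u1 u2 v1 v2.
Proof.
move=> h1 h2 h3 h4 cf z [/andP[a1 a2] /andP[a3 a4]]; apply: cf.
by split; apply/andP; split; lra.
Qed.

Lemma cseg_h f (y : R) x1 x2 : (forall x, x1 <= x <= x2 -> f @ (x +i* y : C) --> f (x +i* y)) ->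
  cseg x1 x2 (fun x => f (x +i* y)).
Proof.
move=> cf x xx; apply: (cvg_comp (fun x => (x +i* y : C)) f) (cf _ xx).
by apply: cvg_cplx; [exact: cvg_id|exact: cvg_cst].
Qed.

Lemma cseg_v f (x : R) y1 y2 : (forall y, y1 <= y <= y2 -> f @ (x +i* y : C) --> f (x +i* y)) ->
  cseg y1 y2 (fun y => f (x +i* y)).
Proof.
move=> cf y yy; apply: (cvg_comp (fun y => (x +i* y : C)) f) (cf _ yy).
by apply: cvg_cplx; [exact: cvg_cst|exact: cvg_id].
Qed.

Definition rbd (x1 x2 y1 y2 : R) : set C :=
  [set z | rect x1 x2 y1 y2 z /\
    [\/ complex.Re z = x1, complex.Re z = x2, complex.Im z = y1 | complex.Im z = y2]].

(** Continuity is asked on the boundary alone, because Cauchy kernels have a pole inside the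
    rectangle. *)
Definition bcont f (x1 x2 y1 y2 : R) := forall z, rbd x1 x2 y1 y2 z -> f @ z --> f z.

Lemma rcont_bcont f x1 x2 y1 y2 : rcont f x1 x2 y1 y2 -> bcont f x1 x2 y1 y2.
Proof. by move=> cf z [zQ _]; exact: cf. Qed.

Lemma bcont_edges f x1 x2 y1 y2 : x1 <= x2 -> y1 <= y2 -> bcont f x1 x2 y1 y2 ->
  [/\ cintegrable `[x1, x2] (fun x => f (x +i* y1)),
      cintegrable `[x1, x2] (fun x => f (x +i* y2)),
      cintegrable `[y1, y2] (fun y => f (x1 +i* y)) &
      cintegrable `[y1, y2] (fun y => f (x2 +i* y))].
Proof.
move=> xx yy cf; split.
- by apply/cseg_integrable/cseg_h => t tt; apply: cf; split;
    [split; rewrite //= lexx|constructor 3].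
- by apply/cseg_integrable/cseg_h => t tt; apply: cf; split;
    [split; rewrite //= lexx ?andbT|constructor 4].
- by apply/cseg_integrable/cseg_v => t tt; apply: cf; split;
    [split; rewrite //= lexx|constructor 1].
- by apply/cseg_integrable/cseg_v => t tt; apply: cf; split;
    [split; rewrite //= lexx ?andbT|constructor 2].
Qed.

Lemma bd_splitx f x1 x2 y1 y2 x : x1 <= x -> x <= x2 -> y1 <= y2 ->
  bcont f x1 x2 y1 y2 -> bd f x1 x2 y1 y2 = bd f x1 x y1 y2 + bd f x x2 y1 y2.
Proof.
move=> h1 h2 h3 cf; have [i1 i2 _ _] := bcont_edges (le_trans h1 h2) h3 cf.
rewrite /bd (cint_split h1 h2 i1) (cint_split h1 h2 i2); ring.
Qed.

Lemma bd_splity f x1 x2 y1 y2 y : y1 <= y -> y <= y2 -> x1 <= x2 ->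
  bcont f x1 x2 y1 y2 -> bd f x1 x2 y1 y2 = bd f x1 x2 y1 y + bd f x1 x2 y y2.
Proof.
move=> h1 h2 h3 cf; have [_ _ i1 i2] := bcont_edges h3 (le_trans h1 h2) cf.
rewrite /bd (cint_split h1 h2 i1) (cint_split h1 h2 i2); ring.
Qed.

Lemma eq_bd f g x1 x2 y1 y2 : x1 <= x2 -> y1 <= y2 ->
  (forall z, rbd x1 x2 y1 y2 z -> f z = g z) -> bd f x1 x2 y1 y2 = bd g x1 x2 y1 y2.
Proof.
move=> xx yy fg; rewrite /bd; congr (_ - _ + _ * (_ - _));
  apply: eq_cint => t; rewrite /= in_itv/= => tt; apply: fg;
  (split; first by split; rewrite /= ?lexx ?xx ?yy).
- by constructor 3.
- by constructor 4.
- by constructor 2.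
- by constructor 1.
Qed.

Lemma bdD f g x1 x2 y1 y2 : x1 <= x2 -> y1 <= y2 ->
  bcont f x1 x2 y1 y2 -> bcont g x1 x2 y1 y2 ->
  bd (fun z => f z + g z) x1 x2 y1 y2 = bd f x1 x2 y1 y2 + bd g x1 x2 y1 y2.
Proof.
move=> xx yy cf cg.
have [f1 f2 f3 f4] := bcont_edges xx yy cf.
have [g1 g2 g3 g4] := bcont_edges xx yy cg.
rewrite /bd !cintD//; ring.
Qed.

Lemma bdZ (k : R[i]) f x1 x2 y1 y2 : x1 <= x2 -> y1 <= y2 ->
  bcont f x1 x2 y1 y2 ->
  bd (fun z => k * f z) x1 x2 y1 y2 = k * bd f x1 x2 y1 y2.
Proof.
move=> xx yy cf; have [f1 f2 f3 f4] := bcont_edges xx yy cf.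
rewrite /bd !cintZ//; ring.
Qed.

Lemma rcont_cst (k : C) x1 x2 y1 y2 : rcont (fun=> k) x1 x2 y1 y2.
Proof. by move=> z _; exact: (cdiff_cvg (@cdiff_cst R k z)). Qed.

Lemma rcont_id x1 x2 y1 y2 : rcont id x1 x2 y1 y2.
Proof. by move=> z _; exact: (cdiff_cvg (@cdiff_id R z)). Qed.

Lemma rcontD f g x1 x2 y1 y2 : rcont f x1 x2 y1 y2 -> rcont g x1 x2 y1 y2 ->
  rcont (fun z => f z + g z) x1 x2 y1 y2.
Proof.
by move=> cf cg z zQ; exact: (@cvgD _ C _ _ _ f g _ _ (cf z zQ) (cg z zQ)).
Qed.

Lemma rcontM f g x1 x2 y1 y2 : rcont f x1 x2 y1 y2 -> rcont g x1 x2 y1 y2 ->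
  rcont (fun z => f z * g z) x1 x2 y1 y2.
Proof.
move=> cf cg z zQ.
exact: (@cvgM R[i] C (nbhs z) _ (f : C -> R[i]) (g : C -> R[i]) _ _ (cf z zQ) (cg z zQ)).
Qed.

Lemma bd_cst (k : C) x1 x2 y1 y2 : bd (fun=> k) x1 x2 y1 y2 = 0.
Proof. by rewrite /bd !subrr mulr0 addr0. Qed.

(** On opposite edges the integrands differ by the constants i (y1 - y2) and x2 - x1. Multiplied by
    the lengths, and by i for the vertical pair, these cancel. *)
Lemma bd_id x1 x2 y1 y2 : x1 <= x2 -> y1 <= y2 -> bd id x1 x2 y1 y2 = 0.
Proof.
move=> xx yy; rewrite /bd.
have ih y : cintegrable `[x1, x2] (fun x : R => x +i* y).
  by apply/cseg_integrable/(@cseg_h id) => x _; apply: (@rcont_id x x y y); rewrite /rect/= !lexx.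
have iv x : cintegrable `[y1, y2] (fun y : R => x +i* y).
  by apply/cseg_integrable/(@cseg_v id) => y _; apply: (@rcont_id x x y y); rewrite /rect/= !lexx.
have ic a b (k : R[i]) : cintegrable `[a, b] (fun=> k).
  by apply: cseg_integrable => t _; exact: cvg_cst.
have -> : cint `[x1, x2] (fun x => x +i* y1) =
    cint `[x1, x2] (fun x => x +i* y2) + cint `[x1, x2] (fun=> 0 +i* (y1 - y2)).
  rewrite -cintD//; apply: eq_cint => x _; simpc; congr Complex; ring.
have -> : cint `[y1, y2] (fun y => x2 +i* y) =
    cint `[y1, y2] (fun y => x1 +i* y) + cint `[y1, y2] (fun=> (x2 - x1)%:C).
  rewrite -cintD//; apply: eq_cint => x _; simpc; congr Complex; ring.
rewrite !cint_cst// [X in X + _]addrAC subrr add0r [X in _ + _ * X]addrAC subrr add0r.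
by simpc; apply/eqP; rewrite eq_complex/=; apply/andP; split; apply/eqP; ring.
Qed.

Lemma bd_affine (k l : C) x1 x2 y1 y2 : x1 <= x2 -> y1 <= y2 ->
  bd (fun z => k + l * z) x1 x2 y1 y2 = 0.
Proof.
move=> xx yy; rewrite bdD//.
- by rewrite bd_cst add0r bdZ ?bd_id ?mulr0//; exact/rcont_bcont/rcont_id.
- exact/rcont_bcont/rcont_cst.
- by apply/rcont_bcont/rcontM; [exact: rcont_cst|exact: rcont_id].
Qed.

Lemma bd_bound f (M : R) x1 x2 y1 y2 : x1 <= x2 -> y1 <= y2 ->
  bcont f x1 x2 y1 y2 -> (forall z, rbd x1 x2 y1 y2 z -> normc (f z) <= M) ->
  normc (bd f x1 x2 y1 y2) <= 4 * M * ((x2 - x1) + (y2 - y1)).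
Proof.
move=> xx yy cf fM; have [i1 i2 i3 i4] := bcont_edges xx yy cf.
have h1 : normc (cint `[x1, x2] (fun x => f (x +i* y1))) <= 2 * M * (x2 - x1).
  by apply: cint_bound => // t tt; apply: fM; split;
    [split; rewrite //= lexx|constructor 3].
have h2 : normc (cint `[x1, x2] (fun x => f (x +i* y2))) <= 2 * M * (x2 - x1).
  by apply: cint_bound => // t tt; apply: fM; split;
    [split; rewrite //= lexx ?andbT|constructor 4].
have h3 : normc (cint `[y1, y2] (fun y => f (x1 +i* y))) <= 2 * M * (y2 - y1).
  by apply: cint_bound => // t tt; apply: fM; split;
    [split; rewrite //= lexx|constructor 1].
have h4 : normc (cint `[y1, y2] (fun y => f (x2 +i* y))) <= 2 * M * (y2 - y1).
  by apply: cint_bound => // t tt; apply: fM; split;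
    [split; rewrite //= lexx ?andbT|constructor 2].
apply: le_trans (le_normcD _ _) _; rewrite [leRHS]mulrDr; apply: lerD.
  apply: le_trans (le_normcD _ _) _; rewrite normcN; lra.
rewrite normcM normci mul1r; apply: le_trans (le_normcD _ _) _; rewrite normcN; lra.
Qed.

Lemma nested_intervals (u v : nat -> R) :
  (forall n, u n <= u n.+1) -> (forall n, v n.+1 <= v n) -> (forall n, u n <= v n) ->
  exists z, forall n, u n <= z <= v n.
Proof.
move=> uS vS uv.
have um m n : (m <= n)%N -> u m <= u n.
  by move=> /subnK <-; elim: (n - m)%N => // k /le_trans; apply; rewrite addSn.
have vm m n : (m <= n)%N -> v n <= v m.
  by move=> /subnK <-; elim: (n - m)%N => // k; apply: le_trans; rewrite addSn.
have ub n : ubound (range u) (v n).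
  move=> _ [m _ <-]; apply: (@le_trans _ _ (u (maxn m n))).
    by apply: um; rewrite leq_maxl.
  by apply: le_trans (uv _) _; apply: vm; rewrite leq_maxr.
exists (sup (range u)) => n; apply/andP; split.
  apply: ub_le_sup; last by exists n.
  by exists (v 0%N).
by apply: ge_sup; [exists (u 0%N); exists 0%N|exact: ub].
Qed.

Lemma norm4_lt (E q1 q2 q3 q4 : R[i]) : E = q1 + q2 + (q3 + q4) ->
  4 * normc q1 < normc E -> 4 * normc q2 < normc E -> 4 * normc q3 < normc E ->
  4 * normc q4 < normc E -> False.
Proof.
move=> EE; have : normc E <= normc q1 + normc q2 + (normc q3 + normc q4).
  rewrite EE; apply: le_trans (le_normcD _ _) _.
  by apply: lerD; exact: le_normcD.
lra.
Qed.

Section Bisection.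
Variables (f : C -> C) (W H : R).
Hypotheses (W0 : 0 <= W) (H0 : 0 <= H).

Let Q (n : nat) (p : R * R) :=
  bd f p.1 (p.1 + W / 2 ^+ n) p.2 (p.2 + H / 2 ^+ n).

Let quarter (n : nat) (p : R * R) (b c : bool) : R * R :=
  (p.1 + (b%:R : R) * (W / 2 ^+ n.+1), p.2 + (c%:R : R) * (H / 2 ^+ n.+1)).

Let big n p b c := normc (Q n p) <= 4 * normc (Q n.+1 (quarter n p b c)).

(** The last quarter is the default: by [norm4_lt] the four integrals cannot all fail the test. *)
Let step n p :=
  if big n p false false then quarter n p false false else
  if big n p false true then quarter n p false true else
  if big n p true false then quarter n p true false else quarter n p true true.

Let stepE n p : exists b c, step n p = quarter n p b c.
Proof.
rewrite /step; case: ifP => _; first by exists false, false.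
case: ifP => _; first by exists false, true.
by case: ifP => _; [exists true, false|exists true, true].
Qed.

Let halfE (D : R) n : D / 2 ^+ n = D / 2 ^+ n.+1 + D / 2 ^+ n.+1.
Proof. by rewrite exprS; field; rewrite expf_neq0. Qed.

Let half_ge0 (D : R) n : 0 <= D -> 0 <= D / 2 ^+ n.
Proof. by move=> D0; rewrite divr_ge0// exprn_ge0. Qed.

Let step_big n p :
  rcont f p.1 (p.1 + W / 2 ^+ n) p.2 (p.2 + H / 2 ^+ n) ->
  normc (Q n p) <= 4 * normc (Q n.+1 (step n p)).
Proof.
move=> cf.
suff E : Q n p = Q n.+1 (quarter n p false false) + Q n.+1 (quarter n p false true) +
    (Q n.+1 (quarter n p true false) + Q n.+1 (quarter n p true true)).
  rewrite /step; case: ifPn => //; rewrite /big -ltNge => h1.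
  case: ifPn => //; rewrite -ltNge => h2; case: ifPn => //; rewrite -ltNge => h3.
  rewrite leNgt; apply/negP => h4.
  exact: (norm4_lt E h1 h2 h3 h4).
have W2 := half_ge0 n.+1 W0; have H2 := half_ge0 n.+1 H0.
move: cf; rewrite /Q /quarter /= !mul0r !mul1r !addr0 (halfE W) (halfE H).
move: (W / 2 ^+ n.+1) (H / 2 ^+ n.+1) W2 H2 (p.1) (p.2) => w h w0 h0 u v cf.
have u1 : u <= u + w by rewrite lerDl.
have u2 : u + w <= u + (w + w) by rewrite addrA lerDl.
have v1 : v <= v + h by rewrite lerDl.
have v2 : v + h <= v + (h + h) by rewrite addrA lerDl.
have u3 := le_trans u1 u2; have v3 := le_trans v1 v2.
have cL : bcont f u (u + w) v (v + (h + h)) by apply/rcont_bcont; exact: rcont_sub cf.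
have cR : bcont f (u + w) (u + (w + w)) v (v + (h + h)).
  by apply/rcont_bcont; exact: rcont_sub cf.
rewrite (bd_splitx u1 u2 v3 (rcont_bcont cf)) (bd_splity v1 v2 u1 cL).
by rewrite (bd_splity v1 v2 u2 cR) !addrA.
Qed.

Let Fixpoint corner (p : R * R) (n : nat) : R * R :=
  if n is m.+1 then step m (corner p m) else p.

Lemma Goursat_bisection (x y : R) :
  (forall z, rect x (x + W) y (y + H) z -> cdiff f z) ->
  bd f x (x + W) y (y + H) = 0.
Proof.
move=> df; pose c := corner (x, y).
have W2 n := half_ge0 n W0; have H2 n := half_ge0 n H0.
have cS n : [/\ (c n).1 <= (c n.+1).1, (c n).2 <= (c n.+1).2,
    (c n.+1).1 + W / 2 ^+ n.+1 <= (c n).1 + W / 2 ^+ n &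
    (c n.+1).2 + H / 2 ^+ n.+1 <= (c n).2 + H / 2 ^+ n].
  rewrite /c /= -/(c n); have [b [b' ->]] := stepE n (c n).
  rewrite /quarter/= (halfE W n) (halfE H n).
  move: (W / 2 ^+ n.+1) (H / 2 ^+ n.+1) (W2 n.+1) (H2 n.+1) (c n).1 (c n).2 => w h w0 h0 u v.
  by case: b; case: b'; rewrite /= ?mul0r ?mul1r ?addr0; split; lra.
have [X HX] : exists X, forall n, (c n).1 <= X <= (c n).1 + W / 2 ^+ n.
  apply: (@nested_intervals (fun n => (c n).1) (fun n => (c n).1 + W / 2 ^+ n)) => n.
  - by case: (cS n).
  - by case: (cS n).
  - by rewrite lerDl W2.
have [Y HY] : exists Y, forall n, (c n).2 <= Y <= (c n).2 + H / 2 ^+ n.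
  apply: (@nested_intervals (fun n => (c n).2) (fun n => (c n).2 + H / 2 ^+ n)) => n.
  - by case: (cS n).
  - by case: (cS n).
  - by rewrite lerDl H2.
have inQ n : [/\ x <= (c n).1, y <= (c n).2, (c n).1 + W / 2 ^+ n <= x + W &
    (c n).2 + H / 2 ^+ n <= y + H].
  elim: n => [|n [i1 i2 i3 i4]]; first by rewrite /c/= expr0 !divr1.
  by case: (cS n) => j1 j2 j3 j4; split; lra.
have cf : rcont f x (x + W) y (y + H) by move=> z /df; exact: cdiff_cvg.
have cfn n : rcont f (c n).1 ((c n).1 + W / 2 ^+ n) (c n).2 ((c n).2 + H / 2 ^+ n).
  by case: (inQ n) => i1 i2 i3 i4; apply: rcont_sub cf.
have Qn n : normc (bd f x (x + W) y (y + H)) <= 4 ^+ n * normc (Q n (c n)).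
  elim: n => [|n IH]; first by rewrite /Q /c /= expr0 !divr1 mul1r.
  apply: le_trans IH _; rewrite exprSr -mulrA ler_wpM2l ?exprn_ge0//.
  exact: step_big.
have [l hl] : cdiff f (X +i* Y).
  apply: df; have := HX 0%N; have := HY 0%N; rewrite /c/= expr0 !divr1.
  by split.
pose D := W + H; have D0 : 0 <= D by rewrite addr_ge0.
apply: eq0_normc; apply/le_anti; rewrite normc_ge0 andbT.
apply/ler_addgt0Pr => e e0; rewrite add0r.
(* The 4 is the constant of [bd_bound]; diameter and half-perimeter at stage n are each at most D /
   2^n, whose product D^2 / 4^n compensates the 4^n of the bisection. *)
have D1 : 0 < 4 * (D ^+ 2 + 1) by rewrite mulr_gt0// ltr_wpDl// sqr_ge0.
have [|d d0 hd] := hl (e / (4 * (D ^+ 2 + 1))); first exact: divr_gt0.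
have [n nd] : exists n, D / 2 ^+ n < d.
  exists (Num.truncn (D / d)).+1; rewrite ltr_pdivrMr ?exprn_gt0//.
  rewrite mulrC -ltr_pdivrMr//.
  apply: lt_le_trans (truncnS_gt _) _.
  by rewrite -natrX ler_nat; apply: ltnW; exact: ltn_expl.
set e1 := e / _ in hd.
have e10 : 0 < e1 by exact: divr_gt0.
have := HX n; have := HY n; set cn := c n => /andP[Y1 Y2] /andP[X1 X2].
have dist z : rect cn.1 (cn.1 + W / 2 ^+ n) cn.2 (cn.2 + H / 2 ^+ n) z ->
    normc (z - (X +i* Y)) <= D / 2 ^+ n.
  move=> [/andP[a1 a2] /andP[a3 a4]].
  have -> : z - (X +i* Y) = (complex.Re z - X) +i* (complex.Im z - Y) by case: (z).
  apply: le_trans (normc_Complex _ _) _; rewrite mulrDl; apply: lerD.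
  - by rewrite ler_norml; apply/andP; split; lra.
  - by rewrite ler_norml; apply/andP; split; lra.
(* Subtracting the affine part leaves the boundary integral unchanged, and what remains is o(w - z)
   at the limit point of the nested rectangles. *)
pose err z := f z - f (X +i* Y) - l * (z - (X +i* Y)).
pose aff z := (f (X +i* Y) - l * (X +i* Y)) + l * z.
have cna : rcont aff cn.1 (cn.1 + W / 2 ^+ n) cn.2 (cn.2 + H / 2 ^+ n).
  by apply: rcontD; [exact: rcont_cst|apply: rcontM; [exact: rcont_cst|exact: rcont_id]].
have cnn : rcont (fun z => (-1) * aff z) cn.1 (cn.1 + W / 2 ^+ n) cn.2 (cn.2 + H / 2 ^+ n).
  exact: (@rcontM (fun=> -1) aff _ _ _ _ (@rcont_cst _ _ _ _ _) cna).
have errE : err = fun z => f z + (-1) * aff z.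
  by apply/funext => z; rewrite /err /aff; ring.
have w1 : cn.1 <= cn.1 + W / 2 ^+ n by rewrite lerDl W2.
have h1 : cn.2 <= cn.2 + H / 2 ^+ n by rewrite lerDl H2.
have QE : Q n cn = bd err cn.1 (cn.1 + W / 2 ^+ n) cn.2 (cn.2 + H / 2 ^+ n).
  rewrite errE (@bdD f (fun z => -1 * aff z) _ _ _ _ w1 h1 (rcont_bcont (cfn n)) (rcont_bcont cnn)).
  by rewrite (@bdZ (-1) aff _ _ _ _ w1 h1 (rcont_bcont cna)) bd_affine// mulr0 addr0.
have cerr : rcont err cn.1 (cn.1 + W / 2 ^+ n) cn.2 (cn.2 + H / 2 ^+ n).
  rewrite errE.
  exact: (@rcontD f (fun z => -1 * aff z) _ _ _ _ (cfn n) cnn).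
have berr z : rect cn.1 (cn.1 + W / 2 ^+ n) cn.2 (cn.2 + H / 2 ^+ n) z ->
    normc (err z) <= e1 * (D / 2 ^+ n).
  move=> zQ; apply: le_trans (hd z _) _; first exact: le_lt_trans (dist z zQ) nd.
  by rewrite ler_wpM2l ?dist// ltW.
have := bd_bound w1 h1 (rcont_bcont cerr) (fun z zb => berr z zb.1); rewrite -QE => bQ.
apply: le_trans (Qn n) _.
apply: le_trans (ler_wpM2l _ bQ) _; first by rewrite exprn_ge0.
have -> : 4 ^+ n * (4 * (e1 * (D / 2 ^+ n)) * (cn.1 + W / 2 ^+ n - cn.1 + (cn.2 + H / 2 ^+ n - cn.2)))
   = 4 * e1 * D ^+ 2.
  have -> : (4 : R) = 2 ^+ 2 by rewrite expr2 -natrM.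
  rewrite -exprM mulnC exprM expr2 /D; field; exact: expf_neq0.
rewrite /e1; have -> : 4 * (e / (4 * (D ^+ 2 + 1))) * D ^+ 2 = e * (D ^+ 2 / (D ^+ 2 + 1)).
  by field; rewrite gt_eqF// ltr_wpDl// sqr_ge0.
by rewrite ger_pMr// ler_pdivrMr ?mul1r ?lerDl// ltr_wpDl// sqr_ge0.
Qed.

End Bisection.

(** The bisection is run with side lengths W and H, which halve uniformly; here corners replace
    them. *)
Theorem Goursat f x1 x2 y1 y2 : x1 <= x2 -> y1 <= y2 ->
  (forall z, rect x1 x2 y1 y2 z -> cdiff f z) -> bd f x1 x2 y1 y2 = 0.
Proof.
move=> xx yy df; have := @Goursat_bisection f (x2 - x1) (y2 - y1) _ _ x1 y1.
by rewrite !subr_ge0 !subrKC; exact.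
Qed.

End Goursat.

(** * Cauchy's formula on rectangles *)

Section Cauchy.
Variable R : realType.
Local Notation C := R[i]^o.
Local Notation leb := (@lebesgue_measure R).
Implicit Types f g : C -> C.

Lemma Rint_affine (a r : R) (G : R -> R) : 0 < r ->
  (forall t : R, -1 <= t <= 1 -> G @ t --> G t) ->
  \int[leb]_(x in `[a - r, a + r]) G ((x - a) / r) = r * \int[leb]_(t in `[-1, 1]) G t.
Proof.
move=> r0 cG; pose F (x : R) := (x - a) * r^-1.
have dF (x : R) : is_derive x (1 : R) F r^-1.
  apply: is_derive_eq; rewrite /GRing.scale/=; ring.
have F1 : derive1 F = cst r^-1.
  by apply/funext => x; rewrite derive1E; exact: derive_val.
have cF : continuous F.
  by move=> x; apply/differentiable_continuous/derivable1_diffP.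
have arE : F (a - r) = -1 by rewrite /F; field; rewrite gt_eqF.
have brE : F (a + r) = 1 by rewrite /F; field; rewrite gt_eqF.
have := @integration_by_substitution_increasing R F G (a - r) (a + r).
rewrite arE brE => H.
have -> : \int[leb]_(t in `[-1, 1]) G t =
    \int[leb]_(x in `[a - r, a + r]) (G ((x - a) / r) * r^-1).
  rewrite /Rintegral H.
  - by congr fine; apply: eq_integral => x _; rewrite F1.
  - lra.
  - by move=> x y _ _ xy; rewrite /F ltr_pM2r ?invr_gt0// ltrD2r.
  - by move=> x _; rewrite F1; exact: cvg_cst.
  - by rewrite F1; exact: is_cvg_cst.
  - by rewrite F1; exact: is_cvg_cst.
  - by split => [x _//||]; [exact/cvg_at_right_filter/cF|exact/cvg_at_left_filter/cF].
  - by apply: continuous_in_subspaceT => t; rewrite inE/= in_itv/= => /cG.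
rewrite RintegralZr//; first by rewrite mulrCA divff ?mulr1// gt_eqF.
apply: seg_integrable => x xab.
apply: (cvg_comp F G) (cF x) (cG _ _).
by rewrite /F ler_pdivlMr// ler_pdivrMr//; apply/andP; split; lra.
Qed.

Lemma cint_affine (a r : R) (g : R -> R[i]) : 0 < r -> cseg (-1) 1 g ->
  cint `[a - r, a + r] (fun x => g ((x - a) / r)) = r%:C * cint `[-1, 1] g.
Proof.
move=> r0 cg; rewrite /cint.
rewrite (@Rint_affine a r (fun t => complex.Re (g t)))//; last first.
  by move=> t /cg h; exact: (@cvg_Re R _ _ _ g).
rewrite (@Rint_affine a r (fun t => complex.Im (g t)))//; last first.
  by move=> t /cg h; exact: (@cvg_Im R _ _ _ g).
by simpc.
Qed.

(* Stands for 2 pi i; only the fact that it does not vanish is used. *)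
Definition cauchyJ : R[i] := bd (fun w : C => w^-1) (-1) 1 (-1) 1.

Lemma cvg_inv (z : C) : z != 0 -> (fun w : C => w^-1 : C) @ z --> (z^-1 : C).
Proof.
by move=> z0; apply: (@cdiff_cvg R (fun w => w^-1)); apply: cdiffV => //; exact: cdiff_id.
Qed.

Lemma sq_bd_neq0 z : rbd (-1 : R) 1 (-1) 1 z -> z != 0.
Proof.
case=> _ h; apply/eqP => z0; case: h; rewrite z0 /= => /eqP;
  by rewrite eq_sym ?oppr_eq0 oner_eq0.
Qed.

(** The form dw / (w - c) is invariant under translation and scaling: the factor r from the lengths
    cancels the r^-1 from the kernel. *)
Lemma bd_inv_sq (a b r : R) : 0 < r ->
  bd (fun w : C => (w - (a +i* b))^-1) (a - r) (a + r) (b - r) (b + r) = cauchyJ.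
Proof.
move=> r0.
have r0' : r%:C != 0 :> R[i] by rewrite eq_complex/= negb_and gt_eqF.
have cJ : bcont (fun w : C => w^-1) (-1) 1 (-1) 1.
  by move=> z /sq_bd_neq0; exact: cvg_inv.
have h11 : -1 <= 1 :> R by lra.
have [i1 i2 i3 i4] := bcont_edges h11 h11 cJ.
have sh y : (y = -1) \/ (y = 1) -> cseg (-1) 1 (fun t => (t +i* y)^-1 : R[i]).
  move=> hy; apply: (@cseg_h R (fun w => w^-1)) => x xx; apply: cJ.
  by case: hy => ->; split; [split; rewrite ?lexx//= h11|constructor 3|split; rewrite ?lexx//= h11|constructor 4].
have sv x : (x = -1) \/ (x = 1) -> cseg (-1) 1 (fun t => (x +i* t)^-1 : R[i]).
  move=> hx; apply: (@cseg_v R (fun w => w^-1)) => y yy; apply: cJ.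
  by case: hx => ->; split; [split; rewrite ?lexx//= h11|constructor 1|split; rewrite ?lexx//= h11|constructor 2].
have EH y (Y : R) : Y - b = y * r ->  (y = -1) \/ (y = 1) ->
  cint `[a - r, a + r] (fun x => ((x +i* Y) - (a +i* b))^-1) =
  cint `[-1, 1] (fun t => (t +i* y)^-1).
  move=> hY hy.
  rewrite (_ : cint `[a - r, a + r] _ = cint `[a - r, a + r] (fun x => (r%:C)^-1 *
    (((x - a) / r) +i* y)^-1)).
    rewrite (@cint_affine a r (fun t => (r%:C)^-1 * (t +i* y)^-1))//; last first.
      exact/csegZ/sh.
    by rewrite cintZ//; [rewrite mulrA divff// mul1r|exact/cseg_integrable/sh].
  apply: eq_cint => x _; rewrite -invfM; congr _^-1.
  have -> : Y = b + y * r by rewrite -hY addrC subrK.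
  apply/eqP; rewrite eq_complex/=; apply/andP; split; apply/eqP; last by ring.
  by field; rewrite gt_eqF.
have EV x (X : R) : X - a = x * r -> (x = -1) \/ (x = 1) ->
  cint `[b - r, b + r] (fun y => ((X +i* y) - (a +i* b))^-1) =
  cint `[-1, 1] (fun t => (x +i* t)^-1).
  move=> hX hx.
  rewrite (_ : cint `[b - r, b + r] _ = cint `[b - r, b + r] (fun y => (r%:C)^-1 *
    (x +i* ((y - b) / r))^-1)).
    rewrite (@cint_affine b r (fun t => (r%:C)^-1 * (x +i* t)^-1))//; last first.
      exact/csegZ/sv.
    by rewrite cintZ//; [rewrite mulrA divff// mul1r|exact/cseg_integrable/sv].
  apply: eq_cint => y _; rewrite -invfM; congr _^-1.
  have -> : X = a + x * r by rewrite -hX addrC subrK.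
  apply/eqP; rewrite eq_complex/=; apply/andP; split; apply/eqP; first by ring.
  by field; rewrite gt_eqF.
have e1 (c : R) : c - r - c = -1 * r by ring.
have e2 (c : R) : c + r - c = 1 * r by ring.
have m1 : (-1 = -1 :> R) \/ (-1 = 1 :> R) by left.
have p1 : (1 = -1 :> R) \/ (1 = 1 :> R) by right.
by rewrite /cauchyJ /bd (EH _ _ (e1 b) m1) (EH _ _ (e2 b) p1) (EV _ _ (e2 a) p1)
  (EV _ _ (e1 a) m1).
Qed.

(** Each edge contributes to the imaginary part the integral over [-1, 1] of 1 / (t^2 + 1), which is
    at least 1 because the integrand is at least 1/2. *)
Lemma cauchyJ_neq0 : cauchyJ != 0.
Proof.
suff : 0 < complex.Im cauchyJ by apply: contraTneq => ->; rewrite ltxx.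
have cJ : bcont (fun w : C => w^-1) (-1) 1 (-1) 1.
  by move=> z /sq_bd_neq0; exact: cvg_inv.
have h11 : -1 <= 1 :> R by lra.
have [[_ i1] [_ i2] [i3 _] [i4 _]] := bcont_edges h11 h11 cJ.
have ImE (D : set R) (g : R -> R[i]) : complex.Im (cint D g) = \int[leb]_(x in D) complex.Im (g x) by [].
have ReE (D : set R) (g : R -> R[i]) : complex.Re (cint D g) = \int[leb]_(x in D) complex.Re (g x) by [].
have Rei : complex.Re ('i : R[i]) = 0 by [].
have Imi : complex.Im ('i : R[i]) = 1 by [].
rewrite /cauchyJ /bd ImD ImB ImM ReB !ImE !ReE Rei Imi mul0r add0r mul1r {ImE ReE}.
have lb (u : R -> R) : leb.-integrable `[-1, 1] (EFin \o u) ->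
    (forall t : R, -1 <= t <= 1 -> 2^-1 <= u t) -> 1 <= \int[leb]_(t in `[-1, 1]) u t.
  move=> iu hu.
  have -> : 1 <= \int[leb]_(t in `[-1, 1]) u t =
      (\int[leb]_(t in `[-1, 1]) (2^-1 : R) <= \int[leb]_(t in `[-1, 1]) u t).
    congr (_ <= _); rewrite Rintegral_cst//= lebesgue_measure_itv/= lte_fin ifT/=; last by lra.
    by field.
  apply: le_Rintegral => //.
    by apply: seg_integrable => x _; exact: cvg_cst.
have h (t : R) : -1 <= t <= 1 -> 2^-1 <= 1 / (t ^+ 2 + 1).
  move=> tt; rewrite ler_pdivlMr; last by rewrite ltr_wpDl// sqr_ge0.
  nra.
have P1 : 1 <= \int[leb]_(t in `[-1, 1]) complex.Im ((t +i* (-1))^-1 : R[i]).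
  apply: lb => // t /h; rewrite /= sqrrN expr1n => hh; lra.
have P2 : 1 <= - \int[leb]_(t in `[-1, 1]) complex.Im ((t +i* 1)^-1 : R[i]).
  rewrite -[leRHS]mulN1r -RintegralZl//; apply: lb.
    rewrite (_ : EFin \o _ = (fun x => (-1)%:E * (complex.Im ((x +i* 1)^-1 : R[i]))%:E)%E).
      exact: integrableZl.
    by apply/funext => x /=; rewrite EFinM.
  move=> t /h; rewrite /= expr1n => hh; lra.
have P3 : 1 <= \int[leb]_(t in `[-1, 1]) complex.Re ((1 +i* t)^-1 : R[i]).
  apply: lb => // t /h; rewrite /= expr1n addrC => hh; lra.
have P4 : 1 <= - \int[leb]_(t in `[-1, 1]) complex.Re (((-1) +i* t)^-1 : R[i]).
  rewrite -[leRHS]mulN1r -RintegralZl//; apply: lb.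
    rewrite (_ : EFin \o _ = (fun x => (-1)%:E * (complex.Re ((-1 +i* x)^-1 : R[i]))%:E)%E).
      exact: integrableZl.
    by apply/funext => x /=; rewrite EFinM.
  move=> t /h; rewrite /= sqrrN expr1n addrC => hh; lra.
apply: (lt_le_trans _ (lerD (lerD P1 P2) (lerD P3 P4))); lra.
Qed.

(** Cutting along the sides of the square leaves four rectangles that avoid the singular point;
    [Goursat] makes their integrals vanish. *)
Lemma bd_hole f (x1 x2 y1 y2 a b r : R) : 0 < r -> x1 <= a - r -> a + r <= x2 ->
  y1 <= b - r -> b + r <= y2 ->
  (forall z, rect x1 x2 y1 y2 z -> z != a +i* b -> cdiff f z) ->
  bd f x1 x2 y1 y2 = bd f (a - r) (a + r) (b - r) (b + r).
Proof.
move=> r0 h1 h2 h3 h4 df.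
have sub u1 u2 v1 v2 : x1 <= u1 -> u2 <= x2 -> y1 <= v1 -> v2 <= y2 ->
    ~ rbd u1 u2 v1 v2 (a +i* b) -> bcont f u1 u2 v1 v2.
  move=> k1 k2 k3 k4 nab z zQ; apply/cdiff_cvg/df.
    by case: zQ => -[/andP[? ?] /andP[? ?]] _; split; apply/andP; split; lra.
  by apply/eqP => zE; apply: nab; rewrite -zE.
have hol u1 u2 v1 v2 : x1 <= u1 -> u2 <= x2 -> y1 <= v1 -> v2 <= y2 ->
    u1 <= u2 -> v1 <= v2 -> ~ rect u1 u2 v1 v2 (a +i* b) -> bd f u1 u2 v1 v2 = 0.
  move=> k1 k2 k3 k4 uu vv nab; apply: Goursat => // z zQ; apply: df.
    by case: zQ => /andP[? ?] /andP[? ?]; split; apply/andP; split; lra.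
  by apply/eqP => zE; apply: nab; rewrite -zE.
have -> : bd f x1 x2 y1 y2 = bd f x1 (a - r) y1 y2 + bd f (a - r) x2 y1 y2.
  by apply: bd_splitx; [lra..|apply: sub; [lra..|move=> [_ /=] [] ?; lra]].
have -> : bd f (a - r) x2 y1 y2 = bd f (a - r) (a + r) y1 y2 + bd f (a + r) x2 y1 y2.
  by apply: bd_splitx; [lra..|apply: sub; [lra..|move=> [_ /=] [] ?; lra]].
have -> : bd f (a - r) (a + r) y1 y2 =
    bd f (a - r) (a + r) y1 (b - r) + bd f (a - r) (a + r) (b - r) y2.
  by apply: bd_splity; [lra..|apply: sub; [lra..|move=> [_ /=] [] ?; lra]].
have -> : bd f (a - r) (a + r) (b - r) y2 =
    bd f (a - r) (a + r) (b - r) (b + r) + bd f (a - r) (a + r) (b + r) y2.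
  by apply: bd_splity; [lra..|apply: sub; [lra..|move=> [_ /=] [] ?; lra]].
have -> : bd f x1 (a - r) y1 y2 = 0.
  by apply: hol; [lra..|move=> [/= /andP[? ?] _]; lra].
have -> : bd f (a + r) x2 y1 y2 = 0.
  by apply: hol; [lra..|move=> [/= /andP[? ?] _]; lra].
have -> : bd f (a - r) (a + r) y1 (b - r) = 0.
  by apply: hol; [lra..|move=> [/= _ /andP[? ?]]; lra].
have -> : bd f (a - r) (a + r) (b + r) y2 = 0.
  by apply: hol; [lra..|move=> [/= _ /andP[? ?]]; lra].
by rewrite !add0r !addr0.
Qed.

Lemma sq_bd_dist (a b r : R) z : 0 < r -> rbd (a - r) (a + r) (b - r) (b + r) z ->
  r <= normc (z - (a +i* b)) <= 2 * r.
Proof.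
move=> r0; case: z => x y; rewrite /rbd /rect /= => -[[/andP[x1 x2] /andP[y1 y2]] h].
apply/andP; split; last first.
  apply: le_trans (normc_Complex _ _) _.
  have : `|x - a| <= r by rewrite ler_norml; apply/andP; split; lra.
  have : `|y - b| <= r by rewrite ler_norml; apply/andP; split; lra.
  lra.
have hr := ler_norm r; have hr' := ler_norm (- r); have nr := normrN r.
have [/= X Y] := (normc_ge_absRe ((x +i* y) - (a +i* b)), normc_ge_absIm ((x +i* y) - (a +i* b))).
case: h => h.
- apply: le_trans _ X; rewrite h (_ : a - r - a = - r); last ring; lra.
- apply: le_trans _ X; rewrite h (_ : a + r - a = r); last ring; lra.
- apply: le_trans _ Y; rewrite h (_ : b - r - b = - r); last ring; lra.
- apply: le_trans _ Y; rewrite h (_ : b + r - b = r); last ring; lra.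
Qed.

Theorem Cauchy_rect f (x1 x2 y1 y2 a b : R) : x1 < a < x2 -> y1 < b < y2 ->
  (forall z, rect x1 x2 y1 y2 z -> cdiff f z) ->
  bd (fun w => f w / (w - (a +i* b))) x1 x2 y1 y2 = f (a +i* b) * cauchyJ.
Proof.
move=> /andP[xa ax] /andP[yb by_] df.
set w0 : C := a +i* b.
have w0Q : rect x1 x2 y1 y2 w0 by split => /=; apply/andP; split; lra.
have dw z : cdiff (fun w : C => w - w0) z by apply: cdiffB; [exact: cdiff_id|exact: cdiff_cst].
have dg z : rect x1 x2 y1 y2 z -> z != w0 -> cdiff (fun w => f w / (w - w0)) z.
  move=> zQ zw; apply: cdiffM; first exact: df.
  by apply: cdiffV => //; rewrite subr_eq0.
pose r0 := Num.min (Num.min (a - x1) (x2 - a)) (Num.min (b - y1) (y2 - b)).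
have r00 : 0 < r0 by rewrite /r0 !lt_min !subr_gt0 xa ax yb by_.
have r0P r : r <= r0 -> [/\ x1 <= a - r, a + r <= x2, y1 <= b - r & b + r <= y2].
  by rewrite /r0 !le_min => /andP[/andP[? ?] /andP[? ?]]; split; lra.
apply/eqP; rewrite -subr_eq0; apply/eqP/eq0_normc/le_anti; rewrite normc_ge0 andbT.
apply/ler_addgt0Pr => e e0; rewrite add0r.
(* On the square of half-side r, [bd_bound] multiplies the bound e / 16 / r by 4 * 4 r, which gives
   e. *)
have := cdiff_cvg (df _ w0Q); move=> /cvgcP /(_ (e / 16)).
rewrite divr_gt0// => /(_ isT) /nbhscP[d d0 hd].
pose r := Num.min r0 (d / 3).
have r0' : 0 < r by rewrite lt_min r00 divr_gt0.
have rd : 2 * r < d.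
  have : r <= d / 3 by rewrite /r ge_min lexx orbT.
  lra.
have [k1 k2 k3 k4] : [/\ x1 <= a - r, a + r <= x2, y1 <= b - r & b + r <= y2].
  by apply: r0P; rewrite /r ge_min lexx.
rewrite (@bd_hole _ _ _ _ _ a b r)// -(@bd_inv_sq a b r)//.
have aa : a - r <= a + r by lra.
have bb : b - r <= b + r by lra.
have sq z : rbd (a - r) (a + r) (b - r) (b + r) z -> rect x1 x2 y1 y2 z /\ z - w0 != 0.
  move=> zb; have /andP[h _] := sq_bd_dist r0' zb; split.
    by case: zb => -[/andP[? ?] /andP[? ?]] _; split; apply/andP; split; lra.
  by rewrite -normc_gt0 (lt_le_trans r0').
have ci : bcont (fun w : C => (w - w0)^-1) (a - r) (a + r) (b - r) (b + r).
  by move=> z /sq[_ zw]; apply: (@cdiff_cvg R (fun w => (w - w0)^-1)); exact: cdiffV.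
have cfi : bcont (fun w => f w / (w - w0)) (a - r) (a + r) (b - r) (b + r).
  move=> z /sq[zQ zw]; apply: (@cdiff_cvg R (fun w => f w / (w - w0))); apply: dg => //.
  by rewrite -subr_eq0.
have cki k : bcont (fun w : C => k * (w - w0)^-1) (a - r) (a + r) (b - r) (b + r).
  move=> z /sq[_ zw]; apply: (@cdiff_cvg R (fun w => k * (w - w0)^-1)).
  by apply: cdiffM; [exact: cdiff_cst|exact: cdiffV].
have EZ := @bdZ R (- f w0) (fun w => (w - w0)^-1) _ _ _ _ aa bb ci.
have ED := @bdD R (fun w => f w / (w - w0)) (fun w => - f w0 * (w - w0)^-1) _ _ _ _
  aa bb cfi (cki _).
rewrite -mulNr -EZ -ED.
have -> : (fun z => f z / (z - w0) + - f w0 * (z - w0)^-1) =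
  (fun z => (f z - f w0) / (z - w0)) by apply/funext => z; rewrite [RHS]mulrBl mulNr.
have := @bd_bound R (fun z => (f z - f w0) / (z - w0)) (e / 16 / r) _ _ _ _ aa bb.
have -> : 4 * (e / 16 / r) * (a + r - (a - r) + (b + r - (b - r))) = e.
  by field; rewrite gt_eqF.
apply.
  move=> z /sq[zQ zw]; apply: (@cdiff_cvg R (fun z => (f z - f w0) / (z - w0))).
  apply: cdiffM; last exact: cdiffV.
  by apply: cdiffB; [exact: df|exact: cdiff_cst].
move=> z zb; have /andP[h1 h2] := sq_bd_dist r0' zb.
have h0 : 0 < normc (z - w0) by exact: lt_le_trans r0' h1.
rewrite normcM normcV; apply: ler_pM.
- exact: normc_ge0.
- by rewrite invr_ge0 ltW.
- by apply/ltW/hd; apply: le_lt_trans rd.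
- by rewrite lef_pV2.
Qed.

End Cauchy.

(** * Tonelli's theorem on products of sets, and a mean value argument *)

Section Plane.
Variable R : realType.
Local Notation leb := (@lebesgue_measure R).
Local Notation leb2 := (leb \x leb)%E.
Local Open Scope ereal_scope.

Section Tonelli.
Variables (A B : set R) (g : R * R -> \bar R).
Hypotheses (mA : measurable A) (mB : measurable B).
Hypothesis mg : measurable_fun (A `*` B) g.
Hypothesis g0 : forall p, (A `*` B) p -> 0 <= g p.

Let G := g \_ (A `*` B).

Let mG : measurable_fun setT G.
Proof. exact: (iffLR (measurable_restrictT g (measurableX mA mB)) mg). Qed.

Let G0 p : 0 <= G p.
Proof. by rewrite /G patchE; case: ifPn => // /set_mem; exact: g0. Qed.

Let GxE x : \int[leb]_y G (x, y) =
  ((fun x => \int[leb]_(y in B) g (x, y)) \_ A) x.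
Proof.
rewrite patchE; case: ifPn => [/set_mem Ax|/negP Ax].
  rewrite [RHS]integral_mkcond; apply: eq_integral => y _.
  rewrite /G !patchE; congr (if _ then _ else _).
  apply/idP/idP => [/set_mem[_ ?]|/set_mem ?]; exact: mem_set.
rewrite integral0_eq// => y _; rewrite /G patchE ifF//.
by apply/negP => /set_mem[/mem_set].
Qed.

Let GyE y : \int[leb]_x G (x, y) =
  ((fun y => \int[leb]_(x in A) g (x, y)) \_ B) y.
Proof.
rewrite patchE; case: ifPn => [/set_mem By|/negP By].
  rewrite [RHS]integral_mkcond; apply: eq_integral => x _.
  rewrite /G !patchE; congr (if _ then _ else _).
  apply/idP/idP => [/set_mem[? _]|/set_mem ?]; exact: mem_set.
rewrite integral0_eq// => x _; rewrite /G patchE ifF//.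
by apply/negP => /set_mem[_ /mem_set].
Qed.

Lemma tonelli_x : \int[leb2]_(p in A `*` B) g p =
  \int[leb]_(x in A) \int[leb]_(y in B) g (x, y).
Proof.
rewrite integral_mkcond (@fubini_tonelli1 _ _ _ _ R leb leb G mG G0) [RHS]integral_mkcond.
by apply: eq_integral => x _; rewrite -GxE.
Qed.

Lemma tonelli_y : \int[leb2]_(p in A `*` B) g p =
  \int[leb]_(y in B) \int[leb]_(x in A) g (x, y).
Proof.
rewrite integral_mkcond (@fubini_tonelli1 _ _ _ _ R leb leb G mG G0) (@fubini_tonelli _ _ _ _ R leb leb G mG G0) [RHS]integral_mkcond.
by apply: eq_integral => y _; rewrite -GyE.
Qed.

Lemma measurable_tonelli_x : measurable_fun A (fun x => \int[leb]_(y in B) g (x, y)).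
Proof.
apply: (iffRL (measurable_restrictT _ mA)).
rewrite (_ : _ \_ A = fubini_F leb G); first exact: measurable_fun_fubini_tonelli_F.
by apply/funext => x; rewrite -GxE.
Qed.

Lemma measurable_tonelli_y : measurable_fun B (fun y => \int[leb]_(x in A) g (x, y)).
Proof.
apply: (iffRL (measurable_restrictT _ mB)).
rewrite (_ : _ \_ B = fubini_G leb G); first exact: measurable_fun_fubini_tonelli_G.
by apply/funext => y; rewrite -GyE.
Qed.

End Tonelli.

Lemma exists_le_mean (D : set R) (d M : R) (H : R -> \bar R) : measurable D ->
  leb D = d%:E -> (0 < d)%R -> measurable_fun D H -> (forall x, D x -> 0 <= H x) ->
  \int[leb]_(x in D) H x < M%:E -> exists2 x, D x & H x <= (M / d)%:E.
Proof.
move=> mD Dd d0 mH H0 IM; apply: contrapT => h.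
have M0 : (0 < M)%R.
  by rewrite -lte_fin; apply: le_lt_trans IM; exact: integral_ge0.
have : \int[leb]_(x in D) cst (M / d)%:E x <= \int[leb]_(x in D) H x.
  apply: ge0_le_integral => //.
  - by move=> x _; rewrite lee_fin divr_ge0// ltW.
  - move=> x Dx; rewrite leNgt; apply/negP => Hx; apply: h; exists x => //.
    exact: ltW.
rewrite integral_cst//=; move: Dd => /= ->; rewrite -EFinM divfK ?gt_eqF// => MI.
by move: (lt_le_trans IM MI); rewrite ltxx.
Qed.

End Plane.

Section CintNorm.
Variable R : realType.
Local Notation C := R[i]^o.
Local Notation leb := (@lebesgue_measure R).

Lemma cseg_normc (a b : R) (g : R -> R[i]) : cseg a b g ->
  leb.-integrable `[a, b] (EFin \o (fun x => normc (g x))).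
Proof.
by move=> cg; apply: seg_integrable => x /cg h; exact: (@cvg_normc R _ _ _ g).
Qed.

Lemma cint_le_normc (a b : R) (g : R -> R[i]) : cseg a b g ->
  normc (cint `[a, b] g) <= 2 * \int[leb]_(x in `[a, b]) normc (g x).
Proof.
move=> cg; have [g1 g2] := cseg_integrable cg; have ng := cseg_normc cg.
apply: le_trans (normc_Complex _ _) _.
rewrite mulrDl mul1r; apply: lerD; apply: le_trans (le_normr_Rintegral _ _) _ => //;
  apply: le_Rintegral => //.
- exact: (integrable_abse g1).
- by move=> x _; exact: normc_ge_absRe.
- exact: (integrable_abse g2).
- by move=> x _; exact: normc_ge_absIm.
Qed.

End CintNorm.

(** * Sub-mean value inequalities for |f| and |f|^2 *)

Section SubMean.
Variable R : realType.
Local Notation C := R[i]^o.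
Local Notation leb := (@lebesgue_measure R).
Local Notation leb2 := (leb \x leb)%E.
Implicit Types f g : half_plane R -> C.

Lemma hol_cdiff f (z : C) : holomorphic f -> 0 < complex.Re z -> cdiff (ext0 f) z.
Proof. by move=> hf z0; apply/cdiffP; exact: (hf (exist _ z z0)). Qed.

Lemma cdiff_hol (F : C -> C) (f : half_plane R -> C) :
  (forall z : half_plane R, f z = F (val z)) ->
  (forall z, 0 < complex.Re z -> cdiff F z) -> holomorphic f.
Proof.
move=> fF dF [z z0]; apply/cdiffP => /=.
apply: (@cdiff_near R F _ _ (complex.Re z)) (dF z z0) => // w wz.
have w0 : 0 < complex.Re w.
  have := le_lt_trans (normc_ge_absRe (w - z)) wz; rewrite ReB ltr_norml => /andP[]; lra.
by rewrite ext0E fF.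
Qed.

Lemma hol_mul f g : holomorphic f -> holomorphic g ->
  holomorphic (fun z => f z * g z : C).
Proof.
move=> hf hg; apply: (@cdiff_hol (fun z => ext0 f z * ext0 g z)).
  by case=> z z0; rewrite !ext0E.
by move=> z z0; apply: (@cdiffM R (ext0 f) (ext0 g)); exact: hol_cdiff.
Qed.

Definition sq (a b h : R) : set (R * R) := `[a - h, a + h] `*` `[b - h, b + h].

Lemma measurable_sq a b h : measurable (sq a b h).
Proof. by apply: measurableX; exact: measurable_itv. Qed.

Lemma sub_sq_right_half a b h : h < a -> sq a b h `<=` @right_half R.
Proof.
move=> ha [x y] [/= + _]; rewrite in_itv/= /right_half/= => /andP[xa _].
by apply: lt_le_trans xa; rewrite subr_gt0.
Qed.

(** In [submean1] each of the four edges contributes at most 8 M / h^2; the constant 64 leaves a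
    factor 2 to spare. *)
Definition submeanC : R := 64 / normc (cauchyJ R).

Lemma submeanC_gt0 : 0 < submeanC.
Proof. by rewrite divr_gt0// normc_gt0 cauchyJ_neq0. Qed.

(* Some rectangle between the squares of half-sides [h / 2] and [h] has the
   property that the integral of |f| over each of its edges is at most the average one;
   Cauchy's formula is applied on that rectangle. *)
Lemma submean1 f (a b h : R) : holomorphic f -> 0 < h -> h < a ->
  ((normc (ext0 f (a +i* b)) * h ^+ 2)%:E <= submeanC%:E *
    \int[leb2]_(p in sq a b h) (normc (ext0 f (p.1 +i* p.2)))%:E)%E.
Proof.
move=> hf h0 ha.
set I := (\int[leb2]_(p in sq a b h) _)%E.
have I0 : (0 <= I)%E by apply: integral_ge0 => p _; rewrite lee_fin normc_ge0.
have [Ioo|Ioo] := eqVneq I +oo%E.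
  by rewrite Ioo gt0_muley ?leey// lte_fin submeanC_gt0.
have {Ioo}If : I \is a fin_num by rewrite ge0_fin_numE// ltey.
rewrite -(fineK If) -EFinM lee_fin; set J := fine I.
pose K := cauchyJ R; have K0 : 0 < normc K by rewrite normc_gt0 cauchyJ_neq0.
rewrite -(@ler_pM2r _ (normc K))//.
have -> : submeanC * J * normc K = 64 * J by rewrite /submeanC -/K; field; rewrite gt_eqF.
apply/ler_addgt0Pr => e e0.
(* [exists_le_mean] asks for a strict upper bound of the integral; the excess e / 64 is multiplied
   by 64 at the end. *)
pose M := J + e / 64.
have IM : (I < M%:E)%E by rewrite -(fineK If) lte_fin -/J /M ltrDl divr_gt0.
suff : normc (ext0 f (a +i* b)) * h ^+ 2 * normc K <= 64 * M.
  by move=> /le_trans; apply; rewrite /M mulrDr mulrCA divff ?mulr1.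
pose u (p : R * R) := normc (ext0 f (p.1 +i* p.2)).
have mu_ : measurable_fun (sq a b h) (EFin \o u).
  apply/measurable_EFinP; apply: measurable_funS (measurable_normc_ext0 hf).
  - exact: measurable_right_half.
  - exact: sub_sq_right_half.
have u0 p : (0 <= (u p)%:E)%E by rewrite lee_fin normc_ge0.
have mI c d : measurable (`[c, d]%classic : set R) by exact: measurable_itv.
pose H y := (\int[leb]_(x in `[(a - h)%R, (a + h)%R]) (u (x, y))%:E)%E.
pose V x := (\int[leb]_(y in `[(b - h)%R, (b + h)%R]) (u (x, y))%:E)%E.
have mH : measurable_fun `[b - h, b + h] H by exact: (measurable_tonelli_y (mI _ _) (mI _ _) mu_ (fun p _ => u0 p)).
have mV : measurable_fun `[a - h, a + h] V by exact: (measurable_tonelli_x (mI _ _) (mI _ _) mu_ (fun p _ => u0 p)).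
have H0 y : (0 <= H y)%E by exact: integral_ge0.
have V0 x : (0 <= V x)%E by exact: integral_ge0.
have IH : (\int[leb]_(y in `[(b - h)%R, (b + h)%R]) H y < M%:E)%E.
  by rewrite -(tonelli_y (mI _ _) (mI _ _) mu_ (fun p _ => u0 p)).
have IV : (\int[leb]_(x in `[(a - h)%R, (a + h)%R]) V x < M%:E)%E.
  by rewrite -(tonelli_x (mI _ _) (mI _ _) mu_ (fun p _ => u0 p)).
have pick (G : R -> \bar R) (c d c' : R) : c <= c' -> c' + h / 2 <= d ->
    measurable_fun `[c, d] G -> (forall x, (0 <= G x)%E) ->
    (\int[leb]_(x in `[c, d]) G x < M%:E)%E ->
    exists2 x, c' <= x <= c' + h / 2 & (G x <= (M / (h / 2))%:E)%E.
  move=> cc' c'd mG G0 IG.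
  have sub : `[c', c' + h / 2] `<=` `[c, d].
    move=> x; rewrite /= !in_itv/= => /andP[c'x xd].
    by rewrite (le_trans cc' c'x) (le_trans xd c'd).
  have := @exists_le_mean R `[c', c' + h / 2] (h / 2) M G.
  case=> [//||||//||x].
  - rewrite lebesgue_measure_itv/= lte_fin ltrDl divr_gt0//.
    by rewrite -EFinB addrAC subrr add0r.
  - exact: divr_gt0.
  - by apply: measurable_funS mG.
  - by apply: le_lt_trans IG; apply: ge0_subset_integral.
  - by rewrite /= in_itv/= => xx Gx; exists x.
have [y1 y1b Hy1] : exists2 y, b - h <= y <= b - h + h / 2 & (H y <= (M / (h / 2))%:E)%E.
  by apply: pick mH H0 IH; lra.
have [y2 y2b Hy2] : exists2 y, b + h / 2 <= y <= b + h / 2 + h / 2 & (H y <= (M / (h / 2))%:E)%E.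
  by apply: pick mH H0 IH; lra.
have [x1 x1b Vx1] : exists2 x, a - h <= x <= a - h + h / 2 & (V x <= (M / (h / 2))%:E)%E.
  by apply: pick mV V0 IV; lra.
have [x2 x2b Vx2] : exists2 x, a + h / 2 <= x <= a + h / 2 + h / 2 & (V x <= (M / (h / 2))%:E)%E.
  by apply: pick mV V0 IV; lra.
have df z : rect x1 x2 y1 y2 z -> cdiff (ext0 f) z.
  by move=> [/andP[zx1 zx2] _]; apply: hol_cdiff => //; move/andP: x1b => [? ?]; lra.
have ax : x1 < a < x2 by apply/andP; move/andP: x1b => [? ?]; move/andP: x2b => [? ?]; split; lra.
have by_ : y1 < b < y2 by apply/andP; move/andP: y1b => [? ?]; move/andP: y2b => [? ?]; split; lra.
have := Cauchy_rect ax by_ df; rewrite -/K; set w0 : C := a +i* b => E.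
have {E} : normc (ext0 f w0) * normc K = normc (ext0 f w0 * K) by rewrite normcM.
have := Cauchy_rect ax by_ df; rewrite -/K -/w0 => <-.
set G := (fun w => ext0 f w / (w - w0)) => E.
have far z : (complex.Re z = x1 \/ complex.Re z = x2) \/ (complex.Im z = y1 \/ complex.Im z = y2) ->
    h / 2 <= normc (z - w0).
  have xd t : t <= a - h / 2 \/ a + h / 2 <= t -> h / 2 <= `|t - a|.
    by clear -h0 => -[?|?]; rewrite ler_normr; apply/orP; [right|left]; lra.
  have yd t : t <= b - h / 2 \/ b + h / 2 <= t -> h / 2 <= `|t - b|.
    by clear -h0 => -[?|?]; rewrite ler_normr; apply/orP; [right|left]; lra.
  have := normc_ge_absRe (z - w0); have := normc_ge_absIm (z - w0).
  rewrite ReB ImB /w0 /= => /(le_trans _) I1 /(le_trans _) I2.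
  case/andP: x1b x2b y1b y2b => _ ? /andP[? _] /andP[_ ?] /andP[? _].
  case=> -[] zE; [apply/I2/xd|apply/I2/xd|apply/I1/yd|apply/I1/yd]; rewrite zE.
  - by left; lra.
  - by right; lra.
  - by left; lra.
  - by right; lra.
have h20 : 0 < h / 2 by exact: divr_gt0.
have Gle z : (complex.Re z = x1 \/ complex.Re z = x2) \/ (complex.Im z = y1 \/ complex.Im z = y2) ->
    normc (G z) <= (2 / h) * normc (ext0 f z).
  move=> /far zf; rewrite /G normcM normcV mulrC ler_wpM2r ?normc_ge0//.
  have -> : 2 / h = (h / 2)^-1 by rewrite invf_div.
  by rewrite lef_pV2// posrE// (lt_le_trans h20).
have cG z : rbd x1 x2 y1 y2 z -> G @ z --> G z.
  move=> [zQ zb]; apply: (@cdiff_cvg R G); apply: (@cdiffM R (ext0 f) (fun w => (w - w0)^-1)).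
    exact: df.
  apply: cdiffV; last by apply: cdiffB; [exact: cdiff_id|exact: cdiff_cst].
  rewrite -normc_gt0 (lt_le_trans h20)// far//.
  by case: zb => ->; [left; left|left; right|right; left|right; right].
have M0 : 0 <= M by apply: addr_ge0; [exact: fine_ge0|exact/ltW/divr_gt0].
(* The 8 collects the 2 of [cint_le_normc], the bound 2 / h of the kernel at distance h / 2, and the
   mean M / (h / 2) along a line. *)
have edge (c d c' d' : R) (w : R -> C) (W : R -> R) : c <= c' -> c' <= d' -> d' <= d ->
    cseg c' d' (fun t => G (w t)) ->
    (forall t, c' <= t <= d' -> normc (G (w t)) <= 2 / h * W t) ->
    measurable_fun `[c, d] (EFin \o W) -> (forall t, 0 <= W t) ->
    (\int[leb]_(t in `[c, d]) (W t)%:E <= (M / (h / 2))%:E)%E ->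
    normc (cint `[c', d'] (fun t => G (w t))) <= 8 * M / h ^+ 2.
  move=> cc' c'd' d'd cw wW mW W0 IW.
  apply: le_trans (cint_le_normc cw) _.
  have -> : 8 * M / h ^+ 2 = 2 * (2 / h * (M / (h / 2))) by field; rewrite gt_eqF.
  rewrite ler_wpM2l// -lee_fin.
  have nG := cseg_normc cw.
  rewrite /Rintegral fineK; last exact: integrable_fin_num.
  rewrite EFinM; apply: le_trans (lee_wpmul2l _ IW); last by rewrite lee_fin divr_ge0// ltW.
  rewrite -ge0_integralZl_EFin//; last 2 first.
  - by move=> t _; rewrite lee_fin.
  - by rewrite divr_ge0// ltW.
  have sub : `[c', d'] `<=` `[c, d].
    move=> x; rewrite /= !in_itv/= => /andP[c'x xd].
    by rewrite (le_trans cc' c'x) (le_trans xd d'd).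
  have mW2 : measurable_fun `[c, d] (fun t => ((2 / h)%:E * (W t)%:E)%E).
    exact: measurable_funeM.
  apply: (@le_trans _ _ (\int[leb]_(t in `[c', d']) ((2 / h)%:E * (W t)%:E))%E).
    apply: ge0_le_integral => //.
    - by move=> t _; rewrite lee_fin normc_ge0.
    - exact: (measurable_int leb nG).
    - exact: measurable_funS mW2.
  apply: ge0_subset_integral => //.
  by move=> t _; rewrite -EFinM lee_fin mulr_ge0// divr_ge0// ltW.
have xx : x1 <= x2 by move/andP: ax => [? ?]; lra.
have yy : y1 <= y2 by move/andP: by_ => [? ?]; lra.
have x10 : 0 < x1 by move/andP: x1b => [? ?]; lra.
have ch y : cseg (a - h) (a + h) (fun x => ext0 f (x +i* y)).
  apply: cseg_h => x /andP[xa _]; apply/cdiff_cvg/hol_cdiff => //=.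
  by apply: lt_le_trans xa; rewrite subr_gt0.
have cv x : 0 < x -> cseg (b - h) (b + h) (fun y => ext0 f (x +i* y)).
  by move=> x0; apply: cseg_v => y _; exact/cdiff_cvg/hol_cdiff.
have mh y := measurable_int leb (cseg_normc (ch y)).
have mv x (x0 : 0 < x) := measurable_int leb (cseg_normc (cv x x0)).
have x20 : 0 < x2 by exact: lt_le_trans x10 xx.
have [hx1 hx2 hy1 hy2] : [/\ a - h <= x1, x2 <= a + h, b - h <= y1 & y2 <= b + h].
  case/andP: x1b x2b y1b y2b => ? _ /andP[_ ?] /andP[? _] /andP[_ ?].
  by split => //; lra.
have B1 : normc (cint `[x1, x2] (fun x => G (x +i* y1))) <= 8 * M / h ^+ 2.
  apply: (edge (a - h) (a + h) _ _ (fun x => x +i* y1) (fun x => u (x, y1)) hx1 xx hx2);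
    [|by move=> t ht; apply: Gle; right; left|exact: mh|by move=> t; exact: normc_ge0|exact: Hy1].
  by apply: cseg_h => t ht; apply: cG; split; [split; rewrite //= lexx|constructor 3].
have B2 : normc (cint `[x1, x2] (fun x => G (x +i* y2))) <= 8 * M / h ^+ 2.
  apply: (edge (a - h) (a + h) _ _ (fun x => x +i* y2) (fun x => u (x, y2)) hx1 xx hx2);
    [|by move=> t ht; apply: Gle; right; right|exact: mh|by move=> t; exact: normc_ge0|exact: Hy2].
  by apply: cseg_h => t ht; apply: cG; split; [split; rewrite //= lexx ?andbT|constructor 4].
have B3 : normc (cint `[y1, y2] (fun y => G (x1 +i* y))) <= 8 * M / h ^+ 2.
  apply: (edge (b - h) (b + h) _ _ (fun y => x1 +i* y) (fun y => u (x1, y)) hy1 yy hy2);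
    [|by move=> t ht; apply: Gle; left; left|exact: mv|by move=> t; exact: normc_ge0|exact: Vx1].
  by apply: cseg_v => t ht; apply: cG; split; [split; rewrite //= lexx|constructor 1].
have B4 : normc (cint `[y1, y2] (fun y => G (x2 +i* y))) <= 8 * M / h ^+ 2.
  apply: (edge (b - h) (b + h) _ _ (fun y => x2 +i* y) (fun y => u (x2, y)) hy1 yy hy2);
    [|by move=> t ht; apply: Gle; left; right|exact: mv|by move=> t; exact: normc_ge0|exact: Vx2].
  by apply: cseg_v => t ht; apply: cG; split; [split; rewrite //= lexx ?andbT|constructor 2].
rewrite mulrAC E -ler_pdivlMr ?exprn_gt0//.
have -> : 64 * M / h ^+ 2 = 2 * (8 * M / h ^+ 2) + 2 * (8 * M / h ^+ 2) + 32 * M / h ^+ 2.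
  by field; rewrite gt_eqF.
have Mh0 : 0 <= 32 * M / h ^+ 2.
  by apply: divr_ge0; [exact: mulr_ge0|exact/exprn_ge0/ltW].
apply: le_trans (le_normcD _ _) _; rewrite -[leLHS]addr0; apply: lerD => //.
have n2 (z w : R[i]) (t : R) : normc z <= t -> normc w <= t -> normc (z - w) <= 2 * t.
  move=> zt wt; apply: le_trans (le_normcD _ _) _.
  by rewrite normcN -[2]/(1 + 1) mulrDl mul1r; exact: lerD.
apply: lerD; first by apply: n2.
by rewrite normcM normci mul1r; apply: n2.
Qed.

(** |f|^2 is the modulus of the holomorphic function f f, to which [submean1] applies. *)
Lemma submean f (a b h : R) : holomorphic f -> 0 < h -> h < a ->
  ((normc (ext0 f (a +i* b)) ^+ 2 * h ^+ 2)%:E <= submeanC%:E *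
    \int[leb2]_(p in sq a b h) (normc (ext0 f (p.1 +i* p.2)) ^+ 2)%:E)%E.
Proof.
move=> hf h0 ha; have := @submean1 _ a b h (hol_mul hf hf) h0 ha.
have E z : normc (ext0 (fun z => f z * f z : C) z) = normc (ext0 f z) ^+ 2.
  rewrite /ext0; case: (insub z) => [w|]; first by rewrite /= normcM expr2.
  by change (normc (0 : R[i]) = normc (0 : R[i]) ^+ 2); rewrite normc0 expr0n.
by rewrite E; under eq_integral do rewrite E.
Qed.

End SubMean.

(** * Point evaluations and decay of Bergman functions *)

Section AffineSubstitution.
Variable R : realType.
Local Notation leb := (@lebesgue_measure R).
Local Notation leb2 := (leb \x leb)%E.
Local Open Scope ereal_scope.

Lemma measurable_affine (a s : R) :
  measurable_fun setT (fun x : measurableTypeR R => (a * x + s)%R : measurableTypeR R).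
Proof.
apply: continuous_measurable_fun => x; apply: cvgD; last exact: cvg_cst.
by apply: cvgM; [exact: cvg_cst|exact: cvg_id].
Qed.

(** Lebesgue measure is determined by half-open intervals, on which it agrees with a times the image
    measure of the affine map. *)
Lemma ge0_integral_affine (a s : R) (g : R -> \bar R) : (0 < a)%R ->
  measurable_fun setT g -> (forall x, 0 <= g x) ->
  \int[leb]_x g (a * x + s)%R = (a^-1)%:E * \int[leb]_x g x.
Proof.
move=> a0 mg g0.
pose phi := fun x : measurableTypeR R => (a * x + s)%R : measurableTypeR R.
have mphi : measurable_fun setT phi by exact: measurable_affine.
have -> : \int[leb]_x g (a * x + s)%R = \int[pushforward leb phi]_x g x.
  by rewrite (ge0_integral_pushforward mphi).
have a0' : (0 <= a)%R by exact: ltW.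
pose k : {nonneg R} := NngNum a0'.
pose pf : {measure set (measurableTypeR R) -> \bar R} :=
  measure_function_pushforward__canonical__measure_function_Measure leb mphi.
have -> : \int[leb]_x g x = \int[mscale k pf]_x g x.
  apply: (@eq_measure_integral _ (measurableTypeR R) R setT (mscale k pf) leb g) => A mA _.
  apply: (@lebesgue_measure_unique R (mscale k pf)) => // _ [[c d]] _ <-.
  change (leb `]c, d] = a%:E * leb (phi @^-1` `]c, d])).
  have -> : phi @^-1` `]c, d] = `]((c - s) / a)%R, ((d - s) / a)%R]%classic.
    apply/seteqP; split=> x; rewrite /= !in_itv/= ltr_pdivrMr// ler_pdivlMr//;
      rewrite ltrBlDr lerBrDr [(x * a)%R]mulrC; exact.
  rewrite !lebesgue_measure_itv/= !lte_fin ltr_pM2r ?invr_gt0// ltrD2r.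
  case: ifPn => _; last by rewrite mule0.
  rewrite -!EFinB -EFinM; congr EFin; field; rewrite gt_eqF//.
rewrite ge0_integral_mscale//= -/phi muleA -EFinM mulVf ?mul1e// gt_eqF//.
Qed.

Lemma ge0_integral_affine2 (a s t : R) (G : R * R -> \bar R) : (0 < a)%R ->
  measurable_fun setT G -> (forall p, 0 <= G p) ->
  \int[leb2]_p G (a * p.1 + s, a * p.2 + t)%R = (a ^- 2)%:E * \int[leb2]_p G p.
Proof.
move=> a0 mG G0.
pose phi p : R * R := (a * p.1 + s, a * p.2 + t)%R.
have m1 : measurable_fun setT (fun p : R * R => (a * p.1 + s)%R).
  exact: (measurableT_comp (measurable_affine a s) measurable_fst).
have m2 : measurable_fun setT (fun p : R * R => (a * p.2 + t)%R).
  exact: (measurableT_comp (measurable_affine a t) measurable_snd).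
have mphi : measurable_fun setT phi.
  exact: (measurable_fun_pair m1 m2).
have mGphi : measurable_fun setT (G \o phi) by exact: measurableT_comp.
have Gphi0 p : 0 <= (G \o phi) p by exact: G0.
rewrite (@fubini_tonelli1 _ _ _ _ R leb leb (G \o phi) mGphi Gphi0).
rewrite (@fubini_tonelli1 _ _ _ _ R leb leb G mG G0).
have mH : measurable_fun setT (fubini_F leb G) by exact: measurable_fun_fubini_tonelli_F.
have H0 x : 0 <= fubini_F leb G x by exact: integral_ge0.
transitivity (\int[leb]_x ((a^-1)%:E * (fubini_F leb G) (a * x + s)%R)).
  apply: eq_integral => x _; rewrite /fubini_F -(@ge0_integral_affine a t)//.
  exact: (measurableT_comp mG (measurable_pair1 _)).
have mHa : measurable_fun setT (fun x => fubini_F leb G (a * x + s)%R).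
  exact: (measurableT_comp mH (measurable_affine a s)).
have ai : (0 <= a^-1)%R by rewrite invr_ge0 ltW.
have Ha0 x : setT x -> 0 <= fubini_F leb G (a * x + s)%R by move=> _; exact: H0.
rewrite (ge0_integralZl_EFin leb measurableT Ha0 mHa ai).
rewrite (ge0_integral_affine s a0 mH H0) muleA -EFinM; congr (_%:E * _).
by rewrite -invfM -expr2.
Qed.

End AffineSubstitution.

(** * Weighted densities, dilations, local evaluation bounds *)

Section Density.
Variables (R : realType) (alpha : R).
Local Notation C := R[i]^o.
Local Notation leb := (@lebesgue_measure R).
Local Notation leb2 := (leb \x leb)%E.
Implicit Types f g : half_plane R -> C.

(** Because of [ext0] this density vanishes off the half-plane; the squared norm thus becomes an
    integral over the whole plane, where affine substitutions apply. *)
Definition dens f (p : R * R) : R :=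
  normc (ext0 f (p.1 +i* p.2)) ^+ 2 * p.1 `^ alpha.

Lemma dens_ge0 f p : 0 <= dens f p.
Proof. by rewrite mulr_ge0 ?sqr_ge0 ?powR_ge0. Qed.

Lemma ext0_out f (z : C) : complex.Re z <= 0 -> ext0 f z = 0.
Proof. by move=> z0; rewrite /ext0; case: insubP => //= u u0; rewrite ltNge z0 in u0. Qed.

Lemma dens_out f p : ~ right_half p -> dens f p = 0.
Proof.
move=> /negP; rewrite -leNgt => p0; rewrite /dens ext0_out//.
by rewrite -[X in normc X]/(0 : R[i]) normc0 expr0n mul0r.
Qed.

Lemma measurable_dens_rh f : holomorphic f ->
  measurable_fun (@right_half R) (EFin \o dens f).
Proof.
move=> hf; apply/measurable_EFinP.
apply: (@measurable_funM _ _ _ _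
  (fun p : R * R => normc (ext0 f (p.1 +i* p.2)) ^+ 2)
  (fun p : R * R => p.1 `^ alpha)).
  apply: (@measurable_funX _ _ _ _
    (fun p : R * R => normc (ext0 f (p.1 +i* p.2)))).
  exact: measurable_normc_ext0.
apply: (measurableT_comp (measurable_powR alpha)).
exact: measurable_funTS measurable_fst.
Qed.

Lemma dens_patch f : (EFin \o dens f) \_ (@right_half R) = EFin \o dens f.
Proof.
apply/funext => p; rewrite patchE; case: ifPn => // /negP ph.
by rewrite /= dens_out// => h; apply: ph; exact: mem_set.
Qed.

Lemma measurable_dens f : holomorphic f -> measurable_fun setT (EFin \o dens f).
Proof.
move=> /measurable_dens_rh mf; rewrite -dens_patch.
exact: (iffLR (measurable_restrictT _ (@measurable_right_half R)) mf).
Qed.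

Lemma bergman_intE f : bergman_int alpha f = (\int[leb2]_p (dens f p)%:E)%E.
Proof.
rewrite /bergman_int integral_mkcond; apply: eq_integral => p _.
exact: (congr1 (fun h => h p) (dens_patch f)).
Qed.

Lemma ext0_comp f a b (a0 : 0 < a) (b0 : 0 <= complex.Re b) (z : C) :
  0 < complex.Re z -> ext0 (f \o affine_symbol a0 b0) z = ext0 f (a%:C * z + b).
Proof.
move=> z0; have z1 := affine_half_plane (exist _ z z0) a0 b0.
rewrite ext0E (ext0E f z1) /=; congr f; exact: val_inj.
Qed.

Lemma hol_comp f a b (a0 : 0 < a) (b0 : 0 <= complex.Re b) :
  holomorphic f -> holomorphic (f \o affine_symbol a0 b0).
Proof.
move=> hf; apply: (@cdiff_hol R (fun z => ext0 f (a%:C * z + b))).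
  by case=> z z0; rewrite -ext0_comp// ext0E.
move=> z z0; apply: (@cdiff_affine R (ext0 f)); apply: hol_cdiff => //.
by rewrite ReD ReM /= mul0r subr0 ltr_wpDr// mulr_gt0.
Qed.

(** The area contributes a^-2 and the weight a^-alpha. *)
Lemma bergman_int_dilation f a b (a0 : 0 < a) (b0 : 0 <= complex.Re b) :
  holomorphic f -> complex.Re b = 0 ->
  bergman_int alpha (f \o affine_symbol a0 b0) =
  ((a `^ (- (2 + alpha)))%:E * bergman_int alpha f)%E.
Proof.
move=> hf Reb; rewrite !bergman_intE.
have mf := measurable_dens hf.
have d0 p : (0 <= (dens f p)%:E)%E by rewrite lee_fin dens_ge0.
have := @ge0_integral_affine2 R a 0 (complex.Im b) (EFin \o dens f) a0 mf d0.
move=> /(congr1 (fun x => ((a `^ (- alpha))%:E * x)%E)).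
rewrite muleA -EFinM.
have -> : a `^ (- alpha) * a ^- 2 = a `^ (- (2 + alpha)).
  rewrite -powR_invn ?ltW// -powRD; last by rewrite (gt_eqF a0) implybT.
  by congr powR; ring.
move=> <-.
have m1 : measurable_fun setT (fun p : R * R => (a * p.1 + 0)%R).
  exact: (measurableT_comp (measurable_affine a 0) measurable_fst).
have m2 : measurable_fun setT (fun p : R * R => (a * p.2 + complex.Im b)%R).
  exact: (measurableT_comp (measurable_affine a _) measurable_snd).
have mphi := measurableT_comp mf (measurable_fun_pair m1 m2).
rewrite -(ge0_integralZl_EFin leb2 measurableT (fun p _ => d0 _) mphi (powR_ge0 _ _)).
apply: eq_integral => p _; rewrite /= -EFinM; congr EFin; rewrite /dens /= addr0.
have [p0|p0] := ltP 0 p.1; last first.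
  have e1 : ext0 (f \o affine_symbol a0 b0) (p.1 +i* p.2) = 0 by exact: ext0_out.
  have e2 : ext0 f ((a * p.1) +i* (a * p.2 + complex.Im b)) = 0.
    by apply: ext0_out; rewrite /= pmulr_rle0.
  by rewrite e1 e2 normc0 expr0n !mul0r mulr0.
rewrite ext0_comp//.
have -> : a%:C * (p.1 +i* p.2) + b = (a * p.1) +i* (a * p.2 + complex.Im b).
  by apply/eqP; rewrite eq_complex ReD ImD ReM ImM /= Reb !mul0r subr0 !addr0 !eqxx.
rewrite mulrCA; congr (_ * _); rewrite powRM ?ltW// mulrA -powRD.
  by rewrite addNr powRr0 mul1r.
by rewrite (gt_eqF a0) implybT.
Qed.

(** The absolute value in the exponent treats both signs of alpha at once: x^alpha may increase or
    decrease. *)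
Lemma powR_comparable (c x u : R) : 1 <= c -> 0 < x -> x / c <= u <= c * x ->
  x `^ alpha <= c `^ `|alpha| * u `^ alpha.
Proof.
move=> c1 x0 /andP[xu ux].
have c0 : 0 < c by exact: lt_le_trans c1.
have u0 : 0 < u by apply: lt_le_trans xu; exact: divr_gt0.
have [a0|a0] := leP 0 alpha.
  rewrite (ger0_norm a0) -(powRM _ (ltW c0) (ltW u0)).
  have := @ge0_ler_powR _ _ a0 x (c * u); rewrite !nnegrE; apply.
  - exact: ltW.
  - by rewrite mulr_ge0// ltW.
  - by move: xu; rewrite ler_pdivrMr// mulrC.
have a0' : 0 <= - alpha by rewrite oppr_ge0 ltW.
have := @ge0_ler_powR _ _ a0' u (c * x); rewrite !nnegrE.
move=> /(_ (ltW u0) (mulr_ge0 (ltW c0) (ltW x0)) ux).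
rewrite (powRM _ (ltW c0) (ltW x0)) !powRN.
have ua := powR_gt0 alpha u0; have xa := powR_gt0 alpha x0.
have ca := powR_gt0 alpha c0.
rewrite -invfM lef_pV2 ?posrE ?mulr_gt0// => h.
by rewrite (ltr0_norm a0) powRN mulrC ler_pdivlMr// mulrC.
Qed.

(** [submean] is applied with h = x / 2, whence the 4; on that square the weight varies by a factor
    at most 2^|alpha|. *)
Definition evalC : R := 4 * submeanC R * 2 `^ `|alpha|.

Lemma evalC_gt0 : 0 < evalC.
Proof.
have := submeanC_gt0 R; have := @powR_gt0 R 2 `|alpha| (ltr0n _ _).
by move=> h1 h2; rewrite /evalC mulr_gt0// mulr_gt0.
Qed.

(** The integral is kept local, over a square around the point: it becomes small when the square
    escapes, which gives [decay] and [weighted_eval_cvg0]. *)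
Lemma eval_bound f (x y : R) : holomorphic f -> 0 < x ->
  ((normc (ext0 f (x +i* y)) ^+ 2 * x `^ (2 + alpha))%:E <= evalC%:E *
    \int[leb2]_(p in sq x y (x / 2)) (dens f p)%:E)%E.
Proof.
move=> hf x0; have x20 : 0 < x / 2 by exact: divr_gt0.
have xx : x / 2 < x by rewrite ltr_pdivrMr// ltr_pMr// ltr1n.
have := @submean R f x y _ hf x20 xx.
move=> /(lee_wpmul2l (x := (4 * x `^ alpha)%:E)).
have x4 : (0 <= (4 * x `^ alpha)%:E)%E by rewrite lee_fin mulr_ge0// powR_ge0.
move=> /(_ x4); rewrite -EFinM.
have -> : 4 * x `^ alpha * (normc (ext0 f (x +i* y)) ^+ 2 * (x / 2) ^+ 2) =
    normc (ext0 f (x +i* y)) ^+ 2 * x `^ (2 + alpha).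
  rewrite powRD; last by rewrite (gt_eqF x0) implybT.
  by rewrite powR_mulrn ?ltW//; field.
move=> /le_trans; apply.
have m1 : measurable_fun (sq x y (x / 2))
    (fun p => (normc (ext0 f (p.1 +i* p.2)) ^+ 2)%:E).
  apply/measurable_EFinP; apply: (@measurable_funX _ _ _ _
    (fun p : R * R => normc (ext0 f (p.1 +i* p.2)))).
  apply: measurable_funS (measurable_normc_ext0 hf); first exact: measurable_right_half.
  exact: sub_sq_right_half.
have m2 : measurable_fun (sq x y (x / 2)) (fun p => (dens f p)%:E).
  exact: measurable_funTS (measurable_dens hf).
have p1 p : sq x y (x / 2) p -> (0 <= (normc (ext0 f (p.1 +i* p.2)) ^+ 2)%:E)%E.
  by move=> _; rewrite lee_fin sqr_ge0.
have p2 p : sq x y (x / 2) p -> (0 <= (dens f p)%:E)%E.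
  by move=> _; rewrite lee_fin dens_ge0.
have sC := submeanC_gt0 R.
have k1 : 0 <= 4 * x `^ alpha * submeanC R.
  by apply: mulr_ge0; [apply: mulr_ge0 => //; exact: powR_ge0|exact: ltW].
have k2 : 0 <= evalC by exact/ltW/evalC_gt0.
rewrite muleA -EFinM -(ge0_integralZl_EFin leb2 (measurable_sq x y (x / 2)) p1 m1 k1).
rewrite -(ge0_integralZl_EFin leb2 (measurable_sq x y (x / 2)) p2 m2 k2).
have msq := measurable_sq x y (x / 2).
apply: ge0_le_integral => //.
- by move=> p _; rewrite -EFinM lee_fin mulr_ge0// sqr_ge0.
- exact: measurable_funeM.
- exact: measurable_funeM.
- move=> [u v] [/= + _]; rewrite in_itv/= => /andP[u1 u2].
  rewrite -!EFinM lee_fin /evalC /dens /=.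
  have -> : 4 * x `^ alpha * submeanC R * normc (ext0 f (u +i* v)) ^+ 2 =
    4 * submeanC R * normc (ext0 f (u +i* v)) ^+ 2 * x `^ alpha by ring.
  have -> : 4 * submeanC R * 2 `^ `|alpha| * (normc (ext0 f (u +i* v)) ^+ 2 * u `^ alpha) =
    4 * submeanC R * normc (ext0 f (u +i* v)) ^+ 2 * (2 `^ `|alpha| * u `^ alpha) by ring.
  apply: ler_wpM2l; first by apply: mulr_ge0; [apply: mulr_ge0 => //; exact: ltW|exact: sqr_ge0].
  by apply: powR_comparable => //; [lra|apply/andP; split; lra].
Qed.

End Density.

(** * Decay in vertical strips and independence of the vertical line *)

Section Contour.
Variables (R : realType) (alpha : R).
Hypothesis alpha1 : -1 < alpha.
Local Notation C := R[i]^o.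
Local Notation leb := (@lebesgue_measure R).
Local Notation leb2 := (leb \x leb)%E.
Implicit Types f g : half_plane R -> C.

Definition inA f := holomorphic f /\ (bergman_int alpha f < +oo)%E.

Lemma integrable_dens f : inA f -> leb2.-integrable setT (EFin \o dens alpha f).
Proof.
move=> [hf If]; apply/integrableP; split; first exact: measurable_dens.
have -> : (\int[leb2]_p `|(EFin \o dens alpha f) p| = bergman_int alpha f)%E => //.
rewrite bergman_intE; apply: eq_integral => p _.
by rewrite gee0_abs// lee_fin dens_ge0.
Qed.

(** Dominated convergence, the density of f itself being the dominating function. *)
Lemma cvg_int_leaving f (F : nat -> set (R * R)) : inA f ->
  (forall k, measurable (F k)) ->
  (forall p, right_half p -> \forall k \near \oo, ~ F k p) ->
  (\int[leb2]_(p in F k) (dens alpha f p)%:E)%E @[k --> \oo] --> 0%E.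
Proof.
move=> fA mF leave; have idf := integrable_dens fA.
have md := measurable_dens alpha (proj1 fA).
pose h k p := ((EFin \o dens alpha f) \_ (F k)) p.
have -> : (fun k => \int[leb2]_(p in F k) (dens alpha f p)%:E)%E =
    (fun k => \int[leb2]_p h k p)%E.
  by apply/funext => k; rewrite integral_mkcond.
rewrite -(@integral0 _ _ _ leb2 setT).
apply: (@dominated_cvg _ _ R leb2 setT measurableT h (cst 0%E) (EFin \o dens alpha f)) => //.
- by move=> k; apply: (iffLR (measurable_restrictT _ (mF k))); exact: measurable_funTS.
- move=> p _; apply: cvg_near_cst.
  have [/leave|ph] := pselect (right_half p); last first.
    by apply: nearW => k; rewrite /h patchE /= dens_out//; case: ifP.
  apply: filterS => k Fk; rewrite /h patchE; case: ifPn => //.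
  by move=> /set_mem.
- move=> k p _; rewrite /h patchE; case: ifPn => _ /=.
    by rewrite ger0_norm ?dens_ge0.
  by rewrite normr0 lee_fin dens_ge0.
Qed.

Lemma decay f (l r e : R) : inA f -> 0 < l -> 0 < e ->
  exists Y0 : R, forall x y, l <= x <= r -> Y0 <= `|y| -> normc (ext0 f (x +i* y)) <= e.
Proof.
move=> fA l0 e0.
pose A (k : nat) : set (R * R) := [set p | k%:R <= `|p.2|].
have mA k : measurable (A k).
  rewrite (_ : A k = setT `&` (fun p : R * R => `|p.2|) @^-1` `[k%:R, +oo[%classic); last first.
    by apply/seteqP; split=> p; rewrite /A /= in_itv/= andbT//; case.
  apply: (measurableT_comp (@normr_measurable R setT) measurable_snd) => //.
have md := measurable_dens alpha (proj1 fA).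
have d00 p : (0 <= (dens alpha f p)%:E)%E by rewrite lee_fin dens_ge0.
have := cvg_int_leaving fA mA.
have lv p : right_half p -> \forall k \near \oo, ~ A k p.
  move=> _; near=> k; rewrite /A /=; apply/negP; rewrite -ltNge.
  by near: k; exact: nbhs_infty_gtr.
move=> /(_ lv) AC.
pose d := e ^+ 2 * l `^ (2 + alpha) / evalC alpha.
have d0 : 0 < d.
  by rewrite divr_gt0 ?evalC_gt0// mulr_gt0 ?exprn_gt0// powR_gt0.
have /fine_cvgP[_ /cvgrPdist_lt /(_ _ d0)] := AC.
move=> [k _ Hk].
have {}Hk : (\int[leb2]_(p in A k) (dens alpha f p)%:E <= d%:E)%E.
  have := Hk k (leqnn k); rewrite /= sub0r normrN.
  have Ik0 : (0 <= \int[leb2]_(p in A k) (dens alpha f p)%:E)%E.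
    by apply: integral_ge0 => p _; rewrite lee_fin dens_ge0.
  have Ikf : (\int[leb2]_(p in A k) (dens alpha f p)%:E)%E \is a fin_num.
    rewrite ge0_fin_numE//; apply: le_lt_trans (proj2 fA); rewrite bergman_intE.
    exact: (ge0_subset_integral leb2 (mA k) measurableT md (fun p _ => d00 p) (@subsetT _ _)).
  rewrite ger0_norm ?fine_ge0// => h; rewrite -(fineK Ikf) lee_fin; exact: ltW.
(* The square around the point has half-side x / 2 <= r, so its points still satisfy k <= |v|. *)
exists (k%:R + r) => x y /andP[lx xr] yk.
have x0 : 0 < x by exact: lt_le_trans lx.
have := @eval_bound R alpha f x y (proj1 fA) x0.
have sub : sq x y (x / 2) `<=` A k.
  move=> [u v] [_ /=]; rewrite in_itv/= /A/= => /andP[v1 v2].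
  have := ler_normD v (y - v); rewrite subrKC.
  have : `|y - v| <= x / 2 by rewrite ler_norml; apply/andP; split; lra.
  lra.
have e1 : (0 <= (evalC alpha)%:E)%E by rewrite lee_fin ltW// evalC_gt0.
have := ge0_subset_integral leb2 (measurable_sq x y (x / 2)) (mA k)
  (measurable_funS measurableT (@subsetT _ _) md) (fun p _ => d00 p) sub.
move=> /le_trans /(_ Hk) /(lee_wpmul2l e1) Hs /le_trans /(_ Hs).
rewrite -EFinM lee_fin /d mulrCA divff ?gt_eqF ?evalC_gt0// mulr1.
have lx2 : l `^ (2 + alpha) <= x `^ (2 + alpha).
  have a2 : 0 <= 2 + alpha.
    rewrite addrC -lerBlDr sub0r; apply/ltW; apply: lt_trans alpha1.
    by rewrite ltrN2 ltr1n.
  by have := @ge0_ler_powR _ _ a2 l x; rewrite !nnegrE; apply => //; exact: ltW.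
have lp : 0 < l `^ (2 + alpha) by exact: powR_gt0.
move=> h; rewrite -(@ler_pXn2r _ 2) ?nnegrE ?normc_ge0 ?(ltW e0)//.
rewrite -(ler_pM2r lp); apply: le_trans _ h; apply: ler_wpM2l => //; exact: sqr_ge0.
Unshelve. all: by end_near. Qed.

(* The integrand is the holomorphic function z |-> f(z) conj(g(S - conj z)) on the
   line Re z = t, so that up to small horizontal edges the integral does not
   depend on t. *)
Definition vline f g (S Y t : R) : R[i] :=
  cint `[- Y, Y] (fun y => ext0 f (t +i* y) * conjc (ext0 g ((S - t) +i* y))).

Lemma contour f g (S u v e : R) : inA f -> inA g -> 0 < u -> u <= v -> v < S -> 0 < e ->
  exists Y0 : R, forall Y, Y0 <= Y -> 0 <= Y ->
    normc (vline f g S Y v - vline f g S Y u) <= e.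
Proof.
move=> fA gA u0 uv vS e0.
(* On the horizontal edges f is at most e1 and g at most 1; two edges of length v - u, with the
   factor 2 of [cint_bound], make up the 4. *)
pose e1 := Num.min 1 (e / (4 * (v - u + 1))).
have vu : 0 < v - u + 1 by lra.
have e10 : 0 < e1 by rewrite lt_min ltr01 divr_gt0// mulr_gt0.
have [Y1 H1] := @decay f u v e1 fA u0 e10.
have Sv : 0 < S - v by rewrite subr_gt0.
have [Y2 H2] := @decay g (S - v) (S - u) 1 gA Sv ltr01.
exists (Num.max Y1 Y2) => Y; rewrite ge_max => /andP[Y1Y Y2Y] Y0.
pose k (w : C) : C := ext0 f w * conjc (ext0 g (- 1 * conjc w + S%:C)).
have kE t y : k (t +i* y) = ext0 f (t +i* y) * conjc (ext0 g ((S - t) +i* y)).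
  rewrite /k; congr (_ * conjc (ext0 g _)).
  by apply/eqP; rewrite eq_complex /=; apply/andP; split; apply/eqP; ring.
have YY : - Y <= Y by lra.
have dk z : rect u v (- Y) Y z -> cdiff k z.
  move=> [/andP[zu zv] _].
  apply: (@cdiffM R (ext0 f) (fun w => conjc (ext0 g (- 1 * conjc w + S%:C)))).
    by apply: hol_cdiff (proj1 fA) _; lra.
  apply: (@cdiff_conj R (fun w => ext0 g (- 1 * w + S%:C))).
  apply: (@cdiff_affine R (ext0 g)); apply: hol_cdiff (proj1 gA) _.
  by rewrite ReD ReM /=; case: (z) zu zv => a b /= *; lra.
have /eqP := Goursat uv YY dk; rewrite /bd addrC addr_eq0 => /eqP E.
have -> : vline f g S Y v - vline f g S Y u =
    cint `[- Y, Y] (fun y => k (v +i* y)) - cint `[- Y, Y] (fun y => k (u +i* y)).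
  by congr (_ - _); apply: eq_cint => y _; rewrite kE.
move/(congr1 (@normc R)) : E; rewrite normcM normci mul1r => ->; rewrite normcN.
have ck : rcont k u v (- Y) Y by move=> z /dk; exact: cdiff_cvg.
have [i1 i2 _ _] := bcont_edges uv YY (rcont_bcont ck).
have kb t y : u <= t <= v -> Y <= `|y| -> normc (k (t +i* y)) <= e1.
  move=> /andP[ut tv] Yy; rewrite kE normcM -[leRHS]mulr1.
  have J (w : C) : normc (conjc w) = normc w by case: w => a b /=; rewrite sqrrN.
  rewrite J; apply: ler_pM; rewrite ?normc_ge0//.
  - by apply: H1; [rewrite ut|exact: le_trans Yy].
  - by apply: H2; [apply/andP; split; lra|exact: le_trans Yy].
have b1 : normc (cint `[u, v] (fun x => k (x +i* (- Y)))) <= 2 * e1 * (v - u).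
  by apply: cint_bound => // x xuv; apply: kb => //; rewrite normrN ler_norm.
have b2 : normc (cint `[u, v] (fun x => k (x +i* Y))) <= 2 * e1 * (v - u).
  by apply: cint_bound => // x xuv; apply: kb => //; rewrite ler_norm.
apply: le_trans (le_normcD _ _) _; rewrite normcN.
apply: le_trans (lerD b1 b2) _.
have e1e : e1 * (4 * (v - u + 1)) <= e.
  by rewrite -ler_pdivlMr ?mulr_gt0// /e1 ge_min lexx orbT.
have : 0 <= v - u by lra.
move: e1 (v - u) e10 e1e {H1 kb b1 b2 vu} => p q p0 pe q0.
by apply: le_trans pe; nra.
Qed.

End Contour.

(** * Shifts are symmetric contractions *)

Section Lines.
Variables (R : realType) (alpha : R).
Hypothesis alpha1 : -1 < alpha.
Local Notation C := R[i]^o.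
Local Notation leb := (@lebesgue_measure R).
Local Notation leb2 := (leb \x leb)%E.
Implicit Types f g : half_plane R -> C.

Definition ccont (u : R -> R[i]) := forall y, (u : R -> C) @ y --> (u y : C).

Lemma ccont_sq u : ccont u -> continuous (fun y => normc (u y) ^+ 2).
Proof.
move=> cu y; rewrite /continuous_at (_ : (fun y => _) = (fun y => normc (u y) * normc (u y))).
  have h : normc (u t) @[t --> y] --> normc (u y) by exact: (@cvg_normc R _ _ _ u _ (cu y)).
  by rewrite expr2; exact: cvgM.
by apply/funext => z; rewrite expr2.
Qed.

Lemma ccont_line f x : holomorphic f -> 0 < x -> ccont (fun y => ext0 f (x +i* y)).
Proof.
move=> hf x0 y; apply: (cvg_comp (fun y => (x +i* y : C)) (ext0 f)).
  by apply: cvg_cplx; [exact: cvg_cst|exact: cvg_id].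
exact/cdiff_cvg/hol_cdiff.
Qed.

Lemma ccontD u w : ccont u -> ccont w -> ccont (fun y => u y + w y).
Proof. by move=> cu cw y; exact: (@cvgD _ C _ _ _ u w _ _ (cu y) (cw y)). Qed.

Lemma ccontB u w : ccont u -> ccont w -> ccont (fun y => u y - w y).
Proof. by move=> cu cw y; exact: (@cvgB _ C _ _ _ u w _ _ (cu y) (cw y)). Qed.

Lemma ccontM u w : ccont u -> ccont w -> ccont (fun y => u y * w y).
Proof.
by move=> cu cw y; exact: (@cvgM R[i] _ _ _ (u : R -> R[i]) (w : R -> R[i]) _ _ (cu y) (cw y)).
Qed.

Lemma ccont_conj u : ccont u -> ccont (fun y => conjc (u y)).
Proof.
move=> cu y; apply/cvgcP => e e0.
have /cvgcP /(_ e e0) := cu y; apply: filterS => t.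
by rewrite -rmorphB; case: (u t - u y) => a b /=; rewrite sqrrN.
Qed.

Lemma contD_R (u w : R -> R) : continuous u -> continuous w ->
  continuous (fun y => u y + w y).
Proof. by move=> cu cw y; exact: (@cvgD _ R _ _ _ u w _ _ (cu y) (cw y)). Qed.

Lemma contZ_R (k : R) (u : R -> R) : continuous u -> continuous (fun y => k * u y).
Proof. by move=> cu y; exact: (@cvgM R _ _ _ (fun=> k) u _ _ (@cvg_cst _ _ _ _ _) (cu y)). Qed.

Lemma contB_R (u w : R -> R) : continuous u -> continuous w ->
  continuous (fun y => u y - w y).
Proof. by move=> cu cw y; exact: (@cvgB _ R _ _ _ u w _ _ (cu y) (cw y)). Qed.

Lemma cont_Remul (u w : R -> R[i]) : ccont u -> ccont w ->
  continuous (fun y => complex.Re (u y * conjc (w y))).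
Proof.
move=> cu cw y; have h := ccontM cu (ccont_conj cw).
exact: (@cvg_Re R _ _ _ (fun y => u y * conjc (w y)) _ (h y)).
Qed.

(** Contour shifts compare integrals only on truncated lines and up to e. Monotone convergence
    passes to full lines, whose integrals may a priori be infinite. *)
Lemma le_integral_trunc (A B : R -> R) : continuous A -> continuous B ->
  (forall y, 0 <= A y) -> (forall y, 0 <= B y) ->
  (forall e, 0 < e -> exists Y0 : R, forall Y, Y0 <= Y -> 0 <= Y ->
    \int[leb]_(y in `[- Y, Y]) A y <= \int[leb]_(y in `[- Y, Y]) B y + e) ->
  (\int[leb]_y (A y)%:E <= \int[leb]_y (B y)%:E)%E.
Proof.
move=> cA cB A0 B0 H.
have mA : measurable_fun setT (EFin \o A) by apply/measurable_EFinP; exact: continuous_measurable_fun.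
have mB : measurable_fun setT (EFin \o B) by apply/measurable_EFinP; exact: continuous_measurable_fun.
have iA Y : leb.-integrable `[- Y, Y] (EFin \o A) by apply: seg_integrable => y _; exact: cA.
have iB Y : leb.-integrable `[- Y, Y] (EFin \o B) by apply: seg_integrable => y _; exact: cB.
pose F (n : nat) : set R := `[- n%:R, n%:R]%classic.
have mF n : measurable (F n) by exact: measurable_itv.
have UF : \bigcup_n F n = setT.
  apply/seteqP; split=> // y _; exists (Num.truncn `|y|).+1 => //.
  rewrite /F /= in_itv/=; have := ltW (truncnS_gt `|y|).
  by rewrite ler_norml.
have Fm : {homo F : n m / (n <= m)%N >-> (n <= m)%O}.
  move=> n m nm; apply/subsetPset => y; rewrite /F /= !in_itv/=.
  have : n%:R <= m%:R :> R by rewrite ler_nat.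
  by move=> h /andP[? ?]; apply/andP; split; lra.
have A0e (n : nat) y : F n y -> (0 <= (EFin \o A) y)%E by rewrite lee_fin.
have mAF n : measurable_fun (F n) (EFin \o A) by exact: measurable_funS mA.
have AC := @ge0_nondecreasing_set_cvg_integral _ (measurableTypeR R) R F (EFin \o A) leb Fm mF mAF A0e.
move: (AC); rewrite UF => /cvg_lim <- //.
apply: lime_le; first by apply/cvg_ex; eexists; exact: AC.
apply: nearW => n; apply/lee_addgt0Pr => e e0.
have [Y0 HY] := H e e0.
pose Y := Num.max n%:R Y0.
have nY : n%:R <= Y by rewrite le_max lexx.
have YY : 0 <= Y by exact: le_trans nY.
apply: (@le_trans _ _ (\int[leb]_(y in `[(- Y)%R, Y]) (A y)%:E)%E).
  apply: ge0_subset_integral => //.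
  - exact: mF.
  - exact: measurable_funTS.
  - by move=> y _; rewrite lee_fin.
  - by move=> y; rewrite /F /= !in_itv/= => /andP[? ?]; apply/andP; split; lra.
have := HY Y; rewrite le_max lexx orbT => /(_ isT YY).
rewrite -lee_fin EFinD /Rintegral fineK; last exact: integrable_fin_num (iA Y).
rewrite fineK; last exact: integrable_fin_num (iB Y).
move=> /le_trans; apply; apply: leeD2r; apply: ge0_subset_integral => //.
by move=> y _; rewrite lee_fin.
Qed.

Lemma Re_cint D (w : R -> R[i]) : complex.Re (cint D w) = \int[leb]_(x in D) complex.Re (w x).
Proof. by []. Qed.

Lemma Re_le_normc (z : R[i]) : complex.Re z <= normc z.
Proof. by apply: le_trans (normc_ge_absRe z); exact: ler_norm. Qed.

Lemma vlineE f g (t1 t2 Y : R) : vline f g (t1 + t2) Y t2 =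
  cint `[- Y, Y] (fun y => ext0 f (t2 +i* y) * conjc (ext0 g (t1 +i* y))).
Proof. by rewrite /vline addrK. Qed.

Lemma contour2 f g (t1 t2 e : R) : inA alpha f -> inA alpha g -> 0 < t1 -> t1 <= t2 -> 0 < e ->
  exists Y0 : R, forall Y, Y0 <= Y -> 0 <= Y ->
  `|\int[leb]_(y in `[- Y, Y]) complex.Re (ext0 f (t2 +i* y) * conjc (ext0 g (t1 +i* y))) -
    \int[leb]_(y in `[- Y, Y]) complex.Re (ext0 f (t1 +i* y) * conjc (ext0 g (t2 +i* y)))| <= e.
Proof.
move=> fA gA t10 t12 e0.
have [Y0 H] := @contour R alpha alpha1 f g (t1 + t2) t1 t2 e fA gA t10 t12 (ltr_pwDl t10 (lexx _)) e0.
exists Y0 => Y YY Yp; have := H Y YY Yp; rewrite vlineE.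
have -> : vline f g (t1 + t2) Y t1 = vline f g (t2 + t1) Y t1 by rewrite addrC.
by rewrite vlineE => h; apply: le_trans h; rewrite -!Re_cint -ReB; exact: normc_ge_absRe.
Qed.

Definition mline f (x : R) : \bar R := (\int[leb]_y (normc (ext0 f (x +i* y)) ^+ 2)%:E)%E.

Lemma mline_ge0 f x : (0 <= mline f x)%E.
Proof. by apply: integral_ge0 => y _; rewrite lee_fin sqr_ge0. Qed.

Lemma Re_mulconj (a b : R[i]) : complex.Re (a * conjc b) =
  (normc (a + b) ^+ 2 - normc (a - b) ^+ 2) / 4.
Proof. by rewrite !sqr_normcE ReD ReB ImD ImB ReM; case: b => b1 b2 /=; field. Qed.

Let half_step (a b c e : R) : a - b <= e / 2 -> 2 * b <= c -> 2 * a <= c + e.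
Proof. lra. Qed.

Let cs2 (a b c d : R) : 2 * (a * c - b * - d) <= a ^+ 2 + b ^+ 2 + (c ^+ 2 + d ^+ 2).
Proof. have := sqr_ge0 (a - c); have := sqr_ge0 (b - d); nra. Qed.

(* By [contour], the integral of f(x + 2s + iy) conj(f(x + iy)) equals that of
   |f(x + s + iy)|^2; expand |f(x + 2s + iy) - f(x + iy)|^2 >= 0. *)
Lemma mline_convex f (x s : R) : inA alpha f -> 0 < x -> 0 <= s ->
  (mline f (x + s) + mline f (x + s) <= mline f x + mline f (x + (s + s)))%E.
Proof.
move=> fA x0 s0; have hf := proj1 fA.
have x1 : 0 < x + s by lra.
have x2 : 0 < x + (s + s) by lra.
have c0 := ccont_line hf x0; have c1 := ccont_line hf x1; have c2 := ccont_line hf x2.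
have mm (t : R) (t0 : 0 < t) : measurable_fun setT (fun y : R => (normc (ext0 f (t +i* y)) ^+ 2)%:E).
  by apply/measurable_EFinP; exact: continuous_measurable_fun (ccont_sq (ccont_line hf t0)).
have pp (t y : R) : setT y -> (0 <= (normc (ext0 f (t +i* y)) ^+ 2)%:E)%E.
  by move=> _; rewrite lee_fin sqr_ge0.
have D2 (a c : R) (a0 : 0 < a) (c00 : 0 < c) :=
  ge0_integralD leb measurableT (pp a) (mm a a0) (pp c) (mm c c00).
rewrite /mline -D2// -D2//.
under eq_integral do rewrite -EFinD.
under [leRHS]eq_integral do rewrite -EFinD.
apply: le_integral_trunc.
- exact: (contD_R (ccont_sq c1) (ccont_sq c1)).
- exact: (contD_R (ccont_sq c0) (ccont_sq c2)).
- by move=> y; rewrite addr_ge0// sqr_ge0.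
- by move=> y; rewrite addr_ge0// sqr_ge0.
move=> e e0; have e20 : 0 < e / 2 by exact: divr_gt0.
have xs : x <= x + s by lra.
have [Y0 H] := @contour R alpha alpha1 f f (x + s + (x + s)) x (x + s) (e / 2) fA fA x0 xs
  (ltr_pwDl x1 (lexx _)) e20.
exists Y0 => Y YY Yp; have := H Y YY Yp; rewrite vlineE.
have -> : vline f f (x + s + (x + s)) Y x = vline f f ((x + (s + s)) + x) Y x.
  by congr vline; ring.
rewrite vlineE => h.
have {}h := le_trans (le_trans (Re_le_normc _) h) (lexx _).
rewrite ReB !Re_cint in h.
have cs u : continuous u -> leb.-integrable `[- Y, Y] (EFin \o u).
  by move=> cu; apply: seg_integrable => y _; exact: cu.
have E1 : \int[leb]_(y in `[- Y, Y]) (normc (ext0 f ((x + s) +i* y)) ^+ 2 +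
      normc (ext0 f ((x + s) +i* y)) ^+ 2) =
    2 * \int[leb]_(y in `[- Y, Y]) complex.Re (ext0 f ((x + s) +i* y) * conjc (ext0 f ((x + s) +i* y))).
  have iN := cs _ (ccont_sq c1).
  rewrite (RintegralD _ iN iN); last exact: measurable_itv.
  rewrite mulr_natl mulr2n.
  suff -> : \int[leb]_(y in `[- Y, Y]) (normc (ext0 f ((x + s) +i* y)) ^+ 2) =
    \int[leb]_(y in `[- Y, Y]) complex.Re (ext0 f ((x + s) +i* y) *
      conjc (ext0 f ((x + s) +i* y))) by [].
  apply: eq_Rintegral => y _; rewrite ReM sqr_normcE.
  by case: (ext0 f _) => a b /=; ring.
have E2 : 2 * \int[leb]_(y in `[- Y, Y]) complex.Re (ext0 f (x +i* y) * conjc (ext0 f ((x + (s + s)) +i* y))) <=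
    \int[leb]_(y in `[- Y, Y]) (normc (ext0 f (x +i* y)) ^+ 2 + normc (ext0 f ((x + (s + s)) +i* y)) ^+ 2).
  have cR := cont_Remul c0 c2.
  rewrite -RintegralZl//; last exact: cs.
  apply: le_Rintegral => //.
  - apply: (cs (fun y => 2 * complex.Re (ext0 f (x +i* y) *
      conjc (ext0 f ((x + (s + s)) +i* y))))).
    exact: contZ_R cR.
  - exact: (cs _ (contD_R (ccont_sq c0) (ccont_sq c2))).
  - move=> y _; rewrite ReM !sqr_normcE.
    case: (ext0 f _) => a b; case: (ext0 f _) => c d /=.
    exact: cs2.
rewrite E1; exact: half_step h E2.
Qed.

(** Polarised form of Re <f(t2), g(t1)> = Re <f(t1), g(t2)> on vertical lines. All integrands are
    nonnegative, so that the identity makes sense without integrability on individual lines. *)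
Lemma line_sym f g (t1 t2 : R) : inA alpha f -> inA alpha g -> 0 < t1 -> t1 <= t2 ->
  (\int[leb]_y (normc (ext0 f (t2 +i* y) + ext0 g (t1 +i* y)) ^+ 2 +
               normc (ext0 f (t1 +i* y) - ext0 g (t2 +i* y)) ^+ 2)%:E =
   \int[leb]_y (normc (ext0 f (t1 +i* y) + ext0 g (t2 +i* y)) ^+ 2 +
               normc (ext0 f (t2 +i* y) - ext0 g (t1 +i* y)) ^+ 2)%:E)%E.
Proof.
move=> fA gA t10 t12; have t20 : 0 < t2 by exact: lt_le_trans t12.
have f1 := ccont_line (proj1 fA) t10; have f2 := ccont_line (proj1 fA) t20.
have g1 := ccont_line (proj1 gA) t10; have g2 := ccont_line (proj1 gA) t20.
set A := fun y => normc (ext0 f (t2 +i* y) + ext0 g (t1 +i* y)) ^+ 2 +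
               normc (ext0 f (t1 +i* y) - ext0 g (t2 +i* y)) ^+ 2.
set B := fun y => normc (ext0 f (t1 +i* y) + ext0 g (t2 +i* y)) ^+ 2 +
               normc (ext0 f (t2 +i* y) - ext0 g (t1 +i* y)) ^+ 2.
have cA : continuous A.
  exact: (contD_R (ccont_sq (ccontD f2 g1)) (ccont_sq (ccontB f1 g2))).
have cB : continuous B.
  exact: (contD_R (ccont_sq (ccontD f1 g2)) (ccont_sq (ccontB f2 g1))).
have A0 y : 0 <= A y by rewrite addr_ge0// sqr_ge0.
have B0 y : 0 <= B y by rewrite addr_ge0// sqr_ge0.
pose D1 y := complex.Re (ext0 f (t2 +i* y) * conjc (ext0 g (t1 +i* y))).
pose D2 y := complex.Re (ext0 f (t1 +i* y) * conjc (ext0 g (t2 +i* y))).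
have cD1 : continuous D1 := cont_Remul f2 g1.
have cD2 : continuous D2 := cont_Remul f1 g2.
have AB Y : \int[leb]_(y in `[- Y, Y]) A y = \int[leb]_(y in `[- Y, Y]) B y +
    4 * (\int[leb]_(y in `[- Y, Y]) D1 y - \int[leb]_(y in `[- Y, Y]) D2 y).
  have cs u : continuous u -> leb.-integrable `[- Y, Y] (EFin \o u).
    by move=> cu; apply: seg_integrable => y _; exact: cu.
  rewrite -RintegralB//; try exact: cs.
  rewrite -RintegralZl//; last exact: (cs _ (contB_R cD1 cD2)).
  rewrite -RintegralD//; first last.
  - by apply: (cs (fun y => 4 * (D1 y - D2 y))); exact: contZ_R (contB_R cD1 cD2).
  - exact: cs.
  by apply: eq_Rintegral => y _; rewrite /A /B /D1 /D2 !Re_mulconj; field.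
apply/eqP; rewrite eq_le; apply/andP; split; apply: le_integral_trunc => // e e0;
  have e40 : 0 < e / 4 by [exact: divr_gt0];
  have [Y0 H] := contour2 fA gA t10 t12 e40; exists Y0 => Y YY Yp;
  have := H Y YY Yp; rewrite -/(D1 _) AB ler_norml => /andP[]; rewrite -/D1 -/D2.
- set d1 := Rintegral _ _ _; set d2 := Rintegral _ _ _; set d3 := Rintegral _ _ _; lra.
- set d1 := Rintegral _ _ _; set d2 := Rintegral _ _ _; set d3 := Rintegral _ _ _; lra.
Qed.

End Lines.

(** * Shifts do not increase the norm *)

Section Contraction.
Variables (R : realType) (alpha : R).
Hypothesis alpha1 : -1 < alpha.
Local Notation C := R[i]^o.
Local Notation leb := (@lebesgue_measure R).
Local Notation leb2 := (leb \x leb)%E.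
Implicit Types f g : half_plane R -> C.

(** Composition through [ext0]: the parameters carry no proofs, unlike those of [affine_symbol], so
    composites are compared by comparing a and b. *)
Definition compf (a : R) (b : R[i]) f : half_plane R -> C :=
  fun w => ext0 f (a%:C * val w + b).

Lemma compfE a b (a0 : 0 < a) (b0 : 0 <= complex.Re b) f :
  f \o affine_symbol a0 b0 = compf a b f.
Proof. by apply/funext => -[z z0]; rewrite /compf /= -(ext0_comp f a0 b0 z0) ext0E. Qed.

Lemma ext0_compf a b f (z : C) : 0 < complex.Re z ->
  ext0 (compf a b f) z = ext0 f (a%:C * z + b).
Proof. by move=> z0; rewrite ext0E. Qed.

Lemma hol_compf a b f : 0 < a -> 0 <= complex.Re b -> holomorphic f ->
  holomorphic (compf a b f).
Proof. by move=> a0 b0 hf; rewrite -(compfE a0 b0); exact: hol_comp. Qed.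

Lemma ext0_shift (s : R) f (x y : R) : 0 < x ->
  ext0 (compf 1 s%:C f) (x +i* y) = ext0 f ((x + s) +i* y).
Proof.
move=> x0; rewrite ext0_compf//; congr (ext0 f _).
by apply/eqP; rewrite eq_complex /=; apply/andP; split; apply/eqP; ring.
Qed.

(** A convex sequence whose first step is positive grows at least linearly, which a growth exponent
    th < 1 forbids. *)
Lemma growth_convex (r : nat -> R) (c K th : R) : 0 <= c -> 0 <= K -> 0 <= th -> th < 1 ->
  (forall j, r j.+1 + r j.+1 <= r j + r j.+2) ->
  (forall j, r j <= (1 + c * j%:R) `^ th * K) -> 0 <= r 0%N -> r 1%N <= r 0%N.
Proof.
move=> c0 K0 th0 th1 cvx bnd r0; rewrite leNgt; apply/negP => r01.
pose d := r 1%N - r 0%N; have d0 : 0 < d by rewrite subr_gt0.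
have inc j : d <= r j.+1 - r j.
  elim: j => [|j IH]; first by [].
  by apply: le_trans IH _; have := cvx j; lra.
have lin j : j%:R * d <= r j.
  elim: j => [|j IH]; first by rewrite mul0r.
  by rewrite -natr1 mulrDl mul1r; have := inc j; lra.
pose B := (1 + c) `^ th * K / d.
have B0 : 0 <= B by rewrite divr_ge0 ?mulr_ge0 ?powR_ge0// ltW.
have t1 : 0 < 1 - th by lra.
(* At this index j^(1 - th) exceeds B, so that the linear lower bound overtakes the upper bound. *)
pose j := (Num.truncn (B `^ (1 - th)^-1)).+1.
have jB : B `^ (1 - th)^-1 < j%:R by exact: truncnS_gt.
have j0 : 0 < j%:R :> R by rewrite ltr0n.
have Bj : B < j%:R `^ (1 - th).
  have := gt0_ltr_powR t1; move=> /(_ (B `^ (1 - th)^-1) j%:R).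
  rewrite !nnegrE powR_ge0 ler0n => /(_ isT isT jB).
  by rewrite -powRrM mulVf ?gt_eqF// powRr1.
have j1 : 1 <= j%:R :> R by rewrite ler1n.
have := le_trans (lin j) (bnd j); apply/negP; rewrite -ltNge.
apply: (@le_lt_trans _ _ (((1 + c) * j%:R) `^ th * K)).
  apply: ler_wpM2r => //.
  have := @ge0_ler_powR _ _ th0 (1 + c * j%:R) ((1 + c) * j%:R); rewrite !nnegrE; apply.
  - by rewrite addr_ge0// mulr_ge0.
  - by rewrite mulr_ge0// addr_ge0.
  - by rewrite mulrDl mul1r lerD2r.
rewrite powRM ?addr_ge0//.
have -> : (1 + c) `^ th * j%:R `^ th * K = B * d * j%:R `^ th.
  by rewrite /B divfK ?gt_eqF// mulrAC.
have jth : 0 < j%:R `^ th :> R by exact: powR_gt0.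
have -> : j%:R * d = j%:R `^ (1 - th) * d * j%:R `^ th.
  rewrite mulrAC -powRD; last by rewrite (gt_eqF j0) implybT.
  by rewrite subrK powRr1.
by rewrite ltr_pM2r// ltr_pM2r.
Qed.

(** A loss occurs only for negative alpha, and alpha > -1 keeps the exponent [Num.max 0 (- alpha)]
    below 1, as [growth_convex] requires. *)
Lemma powR_shift (d x t : R) : 0 < d -> d <= x -> 0 <= t ->
  x `^ alpha <= (1 + t / d) `^ (Num.max 0 (- alpha)) * (x + t) `^ alpha.
Proof.
move=> d0 dx t0; have x0 : 0 < x by exact: lt_le_trans dx.
have xt0 : 0 < x + t by rewrite ltr_pwDl.
have [a0|a0] := leP 0 alpha.
  rewrite max_l ?oppr_le0// powRr0 mul1r.
  have := @ge0_ler_powR _ _ a0 x (x + t); rewrite !nnegrE; apply; first exact: ltW.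
  - exact: ltW.
  - by rewrite lerDl.
rewrite max_r ?oppr_ge0 ?(ltW a0)//.
have a0' : 0 <= - alpha by rewrite oppr_ge0 ltW.
have k0 : 0 < 1 + t / d by rewrite ltr_pwDl// divr_ge0// ltW.
have xtk : x + t <= (1 + t / d) * x.
  rewrite mulrDl mul1r lerD2l mulrAC ler_pdivlMr//.
  by rewrite ler_wpM2l.
have := @ge0_ler_powR _ _ a0' (x + t) ((1 + t / d) * x); rewrite !nnegrE.
move=> /(_ (ltW xt0) (mulr_ge0 (ltW k0) (ltW x0)) xtk).
rewrite (powRM _ (ltW k0) (ltW x0)) !powRN.
have ua := powR_gt0 alpha xt0; have xa := powR_gt0 alpha x0.
have ca := powR_gt0 alpha k0.
rewrite -invfM lef_pV2 ?posrE ?mulr_gt0// => h.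
by rewrite mulrC ler_pdivlMr// mulrC.
Qed.

Let P : set R := `]0, +oo[%classic.

Let mP : measurable P. Proof. exact: measurable_itv. Qed.

Let PT : @right_half R = P `*` setT.
Proof.
by apply/seteqP; split=> [[x y]|[x y] []]; rewrite /right_half /P /= in_itv/= andbT.
Qed.

Lemma measurable_mline f : holomorphic f -> measurable_fun P (mline f).
Proof.
move=> hf.
have m1 : measurable_fun (P `*` setT)
    (fun p : R * R => (normc (ext0 f (p.1 +i* p.2)) ^+ 2)%:E).
  rewrite -PT; apply/measurable_EFinP; apply: (@measurable_funX _ _ _ _
    (fun p : R * R => normc (ext0 f (p.1 +i* p.2)))).
  exact: measurable_normc_ext0.
have p1 p : (P `*` setT) p -> (0 <= (normc (ext0 f (p.1 +i* p.2)) ^+ 2)%:E)%E.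
  by move=> _; rewrite lee_fin sqr_ge0.
exact: (measurable_tonelli_x mP measurableT m1 p1).
Qed.

Lemma bergman_int_lines f : holomorphic f ->
  bergman_int alpha f = (\int[leb]_(x in P) ((x `^ alpha)%:E * mline f x))%E.
Proof.
move=> hf; rewrite /bergman_int PT.
have mP' : measurable_fun (P `*` setT) (EFin \o dens alpha f).
  by rewrite -PT; exact: measurable_dens_rh.
have pos p : (P `*` setT) p -> (0 <= (EFin \o dens alpha f) p)%E.
  by move=> _; rewrite lee_fin dens_ge0.
rewrite (tonelli_x mP measurableT mP' pos); apply: eq_integral => x.
rewrite /P inE /= in_itv/= andbT => x0.
have m1 : measurable_fun setT (fun y : R => (normc (ext0 f (x +i* y)) ^+ 2)%:E).
  apply/measurable_EFinP.
  exact: continuous_measurable_fun (ccont_sq (ccont_line hf x0)).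
have p1 (y : R) : setT y -> (0 <= (normc (ext0 f (x +i* y)) ^+ 2)%:E)%E.
  by move=> _; rewrite lee_fin sqr_ge0.
rewrite /mline -(ge0_integralZl_EFin leb measurableT p1 m1 (powR_ge0 x alpha)).
by apply: eq_integral => y _; rewrite /dens /= -EFinM mulrC.
Qed.

Section Shift.
Variables (f : half_plane R -> C) (s : R).
Hypotheses (fA : inA alpha f) (s0 : 0 < s).

Let M := mline f \_ P.
Let mM : measurable_fun setT M.
Proof. exact: (iffLR (measurable_restrictT _ mP) (measurable_mline (proj1 fA))). Qed.

Let M0 x : (0 <= M x)%E.
Proof. by rewrite /M patchE; case: ifP => // _; exact: mline_ge0. Qed.

Let ME x : 0 < x -> M x = mline f x.
Proof. by move=> x0; rewrite /M patchE ifT// inE /P /= in_itv/= andbT. Qed.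

Let H (x : R) : \bar R := ((x `^ alpha)%:E * M x)%E.

Let mpow (D : set R) : measurable_fun D (fun x : R => (x `^ alpha)%:E).
Proof. by apply/measurable_EFinP; apply: measurable_funTS; exact: measurable_powR. Qed.

Let mH : measurable_fun setT H.
Proof. by apply: emeasurable_funM => //; exact: mpow. Qed.

Let H0 x : (0 <= H x)%E.
Proof. by rewrite mule_ge0 ?lee_fin ?powR_ge0//. Qed.

Let HI : (\int[leb]_x H x = bergman_int alpha f)%E.
Proof.
rewrite (bergman_int_lines (proj1 fA)) [RHS]integral_mkcond; apply: eq_integral => x _.
rewrite /H /M !patchE; case: ifP => // _; exact: mule0.
Qed.

Let Mj (j : nat) (x : R) : \bar R := M (1 * x + j%:R * s)%R.

Let mMj j : measurable_fun setT (Mj j).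
Proof. exact: (measurableT_comp mM (measurable_affine 1 _)). Qed.

Let T (D : set R) j := (\int[leb]_(x in D) ((x `^ alpha)%:E * Mj j x))%E.

Let mT (D : set R) j : measurable_fun D (fun x => (x `^ alpha)%:E * Mj j x)%E.
Proof. by apply: emeasurable_funM; [exact: mpow|exact: measurable_funTS]. Qed.

Let pT j x : (0 <= (x `^ alpha)%:E * Mj j x)%E.
Proof. by rewrite mule_ge0 ?lee_fin ?powR_ge0//; exact: M0. Qed.

(** The cut-off at d makes [powR_shift] applicable. The constant blows up as d tends to 0, but it
    disappears from the conclusion of [T01]. *)
Let T_bound (d N : R) j : 0 < d -> (T `[d, N] j <=
  ((1 + s / d * j%:R) `^ (Num.max 0 (- alpha)))%:E * bergman_int alpha f)%E.
Proof.
move=> d0; set K := _ `^ _.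
have mD : measurable (`[d, N]%classic : set R) by exact: measurable_itv.
have mHj : measurable_fun setT (fun x : R => H (1 * x + j%:R * s)).
  exact: (measurableT_comp mH (measurable_affine 1 _)).
have K0 : 0 <= K by exact: powR_ge0.
have Hj0 (x : R) : setT x -> (0 <= H (1 * x + j%:R * s))%E by move=> _; exact: H0.
have E : (\int[leb]_x H (1 * x + j%:R * s)%R = bergman_int alpha f)%E.
  by rewrite (ge0_integral_affine _ ltr01 mH H0) invr1 mul1e HI.
rewrite -E -(ge0_integralZl_EFin leb measurableT Hj0 mHj K0).
have mKH : measurable_fun setT (fun x : R => (K%:E * H (1 * x + j%:R * s))%E).
  exact: measurable_funeM.
apply: (@le_trans _ _ (\int[leb]_(x in `[d, N]) (K%:E * H (1 * x + j%:R * s)%R))%E).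
  apply: (ge0_le_integral leb mD).
  - by move=> x _; exact: pT.
  - exact: mT.
  - exact: measurable_funTS.
  - move=> x; rewrite /= in_itv/= => /andP[dx _]; rewrite /H /Mj mul1r muleA -EFinM.
    apply: lee_wpmul2r; first exact: M0.
    rewrite lee_fin; have js : 0 <= j%:R * s by rewrite mulr_ge0// ltW.
    have -> : K = (1 + j%:R * s / d) `^ (Num.max 0 (- alpha)).
      by rewrite /K; congr powR; ring.
    exact: powR_shift.
apply: (ge0_subset_integral leb mD measurableT mKH) => // x _.
by rewrite mule_ge0// lee_fin.
Qed.

Let T_convex (d N : R) j : 0 < d ->
  (T `[d, N] j.+1 + T `[d, N] j.+1 <= T `[d, N] j + T `[d, N] j.+2)%E.
Proof.
move=> d0; set D := `[d, N]%classic.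
have mD : measurable D by exact: measurable_itv.
have D2 i k := ge0_integralD leb mD (fun x (_ : D x) => pT i x) (@mT D i)
  (fun x (_ : D x) => pT k x) (@mT D k).
rewrite {1}/T -[leLHS](D2 j.+1 j.+1) -[leRHS](D2 j j.+2).
apply: (ge0_le_integral leb mD).
- by move=> x _; apply: adde_ge0; exact: pT.
- by apply: emeasurable_funD; exact: mT.
- by apply: emeasurable_funD; exact: mT.
move=> x; rewrite /D /= in_itv/= => /andP[dx _].
have xj k : 0 < 1 * x + k%:R * s.
  by rewrite mul1r ltr_pwDl ?(lt_le_trans d0 dx)// mulr_ge0// ltW.
rewrite -!ge0_muleDr; try exact: M0.
apply: lee_wpmul2l; first by rewrite lee_fin powR_ge0.
rewrite /Mj !ME//.
have := mline_convex alpha1 fA (xj j) (ltW s0).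
have -> : 1 * x + j%:R * s + s = 1 * x + j.+1%:R * s by rewrite -natr1; ring.
by have -> : 1 * x + j%:R * s + (s + s) = 1 * x + j.+2%:R * s by rewrite -natr1 -natr1; ring.
Qed.

Let T01 (d N : R) : 0 < d -> (T `[d, N] 1 <= T `[d, N] 0)%E.
Proof.
move=> d0.
have T0 j : (0 <= T `[d, N] j)%E by apply: integral_ge0 => x _; exact: pT.
have If : bergman_int alpha f \is a fin_num.
  by rewrite ge0_fin_numE ?bergman_int_ge0//; exact: (proj2 fA).
have Tf j : T `[d, N] j \is a fin_num.
  rewrite ge0_fin_numE//; apply: le_lt_trans (T_bound N j d0) _.
  by rewrite -(fineK If) -EFinM ltry.
rewrite -(fineK (Tf 1%N)) -(fineK (Tf 0%N)) lee_fin.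
apply: (@growth_convex (fun j => fine (T `[d, N] j)) (s / d) (fine (bergman_int alpha f))
  (Num.max 0 (- alpha))).
- by rewrite divr_ge0// ltW.
- by rewrite fine_ge0// bergman_int_ge0.
- by rewrite le_max lexx.
- by rewrite gt_max ltr01/= ltrNl.
- move=> j; move: (T_convex N j d0) (Tf j) (Tf j.+1) (Tf j.+2).
  by case: (T _ j) => [x||]; case: (T _ j.+1) => [y||]; case: (T _ j.+2) => [z||].
- move=> j; move: (T_bound N j d0) (Tf j) If.
  by case: (T _ j) => [x||]; case: (bergman_int alpha f) => [y||].
- by rewrite fine_ge0.
Qed.

(* For fixed d < N, the integrals of x^alpha |f(x + js + iy)|^2 over d <= x <= N
   form a convex sequence in j, which by [powR_shift] grows at most like
   j^max(0, -alpha), hence sublinearly: it cannot increase. *)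
Lemma shift_contraction0 : (bergman_int alpha (compf 1 s%:C f) <= bergman_int alpha f)%E.
Proof.
have hs : holomorphic (compf 1 s%:C f) by apply: hol_compf (proj1 fA) => //=; exact: ltW.
rewrite (bergman_int_lines hs).
rewrite (_ : (\int[leb]_(x in P) _)%E = T P 1); last first.
  apply: eq_integral => x; rewrite inE /P /= in_itv/= andbT => x0.
  rewrite /Mj mul1r mul1r ME ?addr_gt0//; congr (_ * _)%E.
  by apply: eq_integral => y _; rewrite ext0_shift.
pose F (n : nat) : set R := `[n.+1%:R^-1, n.+1%:R]%classic.
have mF n : measurable (F n) by exact: measurable_itv.
have UF : \bigcup_n F n = P.
  apply/seteqP; split=> [x [n _]|x].
    rewrite /F /P /= !in_itv/= andbT => /andP[h _]; apply: lt_le_trans h.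
    by rewrite invr_gt0.
  rewrite /P /= in_itv/= andbT => x0.
  exists (Num.truncn (Num.max x x^-1)) => //.
  rewrite /F /= in_itv/=.
  have := truncnS_gt (Num.max x x^-1); rewrite gt_max => /andP[h1 h2].
  by rewrite (ltW h1) andbT -[leRHS]invrK lef_pV2 ?posrE ?invr_gt0// ltW.
have Fm : {homo F : n m / (n <= m)%N >-> (n <= m)%O}.
  move=> n m nm; apply/subsetPset => y; rewrite /F /= !in_itv/= => /andP[h1 h2].
  have nm1 : n.+1%:R <= m.+1%:R :> R by rewrite ler_nat.
  rewrite (le_trans h2 nm1) andbT; apply: le_trans h1.
  by rewrite lef_pV2 ?posrE.
have pF n x : F n x -> (0 <= (x `^ alpha)%:E * Mj 1 x)%E by move=> _; exact: pT.
have AC := @ge0_nondecreasing_set_cvg_integral _ (measurableTypeR R) R F _ leb Fm mF (fun n => @mT (F n) 1) pF.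
rewrite /T -UF; move/cvg_lim: (AC) => <- //.
apply: lime_le; first by apply/cvg_ex; eexists; exact: AC.
apply: nearW => n; apply: (@le_trans _ _ (T (F n) 0)).
  by apply: T01; rewrite invr_gt0.
rewrite -HI (_ : T (F n) 0 = (\int[leb]_(x in F n) H x)%E); last first.
  by apply: eq_integral => x _; rewrite /Mj mul1r mul0r addr0.
exact: (ge0_subset_integral leb (mF n) measurableT mH).
Qed.

End Shift.

End Contraction.

(** * Norm, inner product and composition operators; symmetry and injectivity of shifts *)

Section BergmanSpace.
Variables (R : realType) (alpha : R).
Hypothesis alpha1 : -1 < alpha.
Local Notation C := R[i]^o.
Local Notation leb := (@lebesgue_measure R).
Local Notation leb2 := (leb \x leb)%E.
Local Notation V := (bergman alpha).
Implicit Types f g h : V.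

Lemma ext0D (u w : half_plane R -> C) z : ext0 (u + w) z = ext0 u z + ext0 w z.
Proof. by have := ext0_lin 1 u w; rewrite !scale1r => ->. Qed.

Lemma ext0Z (k : R[i]) (u : half_plane R -> C) z : ext0 (k *: u) z = k * ext0 u z.
Proof.
have -> : k *: u = k *: u + 0 by rewrite addr0.
rewrite ext0_lin /GRing.add/= [ext0 0 z](_ : _ = 0) ?addr0//.
by rewrite /ext0; case: (insub z).
Qed.

Lemma ext0N (u : half_plane R -> C) z : ext0 (- u) z = - ext0 u z.
Proof. by rewrite -scaleN1r ext0Z mulN1r. Qed.

Lemma ext0B (u w : half_plane R -> C) z : ext0 (u - w) z = ext0 u z - ext0 w z.
Proof. by rewrite ext0D ext0N. Qed.

Lemma bergmanA f : inA alpha f.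
Proof. by have /bergman_predP := valP f. Qed.

Lemma bergman_ext f g : (forall z : C, 0 < complex.Re z -> ext0 f z = ext0 g z) -> f = g.
Proof.
move=> fg; apply/val_inj/funext => -[z z0].
by have := fg z z0; rewrite !ext0E.
Qed.

Definition nsq f : R := fine (bergman_int alpha f).

Definition nrm f : R := Num.sqrt (nsq f).

Lemma nsqE f : (nsq f)%:E = bergman_int alpha f.
Proof. by rewrite fineK// ge0_fin_numE ?bergman_int_ge0//; case: (bergmanA f). Qed.

Lemma nsq_ge0 f : 0 <= nsq f.
Proof. by rewrite fine_ge0// bergman_int_ge0. Qed.

Lemma nrm_ge0 f : 0 <= nrm f. Proof. exact: sqrtr_ge0. Qed.

Lemma sqr_nrm f : nrm f ^+ 2 = nsq f.
Proof. by rewrite sqr_sqrtr// nsq_ge0. Qed.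

Lemma normVE f : `|f| = (nrm f)%:C. Proof. by []. Qed.

Lemma nrmD f g : nrm (f + g) <= nrm f + nrm g.
Proof. by rewrite -lecR rmorphD /= -!normVE ler_normD. Qed.

Lemma nrmZ (k : R[i]) f : nrm (k *: f) = normc k * nrm f.
Proof. by apply/(@complexI R); rewrite rmorphM /= -!normVE normrZ. Qed.

Lemma nrmN f : nrm (- f) = nrm f.
Proof. by apply/(@complexI R); rewrite /= -!normVE normrN. Qed.

Lemma nrmB f g : nrm (f - g) <= nrm f + nrm g.
Proof. by apply: le_trans (nrmD _ _) _; rewrite nrmN. Qed.

Lemma nrm0 : nrm 0 = 0.
Proof. by apply/(@complexI R); rewrite /= -normVE normr0. Qed.

Lemma nrm_eq0 f : nrm f = 0 -> f = 0.
Proof. by move=> f0; apply/eqP; rewrite -normr_eq0 normVE f0. Qed.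

Lemma nsqZ (r : R) f : nsq (r%:C *: f) = r ^+ 2 * nsq f.
Proof. by rewrite -!sqr_nrm nrmZ exprMn normc_real real_normK ?num_real. Qed.

Lemma nsqN f : nsq (- f) = nsq f.
Proof. by rewrite -!sqr_nrm nrmN. Qed.

Definition compV (a : R) (b : R[i]) f : V := insubd 0 (compf a b f).

Lemma composition_opE a b (a0 : 0 < a) (b0 : 0 <= complex.Re b) :
  @composition_op R alpha (affine_symbol a0 b0) = compV a b.
Proof. by apply/funext => f; rewrite /composition_op compfE. Qed.

Lemma shift_contraction (u : half_plane R -> C) (s : R) : inA alpha u -> 0 <= s ->
  (bergman_int alpha (compf 1 s%:C u) <= bergman_int alpha u)%E.
Proof.
move=> uA; rewrite le_eqVlt => /predU1P[<-|s0]; last exact: shift_contraction0.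
rewrite (_ : compf 1 (0 : R)%:C u = u)//.
by apply/funext => -[z z0]; rewrite /compf /= mul1r addr0 ext0E.
Qed.

Lemma compf_split a (b : R[i]) (u : half_plane R -> C) : 0 < a -> 0 <= complex.Re b ->
  compf a b u = compf a (0 +i* complex.Im b) (compf 1 (complex.Re b)%:C u).
Proof.
move=> a0 b0; apply/funext => -[z z0]; rewrite [LHS]/compf [RHS]/compf /=.
rewrite ext0_compf; last by rewrite ReD ReM /= mul0r subr0 addr0 mulr_gt0.
congr (ext0 u _); rewrite mul1r -addrA; congr (_ + _).
by case: (b) => b1 b2; apply/eqP; rewrite eq_complex /= addr0 add0r !eqxx.
Qed.

Lemma bergman_int_compf a (b : R[i]) (u : half_plane R -> C) : 0 < a -> 0 <= complex.Re b ->
  inA alpha u -> bergman_int alpha (compf a b u) =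
  ((a `^ (- (2 + alpha)))%:E * bergman_int alpha (compf 1 (complex.Re b)%:C u))%E.
Proof.
move=> a0 b0 uA; rewrite compf_split//.
have b00 : 0 <= complex.Re (0 +i* complex.Im b) by [].
rewrite -(compfE a0 b00); apply: bergman_int_dilation => //.
by apply: hol_compf (proj1 uA) => //; exact: ltr01.
Qed.

Lemma inA_compf a b (u : half_plane R -> C) : 0 < a -> 0 <= complex.Re b ->
  inA alpha u -> inA alpha (compf a b u).
Proof.
move=> a0 b0 uA; split; first exact: hol_compf (proj1 uA).
rewrite bergman_int_compf//.
apply: lte_mul_pinfty; rewrite ?lee_fin ?powR_ge0//.
exact: le_lt_trans (shift_contraction uA b0) (proj2 uA).
Qed.

Lemma compVE a b f : 0 < a -> 0 <= complex.Re b -> bergman_fun (compV a b f) = compf a b f.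
Proof.
move=> a0 b0; rewrite /compV -[bergman_fun _]/(val _) insubdK//.
exact/bergman_predP/inA_compf/bergmanA.
Qed.

Lemma ext0_compV a b f (z : C) : 0 < a -> 0 <= complex.Re b -> 0 < complex.Re z ->
  ext0 (compV a b f) z = ext0 f (a%:C * z + b).
Proof. by move=> a0 b0 z0; rewrite compVE// ext0_compf. Qed.

Lemma Re_affine a (b z : R[i]) : 0 < a -> 0 <= complex.Re b -> 0 < complex.Re z ->
  0 < complex.Re (a%:C * z + b).
Proof. by move=> a0 b0 z0; rewrite ReD ReM /= mul0r subr0 ltr_wpDr// mulr_gt0. Qed.

Lemma compV_comp a b a' b' f : 0 < a -> 0 <= complex.Re b -> 0 < a' -> 0 <= complex.Re b' ->
  compV a b (compV a' b' f) = compV (a' * a) (a'%:C * b + b') f.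
Proof.
move=> a0 b0 a0' b0'; apply: bergman_ext => z z0.
have h : 0 <= complex.Re (a'%:C * b + b').
  by rewrite ReD ReM /= mul0r subr0 addr_ge0// mulr_ge0// ltW.
rewrite !ext0_compV ?mulr_gt0//; last exact: Re_affine.
by congr (ext0 f _); rewrite rmorphM /= ; ring.
Qed.

Lemma compV1 f : compV 1 0 f = f.
Proof. by apply: bergman_ext => z z0; rewrite ext0_compV ?ltr01// mul1r addr0. Qed.

Lemma compVD a b f g : 0 < a -> 0 <= complex.Re b ->
  compV a b (f + g) = compV a b f + compV a b g.
Proof.
move=> a0 b0; apply: bergman_ext => z z0.
by rewrite ext0_compV// !ext0D !ext0_compV.
Qed.

Lemma compVZ a b (k : R[i]) f : 0 < a -> 0 <= complex.Re b ->
  compV a b (k *: f) = k *: compV a b f.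
Proof.
move=> a0 b0; apply: bergman_ext => z z0.
by rewrite ext0_compV// !ext0Z !ext0_compV.
Qed.

Lemma compVB a b f g : 0 < a -> 0 <= complex.Re b ->
  compV a b (f - g) = compV a b f - compV a b g.
Proof. by move=> a0 b0; rewrite compVD// -scaleN1r compVZ// scaleN1r. Qed.

Lemma compV_sum a b n (F : 'I_n -> V) : 0 < a -> 0 <= complex.Re b ->
  compV a b (\sum_(i < n) F i) = \sum_(i < n) compV a b (F i).
Proof.
move=> a0 b0; elim/big_ind2 : _ => //.
- by rewrite -[X in compV _ _ X](scale0r 0) compVZ// scale0r.
- by move=> f f' g g' <- <-; rewrite compVD.
Qed.

Lemma nsq_compV a b f : 0 < a -> 0 <= complex.Re b ->
  nsq (compV a b f) = a `^ (- (2 + alpha)) * nsq (compV 1 (complex.Re b)%:C f).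
Proof.
move=> a0 b0; rewrite /nsq (compVE f a0 b0).
have b0' : 0 <= complex.Re ((complex.Re b)%:C : R[i]) by [].
rewrite (compVE f ltr01 b0') (bergman_int_compf a0 b0 (bergmanA f)).
by rewrite -(compVE f ltr01 b0') -nsqE -EFinM.
Qed.

Lemma nsq_shift_le (s : R) f : 0 <= s -> nsq (compV 1 s%:C f) <= nsq f.
Proof.
move=> s0; rewrite -lee_fin !nsqE (compVE f ltr01 (s0 : 0 <= complex.Re (s%:C : R[i]))).
exact: shift_contraction (bergmanA f) s0.
Qed.

Lemma nrm_shift_le (s : R) f : 0 <= s -> nrm (compV 1 s%:C f) <= nrm f.
Proof. by move=> s0; rewrite ler_wsqrtr// nsq_shift_le. Qed.

Lemma nrm_compV_le a b f : 0 < a -> 0 <= complex.Re b ->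
  nrm (compV a b f) <= Num.sqrt (a `^ (- (2 + alpha))) * nrm f.
Proof.
move=> a0 b0; rewrite /nrm -sqrtrM ?powR_ge0// ler_wsqrtr// nsq_compV//.
by rewrite ler_wpM2l ?powR_ge0// nsq_shift_le.
Qed.

Definition cross f g (p : R * R) : R :=
  complex.Re (ext0 f (p.1 +i* p.2) * conjc (ext0 g (p.1 +i* p.2))) * p.1 `^ alpha.

Lemma crossE f g p : cross f g p = 4^-1 * dens alpha (f + g) p - 4^-1 * dens alpha (f - g) p.
Proof.
rewrite /cross /dens -[bergman_fun (f + g)]/(bergman_fun f + bergman_fun g).
rewrite -[bergman_fun (f - g)]/(bergman_fun f - bergman_fun g) ext0D ext0B Re_mulconj.
by field.
Qed.

Lemma integrable_cross f g : leb2.-integrable setT (EFin \o cross f g).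
Proof.
rewrite (_ : EFin \o cross f g = (fun p => (4^-1)%:E * (EFin \o dens alpha (f + g)%R) p -
    (4^-1)%:E * (EFin \o dens alpha (f - g)%R) p)%E).
  by apply: integrableB => //; apply: integrableZl => //; apply: integrable_dens; exact: bergmanA.
by apply/funext => p; rewrite /= crossE EFinB !EFinM.
Qed.

(** The real part of the Hilbert space inner product. Its real bilinearity suits the later argument,
    whose moments and polynomials are real. *)
Definition ip f g : R := \int[leb2]_p cross f g p.

Lemma ipff f : ip f f = nsq f.
Proof.
rewrite /ip /Rintegral /nsq bergman_intE; congr fine; apply: eq_integral => p _.
congr EFin; rewrite /cross /dens sqr_normcE ReM; case: (ext0 _ _) => a b /=; ring.
Qed.

Lemma ipC f g : ip f g = ip g f.
Proof.
apply: eq_Rintegral => p _; congr (_ * _); rewrite !ReM.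
by case: (ext0 f _) => a b; case: (ext0 g _) => c d /=; ring.
Qed.

Lemma ipDl f g h : ip (f + g) h = ip f h + ip g h.
Proof.
rewrite /ip -RintegralD//; try exact: integrable_cross.
apply: eq_Rintegral => p _; rewrite /cross -mulrDl; congr (_ * _).
by rewrite -[bergman_fun (f + g)]/(bergman_fun f + bergman_fun g) ext0D mulrDl ReD.
Qed.

Lemma ipZl (r : R) f h : ip (r%:C *: f) h = r * ip f h.
Proof.
rewrite /ip -RintegralZl//; last exact: integrable_cross.
apply: eq_Rintegral => p _; rewrite /cross mulrA; congr (_ * _).
rewrite -[bergman_fun (r%:C *: f)]/(r%:C *: bergman_fun f) ext0Z -mulrA ReM /=.
by rewrite mul0r subr0.
Qed.

Lemma ipDr f g h : ip h (f + g) = ip h f + ip h g.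
Proof. by rewrite ipC ipDl !(ipC h). Qed.

Lemma ipZr (r : R) f h : ip h (r%:C *: f) = r * ip h f.
Proof. by rewrite ipC ipZl (ipC h). Qed.

Lemma ipNl f h : ip (- f) h = - ip f h.
Proof. by rewrite -scaleN1r -[-1](rmorphN1 (real_complex R)) ipZl mulN1r. Qed.

Lemma ipNr f h : ip h (- f) = - ip h f.
Proof. by rewrite ipC ipNl ipC. Qed.

Lemma nsqD f g : nsq (f + g) = nsq f + 2 * ip f g + nsq g.
Proof. by rewrite -!ipff ipDl !ipDr (ipC g f); ring. Qed.

Lemma nsqB f g : nsq (f - g) = nsq f - 2 * ip f g + nsq g.
Proof. by rewrite nsqD nsqN ipNr; ring. Qed.

Lemma nsq_eq0 f : nsq f = 0 -> f = 0.
Proof. by move=> f0; apply: nrm_eq0; rewrite /nrm f0 sqrtr0. Qed.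

Lemma ip_sqr_le f g : ip f g ^+ 2 <= nsq f * nsq g.
Proof.
have [g0|g0] := eqVneq (nsq g) 0.
  by rewrite (nsq_eq0 g0) -(scale0r (0 : V)) -[0 : R[i]](rmorph0 (real_complex R)) ipZr mul0r expr0n
    mulr_ge0// nsq_ge0.
have gp : 0 < nsq g by rewrite lt_neqAle eq_sym g0 nsq_ge0.
have := nsq_ge0 (f - (ip f g / nsq g)%:C *: g).
rewrite nsqB ipZr nsqZ => h.
have E : nsq f - 2 * (ip f g / nsq g * ip f g) + (ip f g / nsq g) ^+ 2 * nsq g =
  (nsq f * nsq g - ip f g ^+ 2) / nsq g by field.
by move: h; rewrite E pmulr_lge0 ?invr_gt0// subr_ge0.
Qed.

Lemma ip_le f g : `|ip f g| <= nrm f * nrm g.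
Proof.
rewrite -(@ler_pXn2r _ 2) ?nnegrE ?mulr_ge0 ?nrm_ge0//.
by rewrite real_normK ?num_real// exprMn !sqr_nrm ip_sqr_le.
Qed.

Lemma polar_arith (p q x y z t : R) :
  p + 2 * x + z + (q - 2 * y + t) = q + 2 * y + t + (p - 2 * x + z) -> x = y.
Proof. lra. Qed.

(** By polarisation this is an identity between four squared norms, which [line_sym] gives on each
    vertical line before integration in x. *)
Lemma ip_shift (s : R) f g : 0 <= s ->
  ip (compV 1 s%:C f) g = ip f (compV 1 s%:C g).
Proof.
move=> s0; set Sf := compV 1 s%:C f; set Sg := compV 1 s%:C g.
suff E : nsq (Sf + g) + nsq (f - Sg) = nsq (f + Sg) + nsq (Sf - g).
  rewrite (nsqD Sf g) (nsqD f Sg) (nsqB f Sg) (nsqB Sf g) in E; apply: polar_arith E.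
apply/EFin_inj; rewrite !EFinD !nsqE.
have hA (u : V) := proj1 (bergmanA u).
rewrite !(bergman_int_lines alpha (hA _)).
pose P : set R := `]0, +oo[%classic.
have mP : measurable P by exact: measurable_itv.
have mpl (u : V) : measurable_fun P (fun x => (x `^ alpha)%:E * mline u x)%E.
  apply: emeasurable_funM; last exact: measurable_mline (hA u).
  by apply/measurable_EFinP; apply: measurable_funTS; exact: measurable_powR.
have ppl (u : V) (x : R) : P x -> (0 <= (x `^ alpha)%:E * mline u x)%E.
  by move=> _; rewrite mule_ge0 ?lee_fin ?powR_ge0 ?mline_ge0.
have ID (u w : V) := ge0_integralD leb mP (ppl u) (mpl u) (ppl w) (mpl w).
rewrite -[LHS](ID (Sf + g) (f - Sg)) -[RHS](ID (f + Sg) (Sf - g)).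
apply: eq_integral => x; rewrite /P inE /= in_itv/= andbT => x0.
rewrite -!ge0_muleDr ?mline_ge0//; congr (_ * _)%E.
have mm (u : V) : measurable_fun setT (fun y : R => (normc (ext0 u (x +i* y)) ^+ 2)%:E).
  by apply/measurable_EFinP; exact: continuous_measurable_fun (ccont_sq (ccont_line (hA u) x0)).
have pp (u : V) (y : R) : setT y -> (0 <= (normc (ext0 u (x +i* y)) ^+ 2)%:E)%E.
  by move=> _; rewrite lee_fin sqr_ge0.
have LD (u w : V) := ge0_integralD leb measurableT (pp u) (mm u) (pp w) (mm w).
rewrite /mline -[LHS](LD (Sf + g) (f - Sg)) -[RHS](LD (f + Sg) (Sf - g)).
have xs : x <= x + s by rewrite lerDl.
have Sh (u : V) y : ext0 (compV 1 s%:C u) (x +i* y) = ext0 u ((x + s) +i* y).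
  by rewrite compVE ?ltr01//; exact: ext0_shift.
have vD (u w : V) z : ext0 (u + w : V) z = ext0 u z + ext0 w z by exact: ext0D.
have vB (u w : V) z : ext0 (u - w : V) z = ext0 u z - ext0 w z by exact: ext0B.
have := line_sym alpha1 (bergmanA f) (bergmanA g) x0 xs => LS.
transitivity (\int[leb]_y (normc (ext0 f ((x + s) +i* y) + ext0 g (x +i* y)) ^+ 2 +
               normc (ext0 f (x +i* y) - ext0 g ((x + s) +i* y)) ^+ 2)%:E)%E.
  by apply: eq_integral => y _; rewrite vD vB !Sh -EFinD.
rewrite LS; apply: eq_integral => y _; rewrite vD vB !Sh -EFinD//.
Qed.

Lemma shiftD (s t : R) f : 0 <= s -> 0 <= t ->
  compV 1 s%:C (compV 1 t%:C f) = compV 1 (s + t)%:C f.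
Proof.
move=> s0 t0; have s0' : 0 <= complex.Re (s%:C : R[i]) by [].
have t0' : 0 <= complex.Re (t%:C : R[i]) by [].
by rewrite (compV_comp f ltr01 s0' ltr01 t0') mulr1 mul1r -rmorphD.
Qed.

Lemma ext0_0 z : ext0 (0 : V) z = 0.
Proof. by rewrite /ext0; case: (insub z). Qed.

(** If S_t f = 0, then the squared norm of S_(t/2) f is <S_t f, f> = 0. Halving repeatedly, f
    vanishes on Re z > s / 2^n for every n. *)
Lemma shift_eq0 (s : R) f : 0 <= s -> compV 1 s%:C f = 0 -> f = 0.
Proof.
move=> s0 Sf0.
have Z (t : R) : 0 <= t -> compV 1 t%:C f = 0 -> compV 1 (t / 2)%:C f = 0.
  move=> t0 tf0; have t20 : 0 <= t / 2 by rewrite divr_ge0.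
  apply: nsq_eq0; rewrite -ipff ip_shift// shiftD// -splitr tf0.
  by rewrite -(scale0r (0 : V)) -[0 : R[i]](rmorph0 (real_complex R)) ipZr mul0r.
have Zn n : compV 1 (s / 2 ^+ n)%:C f = 0.
  elim: n => [|n IH]; first by rewrite expr0 divr1.
  rewrite exprSr invfM mulrA; apply: Z => //.
  by rewrite divr_ge0// exprn_ge0.
apply: bergman_ext => z z0.
have [n nz] : exists n, s / 2 ^+ n < complex.Re z.
  exists (Num.truncn (s / complex.Re z)).+1; rewrite ltr_pdivrMr ?exprn_gt0//.
  rewrite mulrC -ltr_pdivrMr//; apply: lt_le_trans (truncnS_gt _) _.
  by rewrite -natrX ler_nat; apply: ltnW; exact: ltn_expl.
have zn : 0 < complex.Re (z - (s / 2 ^+ n)%:C) by rewrite ReB /= subr_gt0.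
have sn : 0 <= complex.Re (s / 2 ^+ n)%:C by rewrite /= divr_ge0// exprn_ge0.
have := ext0_compV f ltr01 sn zn; rewrite mul1r subrK => <-.
by rewrite Zn !ext0_0.
Qed.

End BergmanSpace.

(** * Completeness *)

Section CauchyEstimate.
Variable R : realType.
Local Notation C := R[i]^o.

(** The 32 is 4 * 4 from [bd_bound] on a square of half-side r, times 2 because w - (c + h) has
    modulus at least r / 2 on its boundary. *)
Definition estC : R := 32 / normc (cauchyJ R).

Lemma estC_gt0 : 0 < estC.
Proof. by rewrite divr_gt0// normc_gt0 cauchyJ_neq0. Qed.

(** A quadratic Taylor remainder that depends on f through its bound M alone. This uniformity makes
    limits holomorphic and yields Lipschitz bounds. *)
Lemma cauchy_estimate (f : C -> C) (a b r M : R) : 0 < r ->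
  (forall z, rect (a - r) (a + r) (b - r) (b + r) z -> cdiff f z) ->
  (forall z, rect (a - r) (a + r) (b - r) (b + r) z -> normc (f z) <= M) ->
  exists l : C, forall h : C, normc h <= r / 2 ->
    normc (f ((a +i* b) + h) - f (a +i* b) - l * h) <= estC * M / r ^+ 2 * normc h ^+ 2.
Proof.
move=> r0 df fM; set c : C := a +i* b.
have aa : a - r <= a + r by lra.
have bb : b - r <= b + r by lra.
have r20 : 0 < r / 2 by rewrite divr_gt0.
have far h w : normc h <= r / 2 -> rbd (a - r) (a + r) (b - r) (b + r) w ->
    r / 2 <= normc (w - (c + h)).
  move=> hr wb; have /andP[h1 _] := sq_bd_dist r0 wb.
  have := le_normcD (w - (c + h)) h; rewrite (_ : w - (c + h) + h = w - c); last by ring.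
  by move=> h2; clear -hr h1 h2; lra.
have dif (k : C) w : w - k != 0 -> cdiff (fun w : C => (w - k)^-1) w.
  move=> wk; apply: cdiffV => //.
  by apply: cdiffB; [exact: cdiff_id|exact: cdiff_cst].
have n0 h w : normc h <= r / 2 -> rbd (a - r) (a + r) (b - r) (b + r) w -> w - (c + h) != 0.
  by move=> hr wb; rewrite -normc_gt0 (lt_le_trans r20)// far.
pose g (h : C) (w : C) : C := f w / (w - (c + h)).
have dg h w : normc h <= r / 2 -> rbd (a - r) (a + r) (b - r) (b + r) w -> cdiff (g h) w.
  move=> hr wb; apply: (@cdiffM R f (fun w => (w - (c + h))^-1)); first by apply: df; case: wb.
  exact/dif/n0.
pose q (w : C) : C := g 0 w * (w - c)^-1.
have h00 : normc (0 : C) <= r / 2 by rewrite normc0 ltW.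
have dq w : rbd (a - r) (a + r) (b - r) (b + r) w -> cdiff q w.
  move=> wb; apply: (@cdiffM R (g 0) (fun w => (w - c)^-1)); first exact: dg.
  by apply: dif; have := n0 0 w h00 wb; rewrite addr0.
have cr h : normc h <= r / 2 -> bd (g h) (a - r) (a + r) (b - r) (b + r) = f (c + h) * cauchyJ R.
  move=> hr; have := normc_ge_absRe h; have := normc_ge_absIm h; rewrite !ler_norml.
  move: hr; move: (normc h) => s; case: h => u v hr /= /andP[v1 v2] /andP[u1 u2].
  apply: (@Cauchy_rect R f _ _ _ _ (a + u) (b + v)) => //; apply/andP; split; clear -r0 hr v1 v2 u1 u2; lra.
exists (bd q (a - r) (a + r) (b - r) (b + r) / cauchyJ R) => h hr.
have J0 := cauchyJ_neq0 R; have J1 : 0 < normc (cauchyJ R) by rewrite normc_gt0.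
(* The remainder kernel: 1 / (w - c - h) - 1 / (w - c) - h / (w - c)^2 equals h^2 / ((w - c)^2 (w -
   c - h)). *)
pose k (w : C) : C := h ^+ 2 * (f w / ((w - c) ^+ 2 * (w - (c + h)))).
have ED : bd k (a - r) (a + r) (b - r) (b + r) =
    bd (g h) (a - r) (a + r) (b - r) (b + r) +
    (- 1 * bd (g 0) (a - r) (a + r) (b - r) (b + r) + - h * bd q (a - r) (a + r) (b - r) (b + r)).
  have cg h' : normc h' <= r / 2 -> bcont (g h') (a - r) (a + r) (b - r) (b + r).
    by move=> hr' w wb; apply: (@cdiff_cvg R (g h')); exact: dg.
  have cq : bcont q (a - r) (a + r) (b - r) (b + r).
    by move=> w wb; apply: (@cdiff_cvg R q); exact: dq.
  have cz (k' : C) (g' : C -> C) : (forall w, rbd (a - r) (a + r) (b - r) (b + r) w -> cdiff g' w) ->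
      forall w, rbd (a - r) (a + r) (b - r) (b + r) w -> cdiff (fun w => k' * g' w) w.
    by move=> dg' w wb; apply: (@cdiffM R (fun=> k') g'); [exact: cdiff_cst|exact: dg'].
  have d0 := cz (-1) (g 0) (fun w wb => dg 0 w h00 wb).
  have dh := cz (- h) q dq.
  have c2 : bcont (fun w => - h * q w) (a - r) (a + r) (b - r) (b + r).
    by move=> w wb; apply: (@cdiff_cvg R (fun w => - h * q w)); exact: dh.
  have c1 : bcont (fun w => -1 * g 0 w) (a - r) (a + r) (b - r) (b + r).
    by move=> w wb; apply: (@cdiff_cvg R (fun w => -1 * g 0 w)); exact: d0.
  have c12 : bcont (fun w => -1 * g 0 w + - h * q w) (a - r) (a + r) (b - r) (b + r).
    move=> w wb; apply: (@cdiff_cvg R (fun w => -1 * g 0 w + - h * q w)).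
    by apply: (@cdiffD R (fun w => -1 * g 0 w) (fun w => - h * q w)); [exact: d0|exact: dh].
  rewrite -(@bdZ R (-1) (g 0) _ _ _ _ aa bb (cg 0 h00)) -(@bdZ R (- h) q _ _ _ _ aa bb cq).
  rewrite -(@bdD R (fun w => -1 * g 0 w) (fun w => - h * q w) _ _ _ _ aa bb c1 c2).
  rewrite -(@bdD R (g h) (fun w => -1 * g 0 w + - h * q w) _ _ _ _ aa bb (cg h hr) c12).
  apply: eq_bd => // w wb; have k1 := n0 h w hr wb; have k2 := n0 0 w h00 wb.
  rewrite /k /q /g; rewrite addr0 in k2 *.
  by field; rewrite k1 k2.
have -> : f (c + h) - f c - bd q (a - r) (a + r) (b - r) (b + r) / cauchyJ R * h =
    bd k (a - r) (a + r) (b - r) (b + r) / cauchyJ R.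
  rewrite ED (cr h hr) (cr 0 h00) addr0; by field.
have M0 : 0 <= M.
  apply: le_trans (fM c _); first exact: normc_ge0.
  by split; rewrite /c /=; apply/andP; split; clear -r0; lra.
have kb w : rbd (a - r) (a + r) (b - r) (b + r) w -> normc (k w) <= 2 * M * normc h ^+ 2 / r ^+ 3.
  move=> wb; have k1 := n0 h w hr wb; have k2 := n0 0 w h00 wb.
  rewrite addr0 in k2.
  have /andP[h1 _] := sq_bd_dist r0 wb; have h2 := far h w hr wb.
  have -> : normc (k w) =
      normc h ^+ 2 * (normc (f w) * (normc (w - c) ^+ 2 * normc (w - (c + h)))^-1).
    by rewrite /k normcM normcX; congr (_ * _); rewrite normcM normcV normcM normcX.
  have -> : 2 * M * normc h ^+ 2 / r ^+ 3 = normc h ^+ 2 * (M * (r ^+ 2 * (r / 2))^-1).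
    by field; rewrite gt_eqF.
  rewrite ler_wpM2l ?sqr_ge0// ler_pM ?normc_ge0 ?invr_ge0 ?mulr_ge0 ?sqr_ge0 ?normc_ge0//.
    by apply: fM; case: wb.
  rewrite lef_pV2 ?posrE ?mulr_gt0 ?exprn_gt0 ?normc_gt0//.
  by rewrite ler_pM ?sqr_ge0 ?(ltW r20)// ler_pXn2r ?nnegrE ?normc_ge0 ?(ltW r0).
have ck : bcont k (a - r) (a + r) (b - r) (b + r).
  move=> w wb; have k1 := n0 h w hr wb; have k2 := n0 0 w h00 wb.
  rewrite addr0 in k2.
  have did (k' : C) : cdiff (fun w : C => w - k') w.
    by apply: cdiffB; [exact: cdiff_id|exact: cdiff_cst].
  apply: (@cdiff_cvg R k); apply: (@cdiffM R (fun=> h ^+ 2) (fun w => f w / ((w - c) ^+ 2 * (w - (c + h))))).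
    exact: cdiff_cst.
  apply: (@cdiffM R f (fun w => ((w - c) ^+ 2 * (w - (c + h)))^-1)); first by apply: df; case: wb.
  apply: (@cdiffV R (fun w => ((w - c) ^+ 2 * (w - (c + h))))).
    by rewrite mulf_neq0// expf_neq0.
  apply: (@cdiffM R (fun w => (w - c) ^+ 2) (fun w => w - (c + h))) => //.
  exact: (@cdiffX R (fun w => w - c)).
have := bd_bound aa bb ck kb; rewrite normcM normcV.
rewrite ler_pdivrMr// => /le_trans; apply; rewrite /estC.
rewrite le_eqVlt; apply/orP; left; apply/eqP.
by field; rewrite gt_eqF// gt_eqF.
Qed.

Lemma complex_complete (v : nat -> C) :
  (forall e : R, 0 < e -> exists N, forall n m, (N <= n)%N -> (N <= m)%N ->
    normc (v n - v m) <= e) ->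
  exists l : C, forall e : R, 0 < e -> exists N, forall n, (N <= n)%N -> normc (v n - l) <= e.
Proof.
move=> cv.
have Rc (u : nat -> R) : (forall n m, `|u n - u m| <= normc (v n - v m)) ->
    exists l : R, u @ \oo --> l.
  move=> uv; suff /cvg_ex[l ul] : cvg (u @ \oo) by exists l.
  apply/cauchy_cvgP/cauchy_exP => e e0.
  have e20 : 0 < e / 2 by rewrite divr_gt0.
  have [N HN] := cv _ e20.
  exists (u N); exists N => //= n Nn; rewrite /ball/=.
  apply: le_lt_trans (uv N n) _; apply: le_lt_trans (HN N n (leqnn N) Nn) _.
  by rewrite ltr_pdivrMr// ltr_pMr// ltr1n.
have [|x vx] := Rc (fun n => complex.Re (v n)).
  by move=> n m; rewrite -ReB; exact: normc_ge_absRe.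
have [|y vy] := Rc (fun n => complex.Im (v n)).
  by move=> n m; rewrite -ImB; exact: normc_ge_absIm.
exists (x +i* y) => e e0.
have FF : Filter (\oo : set_system nat) by exact _.
have /cvgcP /(_ e e0) [N _ HN] := cvg_cplx FF vx vy.
exists N => n Nn; apply: ltW; have := HN n Nn; rewrite /=.
by case: (v n).
Qed.

End CauchyEstimate.

(** * Completeness of the Bergman space *)

Section Complete.
Variables (R : realType) (alpha : R).
Hypothesis alpha1 : -1 < alpha.
Local Notation C := R[i]^o.
Local Notation leb := (@lebesgue_measure R).
Local Notation leb2 := (leb \x leb)%E.
Local Notation V := (bergman alpha).
Implicit Types f g h : V.

Lemma alpha2 : 0 < 2 + alpha.
Proof. by rewrite -(subrr 2) ltrD2l (lt_trans _ alpha1)// ltrN2 ltr1n. Qed.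

(** A bound for the norm of the evaluation at any point of real part x. *)
Definition ptC (x : R) : R := Num.sqrt (evalC alpha / x `^ (2 + alpha)).

Lemma ptC_ge0 x : 0 <= ptC x. Proof. exact: sqrtr_ge0. Qed.

Lemma ptC_le (x y : R) : 0 < x -> x <= y -> ptC y <= ptC x.
Proof.
move=> x0 xy; have y0 := lt_le_trans x0 xy.
rewrite ler_wsqrtr// ler_wpM2l ?(ltW (evalC_gt0 _))// lef_pV2 ?posrE ?powR_gt0//.
by rewrite ge0_ler_powR ?nnegrE ?(ltW alpha2) ?(ltW x0) ?(ltW y0).
Qed.

Lemma pt_bound f (z : C) : 0 < complex.Re z ->
  normc (ext0 f z) <= ptC (complex.Re z) * nrm f.
Proof.
case: z => x y /= x0.
rewrite /ptC /nrm -sqrtrM ?divr_ge0 ?powR_ge0 ?(ltW (evalC_gt0 _))//.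
rewrite -[leLHS]ger0_norm ?normc_ge0// -sqrtr_sqr ler_wsqrtr//.
rewrite mulrAC ler_pdivlMr ?powR_gt0// -lee_fin EFinM.
have hf := proj1 (bergmanA f).
apply: le_trans (eval_bound alpha y hf x0) _; rewrite [leRHS]EFinM nsqE bergman_intE.
apply: lee_wpmul2l; first by rewrite lee_fin ltW// evalC_gt0.
apply: (ge0_subset_integral leb2 (@measurable_sq R _ _ _) measurableT) => //.
  exact: measurable_dens.
by move=> p _; rewrite lee_fin dens_ge0.
Qed.

Lemma pt_bound2 f (x : R) (z : C) : 0 < x -> x <= complex.Re z ->
  normc (ext0 f z) <= ptC x * nrm f.
Proof.
move=> x0 xz; apply: le_trans (pt_bound f (lt_le_trans x0 xz)) _.
by rewrite ler_wpM2r ?nrm_ge0// ptC_le.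
Qed.

Lemma bergman_estimate f (x y : R) : 0 < x -> exists l : C, forall h : C,
  normc h <= x / 4 ->
  normc (ext0 f ((x +i* y) + h) - ext0 f (x +i* y) - l * h) <=
    estC R * (ptC (x / 2) * nrm f) / (x / 2) ^+ 2 * normc h ^+ 2.
Proof.
move=> x0; have x20 : 0 < x / 2 by rewrite divr_gt0.
have in_ z : rect (x - x / 2) (x + x / 2) (y - x / 2) (y + x / 2) z -> x / 2 <= complex.Re z.
  by case=> /andP[+ _] _; lra.
have [|z zr|l Hl] := @cauchy_estimate R (ext0 f) x y (x / 2) (ptC (x / 2) * nrm f) x20.
- move=> z /in_ zx; apply: (hol_cdiff (proj1 (bergmanA f))); exact: lt_le_trans zx.
- by apply: pt_bound2 => //; exact: in_.
by exists l => h hx; apply: Hl; clear -hx; lra.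
Qed.

Definition cauchy_nrm (u : nat -> V) := forall e : R, 0 < e ->
  exists N, forall n m, (N <= n)%N -> (N <= m)%N -> nrm (u n - u m) <= e.

Lemma cauchy_nrm_bounded u : cauchy_nrm u -> exists2 B : R, 0 < B & exists N, forall n, (N <= n)%N -> nrm (u n) <= B.
Proof.
move=> cu; have [N HN] := cu 1 ltr01.
exists (1 + nrm (u N)); first by rewrite ltr_pwDl// nrm_ge0.
exists N => n Nn; rewrite -[u n](subrK (u N)); apply: le_trans (nrmD _ _) _.
by rewrite lerD2r HN.
Qed.

Lemma vB_ext f g z : ext0 (f - g : V) z = ext0 f z - ext0 g z.
Proof. exact: ext0B. Qed.

Lemma le_diff3 (e1 e2 e3 : R) (A B D A' B' D' : C) : normc (A - A') <= e1 ->
  normc (B - B') <= e2 -> normc (D - D') <= e3 ->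
  normc (A - B - D) <= normc (A' - B' - D') + (e1 + e2 + e3).
Proof.
move=> h1 h2 h3; have -> : A - B - D = (A' - B' - D') + ((A - A') - (B - B') - (D - D')) by ring.
apply: le_trans (le_normcD _ _) _; rewrite lerD2l.
apply: le_trans (le_normcD _ _) _; rewrite normcN lerD//.
by apply: le_trans (le_normcD _ _) _; rewrite normcN lerD.
Qed.

Section Limit.
Variable u : nat -> V.
Hypothesis cu : cauchy_nrm u.

Let pt_cauchy (z : C) : 0 < complex.Re z -> forall e : R, 0 < e -> exists N, forall n m,
  (N <= n)%N -> (N <= m)%N -> normc (ext0 (u n) z - ext0 (u m) z) <= e.
Proof.
move=> z0 e e0; have p0 := ptC_ge0 (complex.Re z).
have p1 : 0 < ptC (complex.Re z) + 1 by rewrite ltr_wpDl.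
have [N HN] := cu (divr_gt0 e0 p1).
exists N => n m Nn Nm; rewrite -vB_ext; apply: le_trans (pt_bound _ z0) _.
apply: le_trans (ler_wpM2l p0 (HN n m Nn Nm)) _.
by rewrite mulrCA ler_piMr ?ltW// ltr_pdivrMr// mul1r ltrDl.
Qed.

Let limit_ex : exists G : C -> C, forall z, 0 < complex.Re z -> forall e : R, 0 < e ->
  exists N, forall n, (N <= n)%N -> normc (ext0 (u n) z - G z) <= e.
Proof.
have : forall z : C, exists l : C, 0 < complex.Re z -> forall e : R, 0 < e ->
    exists N, forall n, (N <= n)%N -> normc (ext0 (u n) z - l) <= e.
  move=> z; have [z0|z0] := pselect (0 < complex.Re z); last by exists 0 => /z0.
  by have [l Hl] := complex_complete (pt_cauchy z0); exists l.
by move=> /choice[G HG]; exists G.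
Qed.

(** The bound A |h|^2 on the remainders holds for all large n and survives the pointwise limit, once
    the linear coefficients are known to converge. *)
Lemma cauchy_limit_diff (G : C -> C) : (forall z, 0 < complex.Re z -> forall e : R, 0 < e ->
    exists N, forall n, (N <= n)%N -> normc (ext0 (u n) z - G z) <= e) ->
  forall z, 0 < complex.Re z -> cdiff G z.
Proof.
move=> HG [x y] /= x0; set z : C := x +i* y.
have [B B0 [N0 HB]] := cauchy_nrm_bounded cu.
pose A := estC R * (ptC (x / 2) * B) / (x / 2) ^+ 2.
have x20 : 0 < x / 2 by rewrite divr_gt0.
have A0 : 0 <= A.
  by rewrite divr_ge0 ?sqr_ge0// mulr_ge0 ?(ltW (estC_gt0 R))// mulr_ge0 ?ptC_ge0 ?(ltW B0).
have /choice[l Hl] : forall n, exists l : C, (N0 <= n)%N -> forall h : C, normc h <= x / 4 ->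
    normc (ext0 (u n) (z + h) - ext0 (u n) z - l * h) <= A * normc h ^+ 2.
  move=> n; have [l Hl] := bergman_estimate (u n) y x0; exists l => Nn h hx.
  apply: le_trans (Hl h hx) _; rewrite ler_wpM2r ?sqr_ge0// ler_wpM2r ?invr_ge0 ?sqr_ge0//.
  by rewrite ler_wpM2l ?(ltW (estC_gt0 R))// ler_wpM2l ?ptC_ge0// HB.
have Rezh (h : C) : normc h <= x / 4 -> 0 < complex.Re (z + h).
  move=> hx; have := normc_ge_absRe h; rewrite ler_norml ReD /z /= => /andP[h1 _].
  by clear -x0 hx h1; lra.
have z0 : 0 < complex.Re z by [].
have lc : forall e : R, 0 < e -> exists N, forall n m, (N <= n)%N -> (N <= m)%N -> normc (l n - l m) <= e.
  (* The increment over the real step t determines each coefficient up to A t <= e / 4; the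
     comparison of two coefficients involves four errors of size e t / 4. *)
  move=> e e0; pose t := Num.min (x / 4) (e / (4 * (A + 1))).
  have A1 : 0 < A + 1 by rewrite ltr_wpDl.
  have t0 : 0 < t by rewrite lt_min !divr_gt0// mulr_gt0.
  have tA : A * t <= e / 4.
    apply: (@le_trans _ _ ((A + 1) * t)); first by rewrite ler_wpM2r ?(ltW t0)// lerDl.
    rewrite mulrC -ler_pdivlMr//; have : t <= e / (4 * (A + 1)) by rewrite ge_min lexx orbT.
    by rewrite invfM mulrA.
  have hx : normc (t%:C : C) <= x / 4.
    by rewrite normc_real gtr0_norm// ge_min lexx.
  have et : 0 < e * t / 4 by rewrite divr_gt0// mulr_gt0.
  have [N1 H1] := pt_cauchy (Rezh _ hx) et.
  have [N2 H2] := pt_cauchy z0 et.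
  exists (maxn N0 (maxn N1 N2)) => n m; rewrite !geq_max => /and3P[n0 n1 n2] /and3P[m0 m1 m2].
  rewrite -(ler_pM2r t0).
  have -> : normc (l n - l m) * t = normc (l n * t%:C - l m * t%:C).
    by rewrite -mulrBl normcM normc_real gtr0_norm.
  have En := Hl n n0 _ hx; have Em := Hl m m0 _ hx.
  have Hz := H2 n m n2 m2; have Hzh := H1 n m n1 m1.
  set a := ext0 (u n) (z + t%:C) in En Hzh *; set b := ext0 (u n) z in En Hz *.
  set a' := ext0 (u m) (z + t%:C) in Em Hzh *; set b' := ext0 (u m) z in Em Hz *.
  have -> : l n * t%:C - l m * t%:C =
    ((a - a') - (b - b')) + ((a' - b' - l m * t%:C) - (a - b - l n * t%:C)) by ring.
  apply: le_trans (le_normcD _ _) _.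
  have k1 : normc ((a - a') - (b - b')) <= e * t / 4 + e * t / 4.
    by apply: le_trans (le_normcD _ _) _; rewrite normcN lerD.
  have k2 : normc ((a' - b' - l m * t%:C) - (a - b - l n * t%:C)) <= A * t ^+ 2 + A * t ^+ 2.
    apply: le_trans (le_normcD _ _) _; rewrite normcN.
    by move: En Em; rewrite normc_real gtr0_norm// => En Em; rewrite lerD.
  have k3 : A * t ^+ 2 <= e * t / 4.
    by rewrite expr2 mulrA [e * t / 4]mulrAC ler_wpM2r// ltW.
  clear -k1 k2 k3; set p := normc _ in k1 *; set q := normc _ in k2 *; lra.
have [L HL] := complex_complete lc.
have key (h : C) : normc h <= x / 4 -> normc (G (z + h) - G z - L * h) <= A * normc h ^+ 2.
  move=> hx; apply/ler_addgt0Pr => e e0.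
  have e3 : 0 < e / 3 by rewrite divr_gt0.
  have h1 : 0 < normc h + 1 by rewrite ltr_wpDl// normc_ge0.
  have [N1 H1] := HG _ (Rezh _ hx) _ e3.
  have [N2 H2] := HG z z0 _ e3.
  have [N3 H3] := HL _ (divr_gt0 e3 h1).
  pose n := maxn N0 (maxn N1 (maxn N2 N3)).
  have := leqnn n; rewrite {1}/n !geq_max => /and4P[n0 n1 n2 n3].
  have k1 : normc (G (z + h) - ext0 (u n) (z + h)) <= e / 3 by rewrite normcB_sym H1.
  have k2 : normc (G z - ext0 (u n) z) <= e / 3 by rewrite normcB_sym H2.
  have k3 : normc (L * h - l n * h) <= e / 3.
    rewrite -mulrBl normcM normcB_sym.
    apply: le_trans (ler_wpM2r (normc_ge0 h) (H3 n n3)) _.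
    rewrite -mulrA ler_piMr ?(ltW e3)// mulrC ler_pdivrMr// mul1r lerDl//.
  apply: le_trans (le_diff3 k1 k2 k3) _.
  have k4 := Hl n n0 h hx.
  by clear -k4; set p := normc _ in k4 *; lra.
exists L => e e0; pose d := Num.min (x / 4) (e / (A + 1)).
have A1 : 0 < A + 1 by rewrite ltr_wpDl.
exists d; first by rewrite lt_min !divr_gt0.
move=> w wd; have hx : normc (w - z) <= x / 4.
  by apply: le_trans (ltW wd) _; rewrite ge_min lexx.
have := key _ hx; rewrite subrKC => /le_trans; apply.
rewrite expr2 mulrA ler_wpM2r ?normc_ge0//.
apply: (@le_trans _ _ ((A + 1) * normc (w - z))).
  by rewrite ler_wpM2r ?normc_ge0// lerDl.
rewrite mulrC -ler_pdivlMr//; apply: le_trans (ltW wd) _.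
by rewrite ge_min lexx orbT.
Qed.

(** Evaluations are bounded, so a Cauchy sequence converges pointwise to a holomorphic function;
    Fatou's lemma turns this into convergence in norm. *)
Lemma bergman_complete : exists g : V, forall e : R, 0 < e -> exists N, forall n, (N <= n)%N ->
  nrm (u n - g) <= e.
Proof.
have [G HG] := limit_ex.
pose g0 : half_plane R -> C := fun z => G (val z).
have hg0 : holomorphic g0 by apply: (@cdiff_hol R G) => //; exact: cauchy_limit_diff.
have g0E z : 0 < complex.Re z -> ext0 g0 z = G z by move=> z0; rewrite ext0E.
have F (e : R) : 0 < e -> exists N, forall n, (N <= n)%N ->
    (bergman_int alpha (bergman_fun (u n) - g0)%R <= (e ^+ 2)%:E)%E.
  move=> e0; have [N HN] := cu e0; exists N => n Nn.
  pose h m (p : R * R) := (dens alpha (u n - u (m + N)%N) p)%:E.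
  have hlim p : h m p @[m --> \oo] --> (dens alpha (bergman_fun (u n) - g0) p)%:E.
    have [p0|p0] := pselect (right_half p); last first.
      by rewrite /h; under eq_fun do rewrite dens_out//; rewrite dens_out//; exact: cvg_cst.
    apply: cvg_EFin; first by apply: nearW.
    have c1 : (fun m => normc (ext0 (u n - u (m + N)%N) (p.1 +i* p.2))) @ \oo -->
        normc (ext0 (bergman_fun (u n) - g0) (p.1 +i* p.2)).
      apply: cvg_normc; apply/cvgcP => d d0.
      have d20 : 0 < d / 2 by rewrite divr_gt0.
      have [M HM] := HG (p.1 +i* p.2) p0 _ d20.
      exists M => // m /= Mm; rewrite vB_ext ext0B g0E//.
      set X := ext0 (u n) _; set Y := ext0 _ _; set Z := G _.
      have -> : X - Y - (X - Z) = Z - Y by ring.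
      rewrite normcB_sym.
      apply: le_lt_trans (HM (m + N)%N (leq_trans Mm (leq_addr _ _))) _.
      by rewrite ltr_pdivrMr// ltr_pMr// ltr1n.
    have c2 : (fun m => normc (ext0 (u n - u (m + N)%N) (p.1 +i* p.2)) ^+ 2) @ \oo -->
        normc (ext0 (bergman_fun (u n) - g0) (p.1 +i* p.2)) ^+ 2 by exact: (cvgM c1 c1).
    exact: (cvgM c2 (cvg_cst (p.1 `^ alpha))).
  rewrite bergman_intE.
  have -> : (\int[leb2]_p (dens alpha (bergman_fun (u n) - g0)%R p)%:E =
      \int[leb2]_p limn_einf (h^~ p))%E.
    by apply: eq_integral => p _; rewrite (cvg_limn_einf_sup (hlim p)).
  have mh m : measurable_fun setT (h m) by exact: measurable_dens (proj1 (bergmanA _)).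
  apply: le_trans (@fatou _ _ R leb2 setT measurableT h mh _) _.
    by move=> m p _; rewrite lee_fin dens_ge0.
  rewrite limn_einf_lim; apply: lime_le; first exact: is_cvg_einfs.
  apply: nearW => m; apply: le_trans (ereal_inf_lbound _) _; first by exists m => //=.
  rewrite -bergman_intE -nsqE lee_fin -sqr_nrm ler_pXn2r ?nnegrE ?nrm_ge0 ?(ltW e0)//.
  by apply: HN => //; exact: leq_addl.
have [N HN] := F 1 ltr01.
have gA : g0 \in bergman_pred alpha.
  have dA : (bergman_fun (u N) - g0)%R \in bergman_pred alpha.
    apply/bergman_predP; split; last exact: le_lt_trans (HN N (leqnn N)) (ltry _).
    have -> : bergman_fun (u N) - g0 = - 1 *: g0 + bergman_fun (u N) by rewrite scaleN1r addrC.
    exact: holomorphic_lin (proj1 (bergmanA _)).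
  have -> : g0 = bergman_fun (u N) - (bergman_fun (u N) - g0) by rewrite opprB addrC subrK.
  by apply: rpredB => //; exact: (valP (u N)).
exists (Bergman gA) => e e0; have [M HM] := F e e0; exists M => n Mn.
rewrite -(@ler_pXn2r _ 2) ?nnegrE ?nrm_ge0 ?(ltW e0)// sqr_nrm -lee_fin nsqE.
exact: HM.
Qed.

End Limit.

End Complete.

(** * Density of the range of a shift, decay of its powers *)

Lemma subrACA (W : zmodType) (a b c d : W) : a - b - (c - d) = a - c - (b - d).
Proof. by rewrite !opprB addrACA [RHS]addrACA [- b - c]addrC. Qed.

Section Arith.
Variable R : realType.
Implicit Types x y z t : R.

Lemma defect_arith x y z : y <= z -> x - 2 * z + y <= x - z.
Proof. lra. Qed.

Lemma defect_arith2 x y t : y <= x - t -> x <= y -> t <= 0.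
Proof. lra. Qed.

Lemma moment_arith e l x y z : x <= l + e / 2 -> y <= l + e / 2 -> l <= z ->
  x - 2 * z + y <= e.
Proof. lra. Qed.

End Arith.

Section ShiftLimits.
Variables (R : realType) (alpha : R).
Hypothesis alpha1 : -1 < alpha.
Local Notation C := R[i]^o.
Local Notation V := (bergman alpha).
Implicit Types f g h : V.

Lemma shiftB (s : R) f g : 0 <= s ->
  compV 1 s%:C (f - g) = compV 1 s%:C f - compV 1 s%:C g.
Proof.
move=> s0; have s0' : 0 <= complex.Re (s%:C : R[i]) by [].
by rewrite (compVB alpha1 f g (@ltr01 R) s0').
Qed.

(* The squared distance of z(2n) and z(2m) is c(2n) - 2 c(n + m) + c(2m), where
   c n = nsq (z n) converges. *)
Lemma moment_cauchy (z : nat -> V) :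
  (forall n m, ip (z (n + n)%N) (z (m + m)%N) = nsq (z (n + m)%N)) ->
  (forall n, nsq (z n.+1) <= nsq (z n)) ->
  cauchy_nrm (fun n => z (n + n)%N).
Proof.
move=> zip dec; pose c n := nsq (z n).
have /nonincreasing_seqP nc : forall n, c n.+1 <= c n by [].
have cc : cvgn c.
  apply: nonincreasing_is_cvgn; first exact/nonincreasing_seqP.
  by exists 0 => _ [n _ <-]; exact: nsq_ge0.
have lc n : limn c <= c n by apply: nonincreasing_cvgn_ge => //; exact/nonincreasing_seqP.
move=> e e0; have e2 : 0 < e ^+ 2 / 2 by rewrite divr_gt0// exprn_gt0.
have [N _ HN] := iffLR (@cvgrPdist_lt _ _ _ _ _ _ _) cc _ e2.
have up n : (N <= n)%N -> c n <= limn c + e ^+ 2 / 2.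
  move=> /HN /=; rewrite ltr_norml => /andP[h _].
  by move: h; move: (e ^+ 2) (limn c) (c n) => x y t; lra.
exists N => n m Nn Nm.
rewrite -(@ler_pXn2r _ 2) ?nnegrE ?nrm_ge0 ?(ltW e0)// sqr_nrm nsqB zip.
have h1 := up (n + n)%N (leq_trans Nn (leq_addr _ _)).
have h2 := up (m + m)%N (leq_trans Nm (leq_addr _ _)).
have h3 := lc (n + m)%N.
rewrite /c in h1 h2 h3; move: h1 h2 h3.
exact: moment_arith.
Qed.

Lemma fixed_limit (B : V -> V) (y : nat -> V) g :
  (forall f h, nrm (B f - B h) <= nrm (f - h)) -> (forall n, y n.+1 = B (y n)) ->
  (forall e : R, 0 < e -> exists N, forall n, (N <= n)%N -> nrm (y n - g) <= e) ->
  B g = g.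
Proof.
move=> Bc By yg; apply/subr0_eq/nrm_eq0/le_anti; rewrite nrm_ge0 andbT.
apply/ler_addgt0Pr => e e0; rewrite add0r.
have e20 : 0 < e / 2 by rewrite divr_gt0.
have [N HN] := yg _ e20.
have -> : B g - g = (y N.+1 - g) - (B (y N) - B g).
  by rewrite By opprB [RHS]addrC [RHS]addrA subrK.
have h1 := HN N.+1 (leqnSn N).
have h2 : nrm (B (y N) - B g) <= e / 2 := le_trans (Bc _ _) (HN N (leqnn N)).
rewrite [leRHS]splitr; exact: le_trans (nrmB (y N.+1 - g) (B (y N) - B g)) (lerD h1 h2).
Qed.

Section Defect.
Variables S H A : V -> V.
Hypotheses (AE : forall f, A f = f - S f) (SE : forall f, S f = H (H f)).
Hypothesis HB : forall f h, H (f - h) = H f - H h.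
Hypothesis ipH : forall f h, ip (H f) h = ip f (H h).
Hypothesis H1 : forall f, nsq (H f) <= nsq f.
Hypothesis H0 : forall f, H f = 0 -> f = 0.

Let SB f h : S (f - h) = S f - S h.
Proof. by rewrite !SE !HB. Qed.

Let AB f h : A (f - h) = A f - A h.
Proof. by rewrite !AE SB; exact: subrACA. Qed.

Let ipA f h : ip (A f) h = ip f (A h).
Proof. by rewrite !AE ipDl ipNl ipDr ipNr !SE !ipH. Qed.

Let ipAn n f h : ip (iter n A f) h = ip f (iter n A h).
Proof. by elim: n f h => [|n IH] f h; rewrite // iterSr IH ipA. Qed.

Let ipS f : ip f (S f) = nsq (H f).
Proof. by rewrite SE -ipH ipff. Qed.

Let nsqA f : nsq (A f) <= nsq f - nsq (H f).
Proof.
rewrite AE nsqB ipS; have : nsq (S f) <= nsq (H f) by rewrite SE H1.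
exact: defect_arith.
Qed.

Let nsqA1 f : nsq (A f) <= nsq f.
Proof. by apply: le_trans (nsqA f) _; rewrite gerBl nsq_ge0. Qed.

Let nrmA1 f : nrm (A f) <= nrm f.
Proof. exact: ler_wsqrtr (nsqA1 f). Qed.

(* With A = 1 - H^2, the sequence A^(2n) f converges to a fixed point g of A^2;
   since H is injective g = 0, while f - A^n f belongs to the range of H^2. *)
Lemma square_range_dense f (e : R) : 0 < e -> exists h, nrm (f - S h) <= e.
Proof.
move=> e0; pose z n := iter n A f.
have zip n m : ip (z (n + n)%N) (z (m + m)%N) = nsq (z (n + m)%N).
  by rewrite -ipff /z !ipAn -!iterD addnACA.
have [g yg] := bergman_complete alpha1 (moment_cauchy zip (fun n => nsqA1 (z n))).
have AAg : A (A g) = g.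
  apply: (@fixed_limit (fun x => A (A x)) (fun n => z (n + n)%N)) => //.
    by move=> u v; rewrite -!AB; exact: le_trans (nrmA1 _) (nrmA1 _).
  by move=> n; rewrite /z addSn addnS.
have g0 : g = 0.
  apply: H0; apply: nsq_eq0; apply/le_anti; rewrite nsq_ge0 andbT.
  have := nsqA1 (A g); have := nsqA g; rewrite AAg; exact: defect_arith2.
have rng n : exists h, f - z n = S h.
  elim: n => [|n [h hE]].
    by exists (0 - 0); rewrite SB !subrr.
  exists (h - (- z n)); rewrite SB -(sub0r (z n)) SB -(subrr f) SB subrr sub0r opprK.
  by rewrite -hE -[z n.+1]/(A (z n)) AE opprB addrA addrAC.
have [N HN] := yg e e0.
have [h hE] := rng (N + N)%N.
exists h; rewrite -hE opprB addrC subrK.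
by have := HN N (leqnn N); rewrite g0 subr0.
Qed.

End Defect.

Lemma shift_range_dense (s : R) f (e : R) : 0 <= s -> 0 < e ->
  exists h, nrm (f - compV 1 s%:C h) <= e.
Proof.
move=> s0; have s20 : 0 <= s / 2 by rewrite divr_ge0.
have s20' : 0 <= complex.Re ((s / 2)%:C : R[i]) by [].
apply: (@square_range_dense (compV 1 s%:C) (compV 1 (s / 2)%:C) (fun f => f - compV 1 s%:C f)).
- by [].
- by move=> u; rewrite (shiftD alpha1 u s20 s20) -splitr.
- by move=> u v; rewrite (compVB alpha1 u v (@ltr01 R) s20').
- by move=> u v; rewrite (ip_shift alpha1 u v s20).
- by move=> u; apply: (nsq_shift_le alpha1 u s20).
- by move=> u; apply: (shift_eq0 alpha1 s20).
Qed.

Lemma ptC_small (e : R) : 0 < e -> exists2 x0 : R, 0 < x0 & forall x, x0 <= x -> ptC alpha x <= e.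
Proof.
move=> e0; have a2 := alpha2 alpha1.
pose M := evalC alpha / e ^+ 2.
have M0 : 0 < M by rewrite divr_gt0 ?evalC_gt0// exprn_gt0.
exists (M `^ ((2 + alpha)^-1)); first exact: powR_gt0.
move=> x /(ptC_le alpha1 (powR_gt0 _ M0)) /le_trans; apply.
rewrite /ptC -powRrM mulVf ?gt_eqF// powRr1 ?(ltW M0)//.
rewrite /M invf_div mulrCA divff ?gt_eqF ?evalC_gt0// mulr1.
by rewrite sqrtr_sqr ger0_norm ?(ltW e0).
Qed.

(** The value at z is also the value at z + k s, where the norm of the evaluation tends to 0. *)
Lemma periodic_eq0 g (s : R) : 0 < s -> compV 1 s%:C g = g -> g = 0.
Proof.
move=> s0 gs; apply: bergman_ext => z z0; rewrite ext0_0.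
have per k : ext0 g (z + (k%:R * s)%:C) = ext0 g z.
  elim: k => [|k IH]; first by rewrite mul0r addr0.
  have zk : 0 < complex.Re (z + (k%:R * s)%:C).
    by rewrite ReD /= ltr_wpDr// mulr_ge0// ltW.
  rewrite -IH -[in RHS]gs ext0_compV ?ltr01 ?ltW// mul1r; congr (ext0 g _).
  by rewrite -addrA -rmorphD -natr1 mulrDl mul1r.
apply/eq0_normc/le_anti; rewrite normc_ge0 andbT.
apply/ler_addgt0Pr => e e0; rewrite add0r.
have n1 : 0 < nrm g + 1 by rewrite ltr_wpDl// nrm_ge0.
have [x0 x00 Hx] := ptC_small (divr_gt0 e0 n1).
pose k := (Num.truncn (x0 / s)).+1.
have zk : x0 <= complex.Re (z + (k%:R * s)%:C).
  rewrite ReD /= (@le_trans _ _ (k%:R * s))// ?lerDr ?(ltW z0)//.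
  by rewrite -ler_pdivrMr// ltW// truncnS_gt.
rewrite -(per k); apply: le_trans (pt_bound2 alpha1 g x00 zk) _.
apply: le_trans (ler_wpM2r (nrm_ge0 g) (Hx x0 (lexx _))) _.
by rewrite -mulrA ler_piMr ?(ltW e0)// mulrC ler_pdivrMr// mul1r lerDl.
Qed.

(** By [moment_cauchy] the shifts by even integers converge; the limit is fixed by the shift by 2,
    hence 0. Monotonicity extends the bound to all large shifts. *)
Lemma shift_vanish f (e : R) : 0 < e ->
  exists2 r0 : R, 0 <= r0 & forall r, r0 <= r -> nrm (compV 1 r%:C f) <= e.
Proof.
move=> e0; pose z n := compV 1 (n%:R : R)%:C f.
have n0 n : 0 <= (n%:R : R) by [].
have zip n m : ip (z (n + n)%N) (z (m + m)%N) = nsq (z (n + m)%N).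
  rewrite -ipff /z (ip_shift alpha1 _ _ (n0 _)) (shiftD alpha1 _ (n0 _) (n0 _)).
  rewrite (ip_shift alpha1 _ _ (n0 _)) (shiftD alpha1 _ (n0 _) (n0 _)).
  by rewrite -!natrD addnACA.
have zS (t : R) n : 0 <= t -> nsq (compV 1 (t + n%:R)%:C f) <= nsq (z n).
  by move=> t0; rewrite -(shiftD alpha1 f t0 (n0 n)); apply: (nsq_shift_le alpha1 _ t0).
have dec n : nsq (z n.+1) <= nsq (z n) by rewrite /z -nat1r zS.
have [g yg] := bergman_complete alpha1 (moment_cauchy zip dec).
have g0 : g = 0.
  apply: (@periodic_eq0 g 2) => //.
  apply: (@fixed_limit (compV 1 (2 : R)%:C) (fun n => z (n + n)%N)) => //.
    move=> u v; rewrite -(shiftB u v (n0 2%N)).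
    apply: (nrm_shift_le alpha1 _ (n0 2%N)).
  move=> n; rewrite /z (shiftD alpha1 f (n0 2%N) (n0 _)).
  by rewrite -natrD addSn addnS.
have [N HN] := yg e e0.
exists ((N + N)%N%:R) => // r rN; have := HN N (leqnn N); rewrite g0 subr0; apply: le_trans.
rewrite -[r](subrK (N + N)%N%:R); apply: ler_wsqrtr; apply: zS.
by rewrite subr_ge0.
Qed.

End ShiftLimits.

(** * Infinite dimension *)

Section Primitive.
Variable R : realType.
Local Notation leb := (@lebesgue_measure R).

Lemma ge0_integral_primitive (f F : R -> R) (D : set R) (a b : nat -> R) (B : R) :
  (forall n, a n < b n) -> (forall n, a n.+1 <= a n) -> (forall n, b n <= b n.+1) ->
  D = \bigcup_n `[a n, b n]%classic ->
  (forall x, D x -> is_derive x (1 : R) F (f x)) -> (forall x, D x -> f @ x --> f x) ->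
  (forall x, D x -> 0 <= f x) -> (forall n, F (b n) - F (a n) <= B) ->
  (\int[leb]_(x in D) (f x)%:E <= B%:E)%E.
Proof.
move=> ab da db DE dF cf f0 FB.
pose S n : set R := `[a n, b n]%classic.
have SD n x : a n <= x <= b n -> D x.
  by move=> xn; rewrite DE; exists n => //=; rewrite in_itv.
have mS n : measurable (S n) by exact: measurable_itv.
have inS n : leb.-integrable (S n) (EFin \o f).
  by apply: seg_integrable => x xn; apply: cf; exact: SD xn.
have Sm : {homo S : n m / (n <= m)%N >-> (n <= m)%O}.
  have /nondecreasing_seqP nb : forall n, b n <= b n.+1 by [].
  have /nonincreasing_seqP na : forall n, a n.+1 <= a n by [].
  move=> n m nm; apply/subsetPset => y; rewrite /S /= !in_itv/= => /andP[h1 h2].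
  by rewrite (le_trans (na _ _ nm) h1) (le_trans h2 (nb _ _ nm)).
have f0e (n : nat) y : S n y -> (0 <= (EFin \o f) y)%E.
  by rewrite /S /= in_itv/= => /SD yD; rewrite lee_fin f0.
have AC := @ge0_nondecreasing_set_cvg_integral _ (measurableTypeR R) R S (EFin \o f) leb Sm mS
  (fun n => measurable_int leb (inS n)) f0e.
rewrite DE; move: (AC) => /cvg_lim <- //.
apply: lime_le; first by apply/cvg_ex; eexists; exact: AC.
apply: nearW => n.
rewrite (@continuous_FTC2 R f F (a n) (b n))//.
- by rewrite -EFinB lee_fin.
- apply: continuous_in_subspaceT => x /set_mem; rewrite /= in_itv/= => /SD; exact: cf.
- have dc x : D x -> {for x, continuous F}.
    move=> /dF dx; apply: differentiable_continuous; apply/derivable1_diffP; exact: ex_derive.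
  split.
  + by move=> x; rewrite in_itv/= => /andP[/ltW h1 /ltW h2]; have := dF x (SD n x (introT andP (conj h1 h2))); case.
  + by apply: cvg_at_right_filter; apply/dc/(SD n); rewrite lexx ltW.
  + by apply: cvg_at_left_filter; apply/dc/(SD n); rewrite lexx ltW.
- move=> x; rewrite in_itv/= => /andP[/ltW h1 /ltW h2].
  by have := dF x (SD n x (introT andP (conj h1 h2))) => h; rewrite derive1E; exact: derive_val.
Qed.

Lemma cauchy_density_integral :
  (\int[leb]_(y in setT) ((1 + y ^+ 2)^-1)%:E <= (pi : R)%:E)%E.
Proof.
apply: (@ge0_integral_primitive (fun y => (1 + y ^+ 2)^-1) atan setT
  (fun n => - n.+1%:R) (fun n => n.+1%:R)).
- by move=> n; rewrite (@lt_trans _ _ 0)// oppr_lt0.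
- by move=> n; rewrite lerN2 ler_nat.
- by move=> n; rewrite ler_nat.
- apply/seteqP; split=> // y _; exists (Num.truncn `|y|) => //=.
  by rewrite in_itv/=; have := ltW (truncnS_gt `|y|); rewrite ler_norml.
- by move=> x _; exact: (@continuous_oneDsqrV R x).
- by move=> x _; rewrite invr_ge0 addr_ge0// sqr_ge0.
- move=> n; have := atan_gtNpi2 (- n.+1%:R : R); have := atan_ltpi2 (n.+1%:R : R).
  by move=> h1 h2; rewrite lerBlDr -[pi in leRHS]addr0; lra.
Qed.

Lemma derive_frac (x : R) : 1 + x != 0 ->
  is_derive x (1 : R) (fun x : R => 1 - (1 + x)^-1) ((1 + x) ^- 2).
Proof.
move=> x1; have d0 : is_derive x (1 : R) (cst (1 : R) \+ id) (0 + 1) by exact: is_deriveD.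
have d1 := is_deriveV (x1 : (cst (1 : R) \+ id) x != 0) d0.
have d3 : is_derive x (1 : R) (cst (1 : R)) 0 by exact: is_derive_cst.
suff <- : 0 - (- (cst (1 : R) \+ id) x ^- 2 *: (0 + 1)) = (1 + x) ^- 2 by exact: (is_deriveB d3 d1).
by rewrite sub0r add0r -scaleNr opprK; exact: mulr1.
Qed.

Lemma cont_half_line (alpha x : R) : 0 < x ->
  (fun x : R => (x / (1 + x)) `^ alpha / (1 + x) ^+ 2) @ x --> (x / (1 + x)) `^ alpha / (1 + x) ^+ 2.
Proof.
move=> x0; have x1 : 1 + x != 0 by rewrite gt_eqF// ltr_wpDl.
have c1 : (fun x : R => 1 + x) @ x --> 1 + x by apply: cvgD; [exact: cvg_cst|exact: cvg_id].
have c2 : (fun x : R => x / (1 + x)) @ x --> x / (1 + x) by apply: cvgM; [exact: cvg_id|exact: cvgV].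
have c3 : {for (x / (1 + x)), continuous (fun u : R => u `^ alpha)}.
  apply: differentiable_continuous; apply/derivable1_diffP; apply: derivable_powR.
  by rewrite in_itv/= andbT divr_gt0// ltr_wpDl.
apply: cvgM; first exact: (cvg_comp _ _ c2 c3).
by apply: cvgV; [rewrite expf_neq0|exact: (cvgM c1 c1)].
Qed.

(** The primitive is u^(1 + alpha) / (1 + alpha) with u = x / (1 + x) in (0, 1), whose derivative is
    (1 + x)^-2. *)
Lemma half_line_integral (alpha : R) : -1 < alpha ->
  (\int[leb]_(x in `]0%R, +oo[%classic) ((x / (1 + x)) `^ alpha / (1 + x) ^+ 2)%:E <=
    ((1 + alpha)^-1)%:E)%E.
Proof.
move=> alpha1; have a0 : 0 < 1 + alpha by rewrite -(subrr 1) ltrD2l.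
pose F (x : R) := (1 + alpha)^-1 * (1 - (1 + x)^-1) `^ (1 + alpha).
have hE (x : R) : 0 < x -> 1 - (1 + x)^-1 = x / (1 + x).
  by move=> x0; field; rewrite gt_eqF// ltr_wpDl.
have h0 (x : R) : 0 < x -> 0 < x / (1 + x) by move=> x0; rewrite divr_gt0// ltr_wpDl.
have Fb (x : R) : 0 < x -> 0 <= F x <= (1 + alpha)^-1.
  move=> x0; rewrite /F mulr_ge0 ?powR_ge0 ?invr_ge0 ?(ltW a0)//=.
  have e1 : (1 : R) `^ (1 + alpha) = 1 by rewrite powR1.
  rewrite ler_piMr ?invr_ge0 ?(ltW a0)// -[leRHS]e1.
  rewrite hE// ge0_ler_powR ?nnegrE ?(ltW a0) ?(ltW (h0 x x0))//.
  by rewrite ler_pdivrMr ?ltr_wpDl// mul1r lerDr.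
apply: (@ge0_integral_primitive (fun x => (x / (1 + x)) `^ alpha / (1 + x) ^+ 2) F `]0, +oo[%classic
  (fun n => n.+2%:R^-1) (fun n => n.+2%:R)).
- by move=> n; rewrite (@lt_trans _ _ 1) ?ltr1n// invf_lt1// ltr1n.
- by move=> n; rewrite lef_pV2 ?posrE// ler_nat.
- by move=> n; rewrite ler_nat.
- apply/seteqP; split=> x /=; rewrite in_itv/= ?andbT.
    move=> x0; exists (maxn (Num.truncn x) (Num.truncn x^-1)) => //=; rewrite in_itv/=.
    rewrite -[x in _ <= x <= _]invrK lef_pV2 ?posrE ?invr_gt0// invrK.
    apply/andP; split.
      apply: le_trans (ltW (truncnS_gt x^-1)) _; rewrite ler_nat.
      by apply: leqW; rewrite ltnS leq_maxr.
    apply: le_trans (ltW (truncnS_gt x)) _; rewrite ler_nat.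
    by apply: leqW; rewrite ltnS leq_maxl.
  by case=> n _; rewrite /= in_itv/= => /andP[+ _]; apply: lt_le_trans; rewrite invr_gt0.
- move=> x /=; rewrite in_itv/= andbT => x0.
  have x1 : 1 + x != 0 by rewrite gt_eqF// ltr_wpDl.
  have d1 := derive_frac x1.
  have hp : 0 < 1 - (1 + x)^-1 by rewrite hE// h0.
  have d2 := is_derive1_powR (1 + alpha) hp.
  have d3 := @is_derive1_comp R (fun u => u `^ (1 + alpha)) (fun x : R => 1 - (1 + x)^-1) x _ _ d2 d1.
  have d4 := @is_deriveZ R _ _ _ (1 + alpha)^-1 _ _ _ d3.
  suff <- : (1 + alpha)^-1 *: ((1 + alpha) * (1 - (1 + x)^-1) `^ (1 + alpha - 1) * (1 + x) ^- 2) =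
      (x / (1 + x)) `^ alpha / (1 + x) ^+ 2 by exact: d4.
  rewrite hE// [1 + alpha - 1]addrC addKr /GRing.scale/=.
  by rewrite !mulrA mulVf ?gt_eqF// mul1r.
- by move=> x /=; rewrite in_itv/= andbT => x0; exact: cont_half_line.
- move=> x /=; rewrite in_itv/= andbT => x0.
  by rewrite divr_ge0 ?powR_ge0 ?sqr_ge0.
- move=> n; have n2 : 0 < (n.+2%:R : R) by [].
  have /andP[_ h1] := Fb _ n2.
  have /andP[h2 _] := Fb n.+2%:R^-1 (ltac:(by rewrite invr_gt0)).
  by rewrite lerBlDr (le_trans h1)// lerDl.
Qed.

End Primitive.

(** * Negative powers of z + 1 span an infinite-dimensional space *)

Section Kernels.
Variables (R : realType) (alpha : R).
Hypothesis alpha1 : -1 < alpha.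
Local Notation C := R[i]^o.
Local Notation leb := (@lebesgue_measure R).
Local Notation leb2 := (leb \x leb)%E.
Local Notation V := (bergman alpha).

Definition kern (k : nat) : half_plane R -> C := fun z => ((val z + 1) ^- k : C).

Lemma kern_den (z : C) : 0 < complex.Re z -> z + 1 != 0.
Proof.
move=> z0; apply/eqP => /(congr1 (@complex.Re R)); rewrite ReD /= => h.
by have := ltr_pwDl z0 (@ler01 R); rewrite h ltxx.
Qed.

Lemma ext0_kern k z : 0 < complex.Re z -> ext0 (kern k) z = (z + 1) ^- k.
Proof. by move=> z0; rewrite ext0E. Qed.

Lemma hol_kern k : holomorphic (kern k).
Proof.
apply: (@cdiff_hol R (fun z => (z + 1) ^- k)) => // z z0.
apply: (@cdiffV R (fun z => (z + 1) ^+ k)); first by rewrite expf_neq0// kern_den.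
apply: (@cdiffX R (fun z => z + 1)).
by apply: cdiffD; [exact: cdiff_id|exact: cdiff_cst].
Qed.

(** Of the k + 2 powers of |z + 1|^-2, k pay for the weight, one gives (1 + x)^-2 and one gives (1 +
    y^2)^-1. The bound is a product, so its integral factors. *)
Lemma kern_dens_le (k : nat) (x y : R) : 0 < x -> alpha <= k%:R ->
  dens alpha (kern k.+2) (x, y) <= ((x / (1 + x)) `^ alpha / (1 + x) ^+ 2) * (1 + y ^+ 2)^-1.
Proof.
move=> x0 ak; have x1 : 1 <= 1 + x by rewrite lerDl ltW.
have x1p : 0 < 1 + x by exact: lt_le_trans x1.
rewrite /dens /= ext0_kern// normcV normcX exprVn -exprM mulnC exprM sqr_normcE ReD ImD /= addr0.
set u := (x + 1) ^+ 2 + y ^+ 2; set v := 1 + x.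
have u1 : v ^+ 2 <= u by rewrite /u /v [x + 1]addrC lerDl sqr_ge0.
have u2 : 1 + y ^+ 2 <= u.
  by rewrite /u lerD2r [x + 1]addrC -[leLHS](expr1n _ 2) ler_pXn2r ?nnegrE ?(ltW x1p).
have v2 : 1 <= v ^+ 2 by rewrite -(expr1n _ 2) ler_pXn2r ?nnegrE ?(ltW x1p).
have up : 0 < u by apply: lt_le_trans u1; rewrite exprn_gt0.
rewrite (powRM _ (ltW x0)) ?invr_ge0 ?(ltW x1p)//.
have -> : x `^ alpha * v^-1 `^ alpha / v ^+ 2 / (1 + y ^+ 2) =
    (v^-1 `^ alpha * (v ^+ 2)^-1 * (1 + y ^+ 2)^-1) * x `^ alpha.
  by rewrite [in LHS]mulrC; ring.
rewrite ler_wpM2r ?powR_ge0//.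
have -> : u ^- k.+2 = (u ^+ k)^-1 * u^-1 * u^-1 by rewrite !exprS !invfM mulrC [u^-1 * _]mulrC.
have k1 : (u ^+ k)^-1 <= v^-1 `^ alpha.
  apply: (@le_trans _ _ (v^-1 ^+ k)).
    rewrite exprVn lef_pV2 ?posrE ?exprn_gt0//; apply: lerXn2r; rewrite ?nnegrE ?(ltW up) ?(ltW x1p)//.
    by apply: le_trans u1; rewrite expr2 ler_pMr.
  rewrite -powR_mulrn ?invr_ge0 ?(ltW x1p)//.
  rewrite -[v^-1](powR_inv1 (ltW x1p)) -!powRrM ler_powR// !mulN1r lerN2//.
have y1 : 0 < 1 + y ^+ 2 by rewrite ltr_pwDl// sqr_ge0.
have w0 : 0 <= (u ^+ k)^-1 by rewrite invr_ge0 exprn_ge0// ltW.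
have w1 : 0 <= u^-1 by rewrite invr_ge0 ltW.
apply: ler_pM => //; first exact: mulr_ge0.
  by apply: ler_pM => //; rewrite lef_pV2 ?posrE// exprn_gt0.
by rewrite lef_pV2 ?posrE.
Qed.

Lemma kern_inA (k : nat) : alpha <= k%:R -> kern k.+2 \in bergman_pred alpha.
Proof.
move=> ak; apply/bergman_predP; split; first exact: hol_kern.
pose A : set R := `]0, +oo[%classic.
have mA : measurable A by exact: measurable_itv.
have RA : @right_half R = A `*` setT.
  by apply/seteqP; split=> -[x y]; rewrite /right_half /A /= in_itv/= andbT//; case.
have -> : bergman_int alpha (kern k.+2) =
    (\int[leb2]_(p in A `*` setT) (dens alpha (kern k.+2) p)%:E)%E by rewrite -RA.
have md : measurable_fun (A `*` setT) (EFin \o dens alpha (kern k.+2)).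
  by rewrite -RA; exact: (@measurable_dens_rh R alpha _ (@hol_kern k.+2)).
have d0 p : (0 <= (EFin \o dens alpha (kern k.+2)) p)%E by rewrite lee_fin dens_ge0.
rewrite (tonelli_x mA measurableT md (fun p _ => d0 p)).
pose g (x : R) := (x / (1 + x)) `^ alpha / (1 + x) ^+ 2.
have g0 x : 0 < x -> 0 <= g x.
  by move=> x0; rewrite divr_ge0 ?powR_ge0 ?sqr_ge0.
have mq : measurable_fun setT (fun y : R => ((1 + y ^+ 2)^-1)%:E).
  by apply/measurable_EFinP; apply: continuous_measurable_fun; exact: continuous_oneDsqrV.
have q0 (y : R) : 0 <= (1 + y ^+ 2)^-1 by rewrite invr_ge0 addr_ge0// sqr_ge0.
have mg : measurable_fun A (EFin \o g).
  apply/measurable_EFinP; apply: open_continuous_measurable_fun; first exact: interval_open.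
  move=> x; rewrite inE /A /= in_itv/= andbT => x0.
  exact: cont_half_line.
have inner x : A x -> (\int[leb]_(y in setT) (EFin \o dens alpha (kern k.+2)) (x, y) <=
    (pi : R)%:E * (g x)%:E)%E.
  rewrite /A /= in_itv/= andbT => x0.
  apply: (@le_trans _ _ (\int[leb]_y ((g x)%:E * ((1 + y ^+ 2)^-1)%:E))%E).
    apply: ge0_le_integral => //.
    - by move=> y _; rewrite lee_fin dens_ge0.
    - apply/measurable_EFinP; rewrite /dens /=.
      have c := ccont_sq (ccont_line (@hol_kern k.+2) x0).
      apply: continuous_measurable_fun => y.
      exact: (cvgM (c y) (cvg_cst (x `^ alpha))).
    - by apply: measurable_funeM.
    - by move=> y _; rewrite -EFinM lee_fin kern_dens_le.
  rewrite (ge0_integralZl_EFin leb measurableT _ mq (g0 x x0)).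
    rewrite muleC; apply: lee_wpmul2r; first by rewrite lee_fin g0.
    exact: cauchy_density_integral.
  by move=> y _; rewrite lee_fin.
have p0 : 0 <= (pi : R) by exact: pi_ge0.
apply: (@le_lt_trans _ _ (\int[leb]_(x in A) ((pi : R)%:E * (EFin \o g) x))%E).
  apply: ge0_le_integral => //.
  - by move=> x _; apply: integral_ge0.
  - exact: (measurable_tonelli_x mA measurableT md (fun p _ => d0 p)).
  - by apply: measurable_funeM.
rewrite (ge0_integralZl_EFin leb mA _ mg p0); last first.
  by move=> x; rewrite /A /= in_itv/= andbT => x0; rewrite lee_fin g0.
apply: lte_mul_pinfty => //; apply: le_lt_trans (half_line_integral alpha1) (ltry _).
Qed.

Lemma vD_ext (f g : V) z : ext0 (f + g : V) z = ext0 f z + ext0 g z.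
Proof. exact: ext0D. Qed.

Lemma vZ_ext (k : R[i]) (f : V) z : ext0 (k *: f : V) z = k * ext0 f z.
Proof. exact: ext0Z. Qed.

(** A linear relation, evaluated at z = j + 1, says that a polynomial of size at most n vanishes at
    1 / (j + 2) for every j. *)
Lemma bergman_infinite_dim (n : nat) : exists e : 'I_n -> V, lin_independent e.
Proof.
pose k := (Num.truncn `|alpha|).+1.
have ak i : alpha <= (k + i)%N%:R.
  apply: le_trans (ler_norm _) _; apply: le_trans (ltW (truncnS_gt _)) _.
  by rewrite ler_nat leq_addr.
exists (fun i : 'I_n => Bergman (kern_inA (ak i))) => c c0.
pose p : {poly R[i]} := \poly_(i < n) (if insub i is Some j then c j else 0).
have pj (j : nat) : p.[(j.+2%:R)^-1] = 0.
  have z0 : 0 < complex.Re (j.+1%:R : C).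
    by rewrite -(rmorph_nat (real_complex R)) /= ltr0n.
  have /(congr1 (fun f : V => ext0 f (j.+1%:R : C))) := c0.
  rewrite ext0_0.
  have -> : ext0 (\sum_(i < n) c i *: Bergman (kern_inA (ak i)) : V) (j.+1%:R) =
      \sum_(i < n) c i * (j.+2%:R ^- (k + i).+2).
    elim/big_ind2 : _ => [|f x g y <- <-|i _]; first exact: ext0_0.
    - exact: vD_ext.
    - rewrite vZ_ext; congr (_ * _); apply: etrans (ext0_kern (k + i).+2 z0) _.
      by rewrite natr1.
  move=> h; have : j.+2%:R ^- k.+2 * p.[(j.+2%:R)^-1] = 0.
    rewrite -h horner_poly mulr_sumr; apply: eq_bigr => i _.
    rewrite valK mulrCA; congr (_ * _).
    by rewrite -!exprVn -exprD !addSn.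
  by move=> /eqP; rewrite mulf_eq0 invr_eq0 expf_eq0 pnatr_eq0 /= => /eqP.
have p0 : p = 0.
  apply: (@roots_geq_poly_eq0 _ p [seq (j.+2%:R)^-1 | j <- iota 0 n]).
  - by apply/allP => x /mapP[j _ ->]; apply/rootP.
  - rewrite map_inj_uniq ?iota_uniq// => i j /invr_inj/eqP.
    by rewrite eqr_nat => /eqP[].
  - by rewrite size_map size_iota size_poly.
move=> i; have /(congr1 (fun q : {poly R[i]} => q`_i)) := p0.
by rewrite coef_poly ltn_ord valK coef0.
Qed.

End Kernels.

(** * Finite-dimensional subspaces *)

Section Sphere.
Variable R : realType.

Lemma mx_coord_le (d : nat) (x : 'rV[R]_d) i : `|x ord0 i| <= `|x|.
Proof.
have -> : `|x| = mx_norm x by [].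
by rewrite mx_normrE; exact: (le_bigmax _ (fun ij => `|x ij.1 ij.2|) (ord0, i)).
Qed.

Lemma sphere_cover (d : nat) (U : nat -> set 'rV[R]_d) :
  (forall n, U n `<=` U n.+1) -> (forall n x, U n x -> nbhs x (U n)) ->
  (forall x, `|x| = 1 -> exists n, U n x) -> exists N, forall x, `|x| = 1 -> U N x.
Proof.
move=> Um Uo Uc; pose K : set 'rV[R]_d := [set x | `|x| = 1].
have cK : compact K.
  apply: bounded_closed_compact.
    exists 1; split; first exact: num_real.
    by move=> M M1 x /= ->; exact: ltW.
  have -> : K = (Num.norm : 'rV[R]_d -> R) @^-1` [set 1] by [].
  apply: closed_comp; last exact: closed_eq.
  by move=> x _; exact: norm_continuous.
have Um' n m : (n <= m)%N -> U n `<=` U m.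
  elim: m => [|m IH]; first by rewrite leqn0 => /eqP ->.
  rewrite leq_eqVlt => /predU1P[-> //|nm]; exact: subset_trans (IH nm) (Um m).
have : \forall n \near \oo, K `<=` U n.
  apply: (iffLR (compact_near_coveringP K) cK nat \oo U _) => x /Uc[n Unx].
  exists (U n, [set m | (n <= m)%N]).
    by split; [exact: Uo|exists n].
  by move=> [y m] /= [Uy nm]; exact: Um' nm y Uy.
by case=> N _ HN; exists N => x x1; exact: (HN N (leqnn N)).
Qed.

End Sphere.

Section FiniteDim.
Variables (R : realType) (alpha : R).
Hypothesis alpha1 : -1 < alpha.
Local Notation C := R[i]^o.
Local Notation V := (bergman alpha).
Implicit Types f g h : V.

(** Coefficients are real because the moment argument works with real subspaces; [realify] reduces
    complex spans to this case. *)
Definition comb d (e : 'I_d -> V) (x : 'rV[R]_d) : V := \sum_i (x ord0 i)%:C *: e i.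

Definition rfree d (e : 'I_d -> V) := forall x, comb e x = 0 -> x = 0.

Lemma combD d (e : 'I_d -> V) x y : comb e (x + y) = comb e x + comb e y.
Proof. by rewrite -big_split; apply: eq_bigr => i _; rewrite mxE rmorphD scalerDl. Qed.

Lemma combZ d (e : 'I_d -> V) (r : R) x : comb e (r *: x) = r%:C *: comb e x.
Proof. by rewrite scaler_sumr; apply: eq_bigr => i _; rewrite mxE rmorphM scalerA. Qed.

Lemma combB d (e : 'I_d -> V) x y : comb e (x - y) = comb e x - comb e y.
Proof. by rewrite combD -scaleN1r combZ rmorphN1 scaleN1r. Qed.

Lemma comb0 d (e : 'I_d -> V) : comb e 0 = 0.
Proof. by rewrite -(subrr (0 : 'rV_d)) combB subrr. Qed.

Lemma comb_mul (d d2 : nat) (e : 'I_d -> V) (A : 'M[R]_(d2, d)) y :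
  comb (fun i => comb e (row i A)) y = comb e (y *m A).
Proof.
rewrite /comb; under eq_bigr do rewrite scaler_sumr.
rewrite exchange_big; apply: eq_bigr => j _.
rewrite mxE rmorph_sum scaler_suml; apply: eq_bigr => i _.
by rewrite scalerA -rmorphM mxE.
Qed.

Lemma nrm_sum_le (I : Type) (s : seq I) (P : pred I) (F : I -> V) :
  nrm (\sum_(i <- s | P i) F i) <= \sum_(i <- s | P i) nrm (F i).
Proof.
elim/big_ind2 : _ => [|f x g y fx gy|i _]; rewrite ?nrm0//.
exact: le_trans (nrmD _ _) (lerD fx gy).
Qed.

Lemma nrm_comb_le d (e : 'I_d -> V) x : nrm (comb e x) <= (\sum_i nrm (e i)) * `|x|.
Proof.
apply: le_trans (nrm_sum_le _ _ _) _; rewrite mulr_suml; apply: ler_sum => i _.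
by rewrite nrmZ normc_real mulrC ler_wpM2l ?nrm_ge0// mx_coord_le.
Qed.

Lemma nrm_dist f g : `|nrm f - nrm g| <= nrm (f - g).
Proof.
have h1 : nrm f <= nrm (f - g) + nrm g by rewrite -{1}(subrK g f) nrmD.
have h2 : nrm g <= nrm (f - g) + nrm f by rewrite -(nrmN (f - g)) opprB -{1}(subrK f g) nrmD.
rewrite ler_norml; move: h1 h2; move: (nrm f) (nrm g) (nrm _) => x y z h1 h2.
by apply/andP; split; lra.
Qed.

Lemma nrm_comb_cont d (e : 'I_d -> V) : continuous (fun x => nrm (comb e x)).
Proof.
move=> x; apply: (iffRL (@cvgrPdist_lt _ _ _ (nbhs x) (nbhs_filter x) _ _)) => t t0; pose L := \sum_i nrm (e i) + 1.
have L0 : 0 < L by rewrite ltr_wpDl// sumr_ge0// => i _; exact: nrm_ge0.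
apply/nbhs_ballP; exists (t / L); first exact: divr_gt0.
move=> y; rewrite mx_norm_ball /ball_ /= => xy.
apply: le_lt_trans (nrm_dist _ _) _; rewrite -combB.
apply: le_lt_trans (nrm_comb_le _ _) _.
apply: (@le_lt_trans _ _ (L * `|x - y|)); first by rewrite ler_wpM2r// lerDl.
by rewrite mulrC -ltr_pdivlMr.
Qed.

Lemma rv_normalize d (x : 'rV[R]_d) : x != 0 -> `|(`|x|^-1 *: x)| = 1.
Proof.
move=> x0; rewrite mx_normZ normrV ?unitfE ?normr_eq0// normr_id mulVf// normr_eq0//.
Qed.

Lemma rfree_bound d (e : 'I_d -> V) : rfree e ->
  exists2 c : R, 0 < c & forall x, c * `|x| <= nrm (comb e x).
Proof.
move=> ef; pose U n := [set x : 'rV[R]_d | n.+1%:R^-1 < nrm (comb e x)].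
have [|n x|x x1|N HN] := @sphere_cover R d U.
- move=> n x; rewrite /U /=; apply: le_lt_trans; by rewrite lef_pV2 ?posrE// ler_nat.
- by move=> Ux; exact: (@nrm_comb_cont d e x _ (lt_nbhsr Ux)).
- have x0 : x != 0 by apply/eqP => x0; move: x1; rewrite x0 normr0 => /eqP; rewrite eq_sym oner_eq0.
  have n0 : 0 < nrm (comb e x).
    rewrite lt_neqAle nrm_ge0 andbT eq_sym; apply: contra x0 => /eqP /nrm_eq0 /ef ->//.
  exists (Num.truncn (nrm (comb e x))^-1); rewrite /U /= invf_plt ?posrE//.
  exact: truncnS_gt.
exists N.+1%:R^-1 => [|x]; first by rewrite invr_gt0.
have [->|x0] := eqVneq x 0; first by rewrite normr0 mulr0 nrm_ge0.
have := HN _ (rv_normalize x0); rewrite /U /= combZ nrmZ normc_real.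
have nx : 0 < `|x| by rewrite normr_gt0.
rewrite ger0_norm ?invr_ge0// => h; apply: ltW.
by rewrite -ltr_pdivlMr// mulrC.
Qed.

End FiniteDim.

(** * Moments of a discrete semigroup of positive contractions *)

Section PositiveSemigroup.
Variables (R : realType) (alpha : R).
Hypothesis alpha1 : -1 < alpha.
Local Notation V := (bergman alpha).
Implicit Types f g h : V.
Variable sg : nat -> V -> V.
Hypothesis sgD : forall k f g, sg k (f + g) = sg k f + sg k g.
Hypothesis sgZ : forall k (r : R) f, sg k (r%:C *: f) = r%:C *: sg k f.
Hypothesis sgS : forall j k f, sg j (sg k f) = sg (j + k) f.
Hypothesis ipsg : forall k f g, ip (sg k f) g = ip f (sg k g).
Hypothesis sg_le : forall k f, nsq (sg k f) <= nsq f.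
Hypothesis sg_inj : forall k f, sg k f = 0 -> f = 0.

(** By symmetry this is <sg (k + k) f, f>, the k-th moment of the spectral measure of f for
    [sg 2]. *)
Definition mom k f := nsq (sg k f).

Lemma sgB k f g : sg k (f - g) = sg k f - sg k g.
Proof. by rewrite sgD -scaleN1r -[-1](rmorphN1 (real_complex R)) sgZ rmorphN1 scaleN1r. Qed.

Lemma mom_ge0 k f : 0 <= mom k f. Proof. exact: nsq_ge0. Qed.

Lemma mom_gt0 k f : f != 0 -> 0 < mom k f.
Proof.
move=> f0; rewrite lt_neqAle mom_ge0 andbT eq_sym; apply: contra f0 => /eqP /nsq_eq0.
by move=> /sg_inj ->.
Qed.

Lemma ip_sg k f : ip (sg k.+2 f) (sg k f) = mom k.+1 f.
Proof. by rewrite /mom -ipff !ipsg !sgS; congr (ip f (sg _ f)); rewrite addSn addnS addSn. Qed.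

Lemma mom_logconvex k f : mom k.+1 f ^+ 2 <= mom k f * mom k.+2 f.
Proof. by rewrite -ip_sg mulrC ip_sqr_le. Qed.

Lemma mom_dec k f : mom k.+1 f <= mom k f.
Proof. by rewrite /mom -add1n -sgS; exact: sg_le. Qed.

(** Log-convexity: the ratio of consecutive moments is nondecreasing in k. *)
Lemma ratio_mono (s : R) k f : 0 <= s -> s * mom k f <= mom k.+1 f ->
  s * mom k.+1 f <= mom k.+2 f.
Proof.
move=> s0 h; have [->|f0] := eqVneq f 0.
  have z j : mom j 0 = 0.
    by apply/le_anti; rewrite mom_ge0 andbT (le_trans (sg_le _ _))// -sqr_nrm nrm0 expr0n.
  by rewrite !z mulr0.
have m0 := mom_gt0 k f0; have m1 := mom_gt0 k.+1 f0.
rewrite -(ler_pM2l m0); apply: le_trans (mom_logconvex k f).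
by rewrite mulrA [mom k f * s]mulrC expr2 ler_wpM2r ?mom_ge0.
Qed.

Lemma ratio_mono_le (s : R) k j f : 0 <= s -> (k <= j)%N -> s * mom k f <= mom k.+1 f ->
  s * mom j f <= mom j.+1 f.
Proof.
move=> s0 /subnK <-; elim: (j - k)%N => // n IH h; rewrite addSn; apply: ratio_mono => //.
exact: IH.
Qed.

Lemma ratio_growth (s : R) k j f : 0 <= s -> s * mom k f <= mom k.+1 f ->
  s ^+ j * mom k f <= mom (k + j)%N f.
Proof.
move=> s0 h; elim: j => [|j IH]; first by rewrite mul1r addn0.
rewrite addnS exprS -mulrA; apply: (@le_trans _ _ (s * mom (k + j)%N f)).
  by rewrite ler_wpM2l.
by apply: (@ratio_mono_le s k) => //; rewrite leq_addr.
Qed.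

(** In spectral terms, f lies in the subspace of [sg 2] for the interval [0, l]. This form, unlike a
    bound on ratios, is clearly stable under sums. *)
Definition slow (l : R) f := exists Cc : R, forall k, mom k f <= Cc * l ^+ k.

Lemma momD k f g : mom k (f + g) <= 2 * mom k f + 2 * mom k g.
Proof.
rewrite /mom sgD nsqD; have := nsq_ge0 (sg k f - sg k g); rewrite nsqB.
by move: (nsq _) (ip _ _) (nsq _) => x y z; lra.
Qed.

Lemma slowD l f g : slow l f -> slow l g -> slow l (f + g).
Proof.
move=> [a Ha] [b Hb]; exists (2 * a + 2 * b) => k; apply: le_trans (momD _ _ _) _.
have -> : (2 * a + 2 * b) * l ^+ k = 2 * (a * l ^+ k) + 2 * (b * l ^+ k) by ring.
by rewrite lerD// ler_pM2l.
Qed.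

Lemma slowZ l (r : R) f : slow l f -> slow l (r%:C *: f).
Proof.
move=> [a Ha]; exists (r ^+ 2 * a) => k; rewrite /mom sgZ nsqZ -mulrA.
by rewrite ler_wpM2l ?sqr_ge0//; exact: Ha.
Qed.

(** A ratio s > l would persist at all later indices and make the moments grow at least like s^j. *)
Lemma slow_ratio (l : R) f k : 0 <= l -> slow l f -> mom k.+1 f <= l * mom k f.
Proof.
move=> l0 [Cc HC]; rewrite leNgt; apply/negP => h.
have f0 : f != 0.
  apply: contraTneq h => ->; rewrite -leNgt.
  have z j : mom j 0 = 0.
    by apply/le_anti; rewrite mom_ge0 andbT (le_trans (sg_le _ _))// -sqr_nrm nrm0 expr0n.
  by rewrite !z mulr0.
have m0 := mom_gt0 k f0.
pose s := mom k.+1 f / mom k f.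
have ls : l < s by rewrite ltr_pdivlMr.
have s0 : 0 < s by exact: le_lt_trans ls.
have sE : s * mom k f <= mom k.+1 f by rewrite /s divfK ?gt_eqF.
have G j : mom k f <= (Cc * l ^+ k) * (l / s) ^+ j.
  have := le_trans (ratio_growth j (ltW s0) sE) (HC (k + j)%N).
  move=> hh; rewrite exprMn exprVn [leRHS]mulrA ler_pdivlMr ?exprn_gt0//.
  by rewrite [leLHS]mulrC -mulrA -exprD.
have : (fun j => (Cc * l ^+ k) * (l / s) ^+ j) @ \oo --> (Cc * l ^+ k) * 0.
  apply: cvgM; first exact: cvg_cst.
  have q1 : l / s < 1 by rewrite ltr_pdivrMr// mul1r.
  by apply: cvg_expr; rewrite ger0_norm// divr_ge0// ltW.
rewrite mulr0 => /cvgrPdist_lt /(_ _ m0)[N _ /(_ N (leqnn N))] /=.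
by rewrite sub0r normrN => /(le_lt_trans (ler_norm _)); rewrite ltNge G.
Qed.

(** The factor uses [sg 2], whose spectral values are what the ratios of [mom] measure. *)
Definition qop (r : R) f := sg 2 f - r%:C *: f.
Definition qops (rs : seq R) f := foldr qop f rs.

Lemma qopD r f g : qop r (f + g) = qop r f + qop r g.
Proof. by rewrite /qop sgD scalerDr opprD addrACA. Qed.

Lemma qopsD rs f g : qops rs (f + g) = qops rs f + qops rs g.
Proof. by elim: rs => //= r rs ->; rewrite qopD. Qed.

Lemma qop_comm r t f : qop r (qop t f) = qop t (qop r f).
Proof.
rewrite /qop !sgB !sgZ !scalerBr !scalerA [t%:C * r%:C]mulrC; exact: subrACA.
Qed.

Lemma qops_comm r rs f : qops rs (qop r f) = qop r (qops rs f).
Proof. by elim: rs => //= t rs ->; rewrite qop_comm. Qed.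

Lemma nrm_sg k f : nrm (sg k f) <= nrm f.
Proof. by rewrite ler_wsqrtr. Qed.

Lemma nrm_qop r f : nrm (qop r f) <= (1 + `|r|) * nrm f.
Proof.
apply: le_trans (nrmB _ _) _; rewrite mulrDl mul1r nrmZ normc_real.
by rewrite lerD2r nrm_sg.
Qed.

Lemma nrm_qops rs : exists2 B : R, 0 < B & forall f, nrm (qops rs f) <= B * nrm f.
Proof.
elim: rs => [|r rs [B B0 HB]]; first by exists 1 => // f; rewrite mul1r.
exists ((1 + `|r|) * B) => [|f]; first by rewrite mulr_gt0// ltr_pwDl.
apply: le_trans (nrm_qop _ _) _; by rewrite -mulrA ler_wpM2l ?HB// addr_ge0.
Qed.

Lemma nsq_qop_sg r k f : nsq (qop r (sg k f)) = mom k.+2 f - 2 * r * mom k.+1 f + r ^+ 2 * mom k f.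
Proof. by rewrite /qop nsqB nsqZ ipZr sgS ip_sg mulrA. Qed.

(** The square expands to m_(k+2) - 2 l m_(k+1) + l^2 m_k. Since m_(k+2) <= l m_(k+1) and (l - eta)
    m_k <= m_(k+1), this is at most l eta m_k. *)
Lemma qop_slow (l eta : R) k f : 0 <= l <= 1 -> 0 <= eta -> slow l f ->
  (l - eta) * mom k f <= mom k.+1 f -> nsq (qop l (sg k f)) <= eta * nsq (sg k f).
Proof.
move=> /andP[l0 l1] e0 sf h; rewrite nsq_qop_sg -/(mom k f).
have h2 := slow_ratio k.+1 l0 sf; have m0 := mom_ge0 k f.
have h3 : l * ((l - eta) * mom k f) <= l * mom k.+1 f by rewrite ler_wpM2l.
have h4 : l * (eta * mom k f) <= eta * mom k f by rewrite ler_piMl// mulr_ge0.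
move: h2 h3 h4 m0; move: (mom k f) (mom k.+1 f) (mom k.+2 f) => x y z; nra.
Qed.

(** Pairing the left-hand vector with [sg k f] gives m_(k+1) - l m_k, at least (l' - l) m_k;
    conclude by Cauchy-Schwarz. *)
Lemma qop_fast (l l' : R) k f : l <= l' -> l' * mom k f <= mom k.+1 f ->
  (l' - l) * nrm (sg k f) <= nrm (qop l (sg k f)).
Proof.
move=> ll h; have [n0|n0] := eqVneq (nrm (sg k f)) 0; first by rewrite n0 mulr0 nrm_ge0.
have np : 0 < nrm (sg k f) by rewrite lt_neqAle eq_sym n0 nrm_ge0.
rewrite -(ler_pM2r np) -mulrA -expr2 sqr_nrm.
apply: le_trans (le_trans (ler_norm _) (ip_le (qop l (sg k f)) (sg k f))).
rewrite /qop ipDl ipNl ipZl sgS ip_sg ipff -/(mom k f) mulrBl.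
by rewrite lerD2r.
Qed.

Lemma mom_comb_cont k d (e : 'I_d -> V) : continuous (fun x => mom k (comb e x)).
Proof.
have E x : sg k (comb e x) = comb (fun i => sg k (e i)) x.
  rewrite /comb; elim/big_ind2 : _ => [|f x1 g y1 <- <-|i _].
  - by have := sgB k 0 0; rewrite !subrr.
  - exact: sgD.
  - exact: sgZ.
have -> : (fun x => mom k (comb e x)) =
    (fun x => nrm (comb (fun i => sg k (e i)) x) * nrm (comb (fun i => sg k (e i)) x)).
  by apply/funext => x; rewrite /mom E -expr2 sqr_nrm.
move=> x; have c := @nrm_comb_cont R alpha d (fun i => sg k (e i)) x.
exact: (cvgM c c).
Qed.

Lemma momZ k (r : R) f : mom k (r%:C *: f) = r ^+ 2 * mom k f.
Proof. by rewrite /mom sgZ nsqZ. Qed.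

(** The open sets U n increase because ratios do; by compactness one of them contains the unit
    sphere, and homogeneity removes the normalisation. *)
Lemma uniform_fast (l : R) d (e : 'I_d -> V) : 0 <= l ->
  (forall x, x != 0 -> exists k, l * mom k (comb e x) < mom k.+1 (comb e x)) ->
  exists2 l', l < l' & exists K, forall k, (K <= k)%N -> forall x,
    l' * mom k (comb e x) <= mom k.+1 (comb e x).
Proof.
move=> l0 H.
pose U n := [set x : 'rV[R]_d | 0 < mom n.+1 (comb e x) - (l + n.+1%:R^-1) * mom n (comb e x)].
have ln n : 0 <= l + n.+1%:R^-1 by rewrite addr_ge0.
have [|n x|x x1|N HN] := @sphere_cover R d U.
- move=> n x; rewrite /U /= !subr_gt0 => h.
  have f0 : comb e x != 0.
    apply: contraTneq h => ->; rewrite -leNgt.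
    have z j : mom j 0 = 0.
      by apply/le_anti; rewrite mom_ge0 andbT (le_trans (sg_le _ _))// -sqr_nrm nrm0 expr0n.
    by rewrite !z mulr0.
  apply: (@lt_le_trans _ _ ((l + n.+1%:R^-1) * mom n.+1 (comb e x))).
    by rewrite ltr_pM2r ?mom_gt0// ltrD2l ltf_pV2 ?posrE// ltr_nat.
  exact: ratio_mono (ltW h).
- rewrite /U /= => h.
  have c : {for x, continuous (fun x => mom n.+1 (comb e x) - (l + n.+1%:R^-1) * mom n (comb e x))}.
    have c1 := @mom_comb_cont n.+1 d e x; have c2 := @mom_comb_cont n d e x.
    exact: (cvgB c1 (cvgM (cvg_cst (l + n.+1%:R^-1)) c2)).
  exact: (c _ (lt_nbhsr h)).
- have x0 : x != 0 by apply/eqP => x0; move: x1; rewrite x0 normr0 => /eqP; rewrite eq_sym oner_eq0.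
  have [k hk] := H x x0.
  have m0 : 0 < mom k (comb e x).
    rewrite lt_neqAle mom_ge0 andbT eq_sym; apply: contraTneq hk => h.
    by rewrite h mulr0 -leNgt -h; exact: mom_dec.
  pose t := (mom k.+1 (comb e x) - l * mom k (comb e x)) / mom k (comb e x).
  have t0 : 0 < t by rewrite divr_gt0// subr_gt0.
  have tk : (l + t) * mom k (comb e x) <= mom k.+1 (comb e x).
    by rewrite mulrDl /t divfK ?gt_eqF// addrC subrK.
  (* From index k on the ratio is at least l + t, and the second term makes 1 / (n + 1) smaller than
     t. *)
  pose n := maxn k (Num.truncn t^-1).
  exists n; rewrite /U /= subr_gt0.
  have lt0 : 0 <= l + t by rewrite addr_ge0// ltW.
  apply: lt_le_trans (ratio_mono_le lt0 (leq_maxl _ _) tk : (l + t) * mom n _ <= _).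
  have mn : 0 < mom n (comb e x).
    by apply: mom_gt0; apply: contraTneq m0 => ->; rewrite -leNgt (le_trans (sg_le _ _))// -sqr_nrm nrm0 expr0n.
  rewrite ltr_pM2r// ltrD2l -[t in ltRHS]invrK ltf_pV2 ?posrE ?invr_gt0//.
  by apply: lt_le_trans (truncnS_gt _) _; rewrite ler_nat ltnS leq_maxr.
exists (l + N.+1%:R^-1); first by rewrite ltrDl invr_gt0.
exists N => k Nk x; have [->|x0] := eqVneq x 0.
  rewrite comb0; have z j : mom j 0 = 0.
    by apply/le_anti; rewrite mom_ge0 andbT (le_trans (sg_le _ _))// -sqr_nrm nrm0 expr0n.
  by rewrite !z mulr0.
apply: (ratio_mono_le (ln N) Nk).
have := HN _ (rv_normalize x0); rewrite /U /= combZ !momZ subr_gt0.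
have nx : 0 < `|x|^-1 ^+ 2 by rewrite exprn_gt0// invr_gt0 normr_gt0.
by rewrite mulrCA ltr_pM2l// => /ltW.
Qed.

(** Here u, w, v are the norms of the slow part, of the fast part and of their sum. The condition
    eta <= de / 2 lets the left side absorb the multiple of w. *)
Lemma split_arith (de eta u w v q : R) : 0 < de -> 0 <= eta -> eta <= de / 2 -> eta <= 1 ->
  0 <= u -> 0 <= w -> 0 <= v -> u <= v + w -> de * w <= q -> q <= 2 * v + eta * u ->
  w <= 6 / de * v /\ u <= (1 + 6 / de) * v.
Proof.
move=> d0 e0 ed e1 u0 w0 v0 uvw dw qv.
have hw : w <= 6 / de * v.
  rewrite mulrAC ler_pdivlMr//.
  have h1 : eta * u <= eta * v + eta * w by rewrite -mulrDr ler_wpM2l.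
  have h2 : eta * v <= v by rewrite ler_piMl.
  have h3 : eta * w <= de / 2 * w by rewrite ler_wpM2r.
  by lra.
by split=> //; lra.
Qed.

(* Let l be the largest number such that asymptotically mom k.+1 >= l mom k, uniformly
   on the span of e. The vectors whose moments are O(l^k) form a subspace, on
   which [sg 2 - l] is asymptotically small relative to [sg k]. On a
   complement, a compactness argument provides l' > l with mom k.+1 >= l' mom k,
   and the induction hypothesis applies. A sum of vectors from the two parts
   cannot be much smaller than its terms, as [sg 2 - l] is nearly zero on the
   first one and bounded below on the second one. *)
Theorem approximate_annihilator d (e : 'I_d -> V) : rfree e ->
  exists rs : seq R, forall eps : R, 0 < eps -> exists K, forall k, (K <= k)%N -> forall x,
    nrm (qops rs (sg k (comb e x))) <= eps * nrm (sg k (comb e x)).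
Proof.
elim/ltn_ind: d e => d IH e ef.
have z j : mom j 0 = 0.
  by apply/le_anti; rewrite mom_ge0 andbT (le_trans (sg_le _ _))// -sqr_nrm nrm0 expr0n.
have sg0 k : sg k 0 = 0 by apply: nsq_eq0; exact: z.
have [d0|d0] := posnP d.
  exists [::] => eps eps0; exists 0%N => k _ x.
  have -> : x = 0 by apply/rowP => -[i ik]; exfalso; move: ik; rewrite d0.
  by rewrite comb0 sg0 /= nrm0 mulr0.
(* By [ratio_mono_le] a ratio bound at one index holds at all later ones, so a single k captures the
   asymptotic rate. *)
pose S := [set s : R | 0 <= s /\ exists k, forall x, s * mom k (comb e x) <= mom k.+1 (comb e x)].
have [x0 x00] : exists x0 : 'rV[R]_d, x0 != 0.
  exists (delta_mx ord0 (Ordinal d0)); apply/eqP => /matrixP /(_ ord0 (Ordinal d0)).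
  by rewrite !mxE !eqxx => /eqP; rewrite oner_eq0.
have S0 : S 0 by split=> //; exists 0%N => x; rewrite mul0r mom_ge0.
have S1 s : S s -> s <= 1.
  move=> [s0 [k /(_ x0) h]].
  have m0 : 0 < mom k (comb e x0) by apply: mom_gt0; apply: contra x00 => /eqP /ef ->.
  rewrite -(ler_pM2r m0) mul1r; exact: le_trans h (mom_dec _ _).
have hs : has_sup S by split; [exists 0|exists 1 => s /S1].
pose l := sup S.
have l0 : 0 <= l by apply: ub_le_sup => //; case: hs.
have l1 : l <= 1 by apply: ge_sup; [exists 0|move=> s /S1].
have near_l (t : R) : 0 < t -> exists K, forall k, (K <= k)%N -> forall x,
    (l - t) * mom k (comb e x) <= mom k.+1 (comb e x).
  move=> t0; have [s [s0 [K HK]] ls] := sup_adherent t0 hs.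
  exists K => k Kk x; apply: le_trans (ratio_mono_le s0 Kk (HK x)).
  by rewrite ler_wpM2r ?mom_ge0// ltW.
have notfast : ~ (forall x, x != 0 -> exists k, l * mom k (comb e x) < mom k.+1 (comb e x)).
  move=> /(uniform_fast l0)[l' ll' [K HK]].
  have : S l' by split; [exact: le_trans (ltW ll')|exists K; exact: HK].
  by move=> /(ub_le_sup (proj2 hs)); rewrite leNgt ll'.
have slowP x : (forall k, ~ l * mom k (comb e x) < mom k.+1 (comb e x)) -> slow l (comb e x).
  move=> h; exists (mom 0 (comb e x)) => k; elim: k => [|k IHk]; first by rewrite mulr1.
  have := h k => /negP; rewrite -leNgt => /le_trans; apply.
  by rewrite exprS mulrCA ler_wpM2l.
(* Subspaces of coordinates are row spaces of square matrices; ranks are at most d, so a slow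
   subspace of maximal rank exists. *)
pose good r := `[< exists2 N : 'M[R]_d, \rank N = r & forall y, (y <= N)%MS -> slow l (comb e y) >].
have good0 : exists r, good r.
  exists 0%N; apply/asboolP; exists 0; first exact: mxrank0.
  by move=> y /submx0null ->; exists 0 => k; rewrite comb0 z mul0r.
have goodd r : good r -> (r <= d)%N by move=> /asboolP[N <- _]; exact: rank_leq_row.
case: (ex_maxnP good0 goodd) => r /asboolP[N rN HN] rmax.
(* Maximality makes N contain every slow vector, since adding one to the subspace keeps it slow. *)
have maxN y : slow l (comb e y) -> (y <= N)%MS.
  move=> sy; apply/negPn/negP => yN.
  have : good (\rank (N + y)%MS).
    apply/asboolP; exists (N + y)%MS => // w /sub_addsmxP[[a b] /= ->].
    rewrite combD; apply: slowD; first by apply: HN; rewrite submxMl.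
    have -> : b *m y = (b ord0 ord0) *: y.
      by apply/rowP => j; rewrite !mxE big_ord1.
    by rewrite combZ; apply: slowZ.
  move=> /rmax; rewrite leqNgt -rN => /negP; apply.
  have : (N < N + y)%MS.
    by rewrite ltmxE addsmxSl /=; apply: contra yN; apply: submx_trans; exact: addsmxSr.
  by rewrite ltmxErank => /andP[].
(* With no nonzero slow vector, [uniform_fast] would produce a rate above l. So the complement has
   smaller dimension and the induction applies. *)
have r0 : (0 < r)%N.
  rewrite lt0n; apply/eqP => r00; apply: notfast => x xn0.
  apply: contrapT => h; have : slow l (comb e x).
    by apply: slowP => k hk; apply: h; exists k.
  move=> /maxN; move: rN; rewrite r00 => /eqP; rewrite mxrank_eq0 => /eqP ->.
  by move=> /submx0null x00'; rewrite x00' eqxx in xn0.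
pose B := row_base (N^C)%MS.
pose eB i := comb e (row i B).
have eBE w : comb eB w = comb e (w *m B) by rewrite comb_mul.
have eBf : rfree eB.
  move=> w; rewrite eBE => /ef wB.
  by apply: (row_free_inj (row_base_free (N^C)%MS)); rewrite wB mul0mx.
have dB : (\rank (N^C)%MS < d)%N by rewrite mxrank_compl rN ltn_subrL r0.
have [rs Hrs] := IH _ dB eB eBf.
have [l' ll' [K3 HK3]] : exists2 l', l < l' & exists K, forall k, (K <= k)%N -> forall x,
    l' * mom k (comb eB x) <= mom k.+1 (comb eB x).
  apply: uniform_fast => // w w0; apply: contrapT => h.
  have : slow l (comb e (w *m B)).
    by apply: slowP => k hk; apply: h; exists k; rewrite eBE.
  move=> /maxN wN; move/eqP: w0; apply.
  apply: (row_free_inj (row_base_free (N^C)%MS)); rewrite mul0mx -/B.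
  have : (w *m B <= N :&: N^C)%MS.
    by rewrite sub_capmx wN (submx_trans (submxMl _ _))// eq_row_base.
  by rewrite capmx_compl => /submx0null.
have [Bq Bq0 HBq] := nrm_qops rs.
exists (l :: rs) => eps eps0.
pose de := l' - l; have de0 : 0 < de by rewrite subr_gt0.
(* The total error is eta * M * nrm v: [Bq] times the size of the slow part, at most 1 + 6 / de,
   plus 2 times that of the fast part, at most 6 / de. *)
pose M := Bq * (1 + 6 / de) + 2 * (6 / de).
have M0 : 0 < M.
  have d6 : 0 < 6 / de by rewrite divr_gt0.
  by rewrite addr_gt0// mulr_gt0// addr_gt0.
pose eta := Num.min (Num.min (de / 2) 1) (eps / M).
have eta0 : 0 < eta by rewrite !lt_min ltr01 !divr_gt0.
have eta1 : eta <= de / 2 by rewrite !ge_min lexx.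
have eta2 : eta <= 1 by rewrite !ge_min lexx orbT.
have eta3 : eta * M <= eps by rewrite -ler_pdivlMr// !ge_min lexx !orbT.
(* The precision is eta^2 because [qop_slow] bounds squared norms. *)
have [K1 HK1] := near_l _ (exprn_gt0 2 eta0).
have [K2 HK2] := Hrs _ eta0.
exists (maxn K1 (maxn K2 K3)) => k; rewrite !geq_max => /and3P[k1 k2 k3] x.
have [[a b] /= xE] : exists u : 'M[R]_(1, d) * 'M[R]_(1, d), x = u.1 *m N + u.2 *m (N^C)%MS.
  by apply/sub_addsmxP; exact: submx_full (addsmx_compl_full N).
have [w wE] : exists w, b *m (N^C)%MS = w *m B.
  by apply/submxP; rewrite eq_row_base submxMl.
set v := sg k (comb e x).
pose u0 := sg k (comb e (a *m N)); pose w0 := sg k (comb eB w).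
have vE : v = u0 + w0 by rewrite /v xE wE combD sgD -eBE.
have su : slow l (comb e (a *m N)) by apply: HN; rewrite submxMl.
have hu : nrm (qop l u0) <= eta * nrm u0.
  rewrite -(@ler_pXn2r _ 2) ?nnegrE ?nrm_ge0 ?mulr_ge0 ?nrm_ge0 ?(ltW eta0)//.
  rewrite exprMn !sqr_nrm; apply: (qop_slow (l := l)) => //; first by rewrite l0 l1.
  - by rewrite exprn_ge0// ltW.
  - exact: HK1.
have hw : nrm (qops rs w0) <= eta * nrm w0 by exact: HK2.
have hd : de * nrm w0 <= nrm (qop l w0) by apply: qop_fast; [exact: ltW|exact: HK3].
have n2 f : nrm (qop l f) <= 2 * nrm f.
  apply: le_trans (nrm_qop _ _) _; rewrite ler_wpM2r ?nrm_ge0// ger0_norm//.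
  by rewrite -[leRHS]/(1 + 1) lerD2l.
have hq : nrm (qop l w0) <= 2 * nrm v + eta * nrm u0.
  have -> : qop l w0 = qop l v - qop l u0 by rewrite vE qopD addrAC subrr add0r.
  exact: le_trans (nrmB _ _) (lerD (n2 v) hu).
have uv : nrm u0 <= nrm v + nrm w0.
  have -> : u0 = v - w0 by rewrite vE addrK.
  exact: nrmB.
have [W U] := split_arith de0 (ltW eta0) eta1 eta2 (nrm_ge0 u0) (nrm_ge0 w0) (nrm_ge0 v) uv hd hq.
have -> : qop l (qops rs v) = qops rs (qop l u0) + qop l (qops rs w0).
  by rewrite vE qopsD qopD qops_comm.
apply: le_trans (nrmD _ _) _.
have b1 : nrm (qops rs (qop l u0)) <= eta * (Bq * ((1 + 6 / de) * nrm v)).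
  have h1 := le_trans hu (ler_wpM2l (ltW eta0) U).
  apply: le_trans (le_trans (HBq _) (ler_wpM2l (ltW Bq0) h1)) _.
  by rewrite [X in X <= _]mulrCA.
have b2 : nrm (qop l (qops rs w0)) <= eta * (2 * (6 / de * nrm v)).
  have h1 := le_trans hw (ler_wpM2l (ltW eta0) W).
  apply: le_trans (le_trans (n2 _) (ler_wpM2l (ler0n R 2) h1)) _.
  by rewrite [X in X <= _]mulrCA.
apply: le_trans (lerD b1 b2) _.
have -> : eta * (Bq * ((1 + 6 / de) * nrm v)) + eta * (2 * (6 / de * nrm v)) = eta * M * nrm v.
  by rewrite /M; ring.
by rewrite ler_wpM2r ?nrm_ge0.
Qed.

(** The last partial product that does not kill f gives an eigenvector, for the factor applied
    next. *)
Lemma qops_eigen rs f : f != 0 -> qops rs f = 0 ->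
  exists2 r, r \in rs & exists2 y, y != 0 & sg 2 y = r%:C *: y.
Proof.
elim: rs => [|r rs IH] /= f0; first by move=> f00; rewrite f00 eqxx in f0.
have [q0 _|q0 /subr0_eq] := eqVneq (qops rs f) 0.
  by have [t trs Ht] := IH f0 q0; exists t => //; rewrite inE trs orbT.
by exists r; [rewrite inE eqxx|exists (qops rs f)].
Qed.

Lemma qops_on_eigen rs (r : R) y : sg 2 y = r%:C *: y ->
  qops rs y = (\prod_(t <- rs) (r - t))%:C *: y.
Proof.
move=> yr; elim: rs => [|t rs IH]; first by rewrite big_nil scale1r.
rewrite /= IH big_cons /qop sgZ yr !scalerA -scalerBl; congr (_ *: y).
by rewrite -!rmorphM -rmorphB; congr (_%:C); ring.
Qed.

End PositiveSemigroup.

(** * Symbols which are not of type II *)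

Section Orbits.
Variables (R : realType) (alpha : R).
Hypothesis alpha1 : -1 < alpha.
Local Notation C := R[i]^o.
Local Notation V := (bergman alpha).
Implicit Types f g h : V.

Lemma mul_frac_le (c e : R) : 0 <= c -> 0 <= e -> c * (e / (c + 1)) <= e.
Proof.
move=> c0 e0; have c1 : 0 < c + 1 by rewrite ltr_wpDl.
by rewrite mulrCA ler_piMr// ler_pdivrMr// mul1r lerDl.
Qed.

Lemma geometric_sum (a : R) k : (\sum_(i < k) a ^+ i) * (1 - a) = 1 - a ^+ k.
Proof.
elim: k => [|k IH]; first by rewrite big_ord0 mul0r expr0 subrr.
by rewrite big_ord_recr /= mulrDl IH exprS; ring.
Qed.

(** The translation part of the k-th iterate: w |-> a^k w + offset a b k. *)
Definition offset (a : R) (b : R[i]) (k : nat) : R[i] := (\sum_(i < k) a ^+ i)%:C * b.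

Lemma offsetS a b k : offset a b k.+1 = (a ^+ k)%:C * b + offset a b k.
Proof. by rewrite /offset big_ord_recr /= rmorphD mulrDl addrC. Qed.

Lemma Re_realM (r : R) (z : R[i]) : complex.Re (r%:C * z) = r * complex.Re z.
Proof. by rewrite ReM /= mul0r subr0. Qed.

Lemma Re_offset a b k : complex.Re (offset a b k) = (\sum_(i < k) a ^+ i) * complex.Re b.
Proof. exact: Re_realM. Qed.

Lemma Re_offset_ge0 a b k : 0 <= a -> 0 <= complex.Re b -> 0 <= complex.Re (offset a b k).
Proof.
by move=> a0 b0; rewrite Re_offset mulr_ge0// sumr_ge0// => i _; exact: exprn_ge0.
Qed.

Lemma iter_compV a b k f : 0 < a -> 0 <= complex.Re b ->
  iter k (compV a b) f = compV (a ^+ k) (offset a b k) f.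
Proof.
move=> a0 b0; elim: k => [|k IH].
  by rewrite /offset big_ord0 mul0r expr0 (compV1 alpha1).
rewrite iterS IH (compV_comp alpha1 f a0 b0 (exprn_gt0 k a0) (Re_offset_ge0 k (ltW a0) b0)).
by rewrite -exprSr offsetS.
Qed.

Lemma nrm_compV a b f : 0 < a -> 0 <= complex.Re b ->
  nrm (compV a b f) = Num.sqrt (a `^ (- (2 + alpha))) * nrm (compV 1 (complex.Re b)%:C f).
Proof. by move=> a0 b0; rewrite /nrm (nsq_compV alpha1 f a0 b0) sqrtrM ?powR_ge0. Qed.

(** The operator is an invertible dilation composed with a shift, whose range is dense. *)
Lemma compV_range_dense a b f (e : R) : 0 < a -> 0 <= complex.Re b -> 0 < e ->
  exists h, nrm (f - compV a b h) <= e.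
Proof.
move=> a0 b0 e0; pose y := complex.Im b; pose c := Num.sqrt (a `^ (- (2 + alpha))).
have c0 : 0 <= c by exact: sqrtr_ge0.
have c1 : 0 < c + 1 by rewrite ltr_wpDl.
have iy0 : 0 <= complex.Re (0 +i* y) by [].
have ai0 : 0 < a^-1 by rewrite invr_gt0.
have iy1 : 0 <= complex.Re (0 +i* (- y / a)) by [].
have [h hP] := shift_range_dense alpha1 (compV a^-1 (0 +i* (- y / a)) f) b0 (divr_gt0 e0 c1).
exists h.
have E1 : compV a b h = compV a (0 +i* y) (compV 1 (complex.Re b)%:C h).
  have b0' : 0 <= complex.Re ((complex.Re b)%:C : R[i]) by [].
  rewrite (compV_comp alpha1 h a0 iy0 ltr01 b0') mul1r; congr (compV _ _ h).
  apply/eqP; rewrite eq_complex ReD ImD ReM ImM /= -/y.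
  by apply/andP; split; apply/eqP; ring.
have E2 : f = compV a (0 +i* y) (compV a^-1 (0 +i* (- y / a)) f).
  rewrite (compV_comp alpha1 f a0 iy0 ai0 iy1) mulVf ?gt_eqF//.
  have -> : (a^-1)%:C * (0 +i* y) + (0 +i* (- y / a)) = 0 :> R[i].
    apply/eqP; rewrite eq_complex /= mul0r mulr0 subr0 addr0 !mul0r addr0 eqxx /=.
    by apply/eqP; field; rewrite gt_eqF.
  by rewrite (compV1 alpha1).
rewrite E1 {1}E2 -(compVB alpha1 _ _ a0 iy0).
apply: le_trans (nrm_compV_le alpha1 _ a0 iy0) _; rewrite -/c.
apply: le_trans (ler_wpM2l c0 hP) _.
exact: mul_frac_le (ltW e0).
Qed.

Lemma comb_compV a b d (e : 'I_d -> V) x : 0 < a -> 0 <= complex.Re b ->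
  compV a b (comb e x) = comb (fun i => compV a b (e i)) x.
Proof.
move=> a0 b0; rewrite /comb (compV_sum alpha1 _ a0 b0).
by apply: eq_bigr => i _; rewrite (compVZ alpha1 _ _ a0 b0).
Qed.

(* Real coordinates on a complex span: the family e followed by i e. *)
Definition realify n (e : 'I_n -> V) (i : 'I_(n + n)) : V :=
  match fintype.split i with inl j => e j | inr j => 'i *: e j end.

Lemma realify_comb n (e : 'I_n -> V) (x : 'rV[R]_(n + n)) :
  comb (realify e) x = \sum_(j < n) (x ord0 (lshift n j) +i* x ord0 (rshift n j)) *: e j.
Proof.
rewrite /comb big_split_ord /= -big_split; apply: eq_bigr => j _.
have E1 : fintype.split (lshift n j) = inl j := unsplitK (inl j).
have E2 : fintype.split (rshift n j) = inr j := unsplitK (inr j).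
rewrite /realify E1 E2 /=.
rewrite scalerA -scalerDl; congr (_ *: _); apply/eqP.
rewrite eq_complex ReD ImD ReM ImM /=.
by apply/andP; split; apply/eqP; ring.
Qed.

Lemma realify_free n (e : 'I_n -> V) : lin_independent e -> rfree (realify e).
Proof.
move=> ef x; rewrite realify_comb => /ef h; apply/rowP => i; rewrite mxE.
by rewrite -(splitK i); case: (fintype.split i) => j /=; have := h j => -[].
Qed.

Lemma span_comb n (e : 'I_n -> V) f : lin_span e f -> exists x, f = comb (realify e) x.
Proof.
move=> [c _ <-]; exists (row_mx (\row_j complex.Re (c j)) (\row_j complex.Im (c j))).
rewrite realify_comb; apply: eq_bigr => j _; congr (_ *: _).
by rewrite row_mxEl row_mxEr !mxE; case: (c j).
Qed.

Lemma ball_nrm f g (e : R) : 0 < e -> ball f e%:C g <-> nrm (f - g) < e.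
Proof. by move=> e0; rewrite -ball_normE /ball_ /= normVE ltcR. Qed.

Lemma dense_approx (A : set V) : dense A ->
  forall f (e : R), 0 < e -> exists2 g, A g & nrm (f - g) <= e.
Proof.
move=> dA f e e0; have e0c : 0 < e%:C :> R[i] by rewrite ltcR.
have [||g [fg Ag]] := dA (ball f e%:C)^°%classic.
- by exists f; exact: nbhsx_ballx.
- exact: open_interior.
exists g => //; apply: ltW; apply/(ball_nrm f g e0); exact: interior_subset.
Qed.

(** Approximation by iterates as late as desired, which is what asymptotic estimates can
    contradict. *)
Definition approx (T : V -> V) d (e : 'I_d -> V) := forall K f (t : R), 0 < t ->
  exists2 k, (K <= k)%N & exists x, nrm (f - iter k T (comb e x)) <= t.

(** T^K has dense range: approximate f by T^K h, then h by a point T^k y of the orbit, so that T^(K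
    + k) y approximates f. *)
Lemma supercyclic_approx n a b : 0 < a -> 0 <= complex.Re b ->
  n_supercyclic n (compV a b : V -> V) ->
  exists2 e : 'I_(n + n) -> V, rfree e & approx (compV a b) e.
Proof.
move=> a0 b0 [E [e0 ef EE] dE]; exists (realify e0); first exact: realify_free.
move=> K f t t0.
have aK : 0 < a ^+ K by exact: exprn_gt0.
have bK := Re_offset_ge0 K (ltW a0) b0.
have t20 : 0 < t / 2 by rewrite divr_gt0.
have [h hP] := compV_range_dense f aK bK t20.
pose c := Num.sqrt ((a ^+ K) `^ (- (2 + alpha))).
have c0 : 0 <= c by exact: sqrtr_ge0.
have c1 : 0 < c + 1 by rewrite ltr_wpDl.
have [g [k _ [y Ey gE]] hg] := dense_approx dE h (divr_gt0 t20 c1).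
exists (K + k)%N; first exact: leq_addr.
have [x yx] : exists x, y = comb (realify e0) x by apply: span_comb; rewrite -EE.
exists x; rewrite -yx iterD gE (iter_compV K g a0 b0).
have -> : f - compV (a ^+ K) (offset a b K) g =
    (f - compV (a ^+ K) (offset a b K) h) + compV (a ^+ K) (offset a b K) (h - g).
  by rewrite (compVB alpha1 h g aK bK) addrA subrK.
apply: le_trans (nrmD _ _) _; rewrite [leRHS]splitr lerD//.
apply: le_trans (nrm_compV_le alpha1 _ aK bK) _; rewrite -/c.
apply: le_trans (ler_wpM2l c0 hg) _.
exact: mul_frac_le (ltW t20).
Qed.

Lemma bergman_neq0 : exists f : V, f != 0.
Proof.
have [e ef] := bergman_infinite_dim alpha1 1; exists (e ord0); apply/eqP => e0.
have := ef (fun=> 1); rewrite big_ord1 e0 scaler0 => /(_ erefl ord0)/eqP.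
by rewrite oner_eq0.
Qed.

Lemma bergman_point : exists f : V, exists2 z : R[i], 0 < complex.Re z & ext0 f z != 0.
Proof.
have [f f0] := bergman_neq0; exists f; apply: contrapT => h; move/eqP: f0; apply.
apply: bergman_ext => z z0; rewrite ext0_0; apply: contrapT => fz.
by apply: h; exists z => //; apply/eqP.
Qed.

(** A late iterate y close to f has norm at most nrm f + 1, so its value at z is at most m / 3; but
    that value is within m / 3 of f(z), whose modulus is m. *)
Lemma eval_contra (T : V -> V) d (e : 'I_d -> V) f (z : R[i]) : approx T e ->
  0 < complex.Re z -> ext0 f z != 0 ->
  ~ (forall eta : R, 0 < eta -> exists K, forall k, (K <= k)%N -> forall x,
     normc (ext0 (iter k T (comb e x)) z) <= eta * nrm (iter k T (comb e x))).
Proof.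
move=> aT z0 fz H; set m := normc (ext0 f z).
have m0 : 0 < m by rewrite normc_gt0.
have n1 : 0 < nrm f + 1 by rewrite ltr_wpDl ?nrm_ge0.
have p1 : 0 < ptC alpha (complex.Re z) + 1 by rewrite ltr_wpDl ?ptC_ge0.
have m3 : 0 < m / 3 by rewrite divr_gt0.
have [K HK] := H _ (divr_gt0 m3 n1).
pose t := Num.min 1 (m / 3 / (ptC alpha (complex.Re z) + 1)).
have t0 : 0 < t by rewrite lt_min ltr01 divr_gt0.
have [k Kk [x fx]] := aT K f t t0.
have := HK k Kk x; set y := iter k T _ in fx *.
have ny : nrm y <= nrm f + 1.
  have -> : y = f - (f - y) by rewrite opprB addrC subrK.
  apply: le_trans (nrmB _ _) _; rewrite lerD2l; apply: le_trans fx _.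
  by rewrite ge_min lexx.
have h1 : m / 3 / (nrm f + 1) * nrm y <= m / 3.
  by rewrite mulrAC ler_pdivrMr// ler_wpM2l ?(ltW m3).
have h2 : normc (ext0 f z - ext0 y z) <= m / 3.
  rewrite -vB_ext; apply: le_trans (pt_bound _ z0) _.
  apply: (@le_trans _ _ ((ptC alpha (complex.Re z) + 1) * t)).
    by rewrite ler_pM ?ptC_ge0 ?nrm_ge0// lerDl.
  by rewrite mulrC -ler_pdivlMr// ge_min lexx orbT.
have h3 : m <= normc (ext0 f z - ext0 y z) + normc (ext0 y z).
  by rewrite /m -{1}(subrK (ext0 y z) (ext0 f z)); exact: le_normcD.
move=> h4; have h5 := le_trans h4 h1; move: h2 h3 h5 m0.
by move: (normc _) (normc _) => p q; clearbody m; clear; lra.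
Qed.

Lemma expn_large (s M : R) : 1 < s -> exists K, forall k, (K <= k)%N -> M <= s ^+ k.
Proof.
move=> s1; have s0 : 0 < s by exact: lt_trans s1.
have c : (fun k => s^-1 ^+ k) @ \oo --> (0 : R).
  by apply: cvg_expr; rewrite ger0_norm ?invr_ge0 ?(ltW s0)// invf_lt1.
have M0 : 0 < (`|M| + 1)^-1 by rewrite invr_gt0 ltr_wpDl.
have [K _ HK] := iffLR (@cvgrPdist_lt _ _ _ _ _ _ _) c _ M0.
exists K => k Kk; have := HK k Kk; rewrite /= sub0r normrN ger0_norm ?exprn_ge0 ?invr_ge0 ?(ltW s0)//.
rewrite exprVn ltf_pV2 ?posrE ?exprn_gt0 ?ltr_wpDl// => /ltW; apply: le_trans.
by apply: le_trans (ler_norm M) _; rewrite lerDl.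
Qed.

Lemma powR_expn (a s : R) k : 0 < a -> (a ^+ k) `^ s = (a `^ s) ^+ k.
Proof.
move=> a0; rewrite -(powR_mulrn k (ltW a0)) -(powR_mulrn k (powR_ge0 a s)) -!powRrM.
by rewrite mulrC.
Qed.

Lemma sqrt_expn (t : R) k : 0 <= t -> Num.sqrt (t ^+ k) = Num.sqrt t ^+ k.
Proof.
move=> t0; elim: k => [|k IH]; first by rewrite !expr0 sqrtr1.
by rewrite !exprS sqrtrM// IH.
Qed.

Lemma sqrt_powR_neg (a : R) k : 0 < a ->
  Num.sqrt ((a ^+ k) `^ (- (2 + alpha))) = (Num.sqrt (a `^ (2 + alpha)))^-1 ^+ k.
Proof.
by move=> a0; rewrite powR_expn// sqrt_expn ?powR_ge0// powRN sqrtrV ?powR_ge0.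
Qed.

Lemma sqrt_powR_lt1 (a : R) : 0 < a -> a < 1 -> Num.sqrt (a `^ (2 + alpha)) < 1.
Proof.
move=> a0 a1; have p1 : a `^ (2 + alpha) < 1.
  have e1 : (1 : R) `^ (2 + alpha) = 1 by rewrite powR1.
  by rewrite -[ltRHS]e1 gt0_ltr_powR ?nnegrE ?(ltW a0)// alpha2.
by rewrite -[ltRHS]sqrtr1 ltr_sqrt.
Qed.

(** On the span, the norm of the k-th iterate is at least s^k, s > 1, times a fixed multiple of the
    original norm. Its value at z is a value of the original function at real part at least Re b,
    where evaluations are bounded. *)
Lemma not_supercyclic_attracting n a b : 0 < a -> a < 1 -> 0 < complex.Re b ->
  ~ n_supercyclic n (compV a b : V -> V).
Proof.
move=> a0 a1 b0 /(supercyclic_approx a0 (ltW b0))[e ef ae].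
have [f [z z0 fz]] := bergman_point.
apply: (eval_contra ae z0 fz) => eta eta0.
(* The supremum of the real parts of the offsets: the shift by q is injective, hence bounded below
   on the span, and bounds all the shifts that occur. *)
pose q := complex.Re b / (1 - a).
have a10 : 0 < 1 - a by rewrite subr_gt0.
have q0 : 0 <= q by rewrite divr_ge0 ?(ltW b0) ?(ltW a10).
have q0' : 0 <= complex.Re (q%:C : R[i]) by [].
have Sf : rfree (fun i => compV 1 q%:C (e i)).
  by move=> x; rewrite -(comb_compV _ _ ltr01 q0') => /(shift_eq0 alpha1 q0) /ef.
have [c c0 Hc] := rfree_bound Sf.
pose L := \sum_i nrm (e i).
have L0 : 0 <= L by apply: sumr_ge0 => i _; exact: nrm_ge0.
pose s := (Num.sqrt (a `^ (2 + alpha)))^-1.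
have s1 : 1 < s by rewrite /s invf_gt1 ?sqrt_powR_lt1// sqrtr_gt0 powR_gt0.
pose B := ptC alpha (complex.Re b) * (L / c).
have B0 : 0 <= B by rewrite mulr_ge0 ?ptC_ge0// divr_ge0 ?(ltW c0).
have [K HK] := expn_large (B / eta) s1.
(* For k >= 1 the geometric sum contains its term 1, so the evaluation point has real part at least
   Re b. *)
exists (maxn K 1) => k; rewrite geq_max => /andP[Kk k1] x.
rewrite (iter_compV k _ a0 (ltW b0)).
have ak : 0 < a ^+ k by exact: exprn_gt0.
have bk := Re_offset_ge0 k (ltW a0) (ltW b0).
rewrite (nrm_compV _ ak bk) (sqrt_powR_neg _ a0) -/s.
rewrite (ext0_compV alpha1 _ ak bk z0).
have bk2 : complex.Re (offset a b k) <= q.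
  rewrite Re_offset mulrC ler_wpM2l ?(ltW b0)// -div1r ler_pdivlMr//.
  rewrite geometric_sum.
  by rewrite gerBl exprn_ge0// ltW.
have h1 : normc (ext0 (comb e x) ((a ^+ k)%:C * z + offset a b k)) <=
    ptC alpha (complex.Re b) * nrm (comb e x).
  apply: pt_bound2 => //; rewrite ReD Re_realM Re_offset.
  rewrite (@le_trans _ _ ((\sum_(i < k) a ^+ i) * complex.Re b))//; last first.
    by rewrite lerDr mulr_ge0 ?(ltW z0) ?(ltW ak).
  rewrite ler_peMl ?(ltW b0)//; case: (k) k1 => // m _.
  rewrite big_ord_recl expr0 lerDl sumr_ge0// => i _; exact: exprn_ge0 (ltW a0).
apply: le_trans h1 _.
have h2 : nrm (comb e x) <= L / c * nrm (compV 1 (complex.Re (offset a b k))%:C (comb e x)).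
  apply: le_trans (nrm_comb_le e x) _; rewrite -mulrA ler_wpM2l//.
  rewrite mulrC ler_pdivlMr// mulrC; apply: le_trans (Hc x) _.
  rewrite -(comb_compV _ _ ltr01 q0').
  have qd : 0 <= q - complex.Re (offset a b k) by rewrite subr_ge0.
  rewrite -[q](subrK (complex.Re (offset a b k))) -(shiftD alpha1 _ qd bk).
  exact: nrm_shift_le.
apply: le_trans (ler_wpM2l (ptC_ge0 _ _) h2) _; rewrite mulrA -/B mulrA.
rewrite ler_wpM2r ?nrm_ge0// mulrC -ler_pdivrMr//.
exact: HK.
Qed.

End Orbits.

(** * Automorphisms, the identity, and parabolic symbols *)

Section NotSupercyclic.
Variables (R : realType) (alpha : R).
Hypothesis alpha1 : -1 < alpha.
Local Notation C := R[i]^o.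
Local Notation leb := (@lebesgue_measure R).
Local Notation leb2 := (leb \x leb)%E.
Local Notation V := (bergman alpha).
Implicit Types f g h : V.

Lemma ext0_comb d (e : 'I_d -> V) x z :
  ext0 (comb e x) z = \sum_i (x ord0 i)%:C * ext0 (e i) z.
Proof.
rewrite /comb; elim/big_ind2 : _ => [|f u g v <- <-|i _].
- exact: ext0_0.
- exact: vD_ext.
- exact: vZ_ext.
Qed.

Lemma normc_ext0_comb d (e : 'I_d -> V) x z :
  normc (ext0 (comb e x) z) <= `|x| * \sum_i normc (ext0 (e i) z).
Proof.
rewrite ext0_comb mulr_sumr.
apply: (@le_trans _ _ (\sum_i normc ((x ord0 i)%:C * ext0 (e i) z))).
  elim/big_ind2 : _ => [|u r v s ur vs|i _]; rewrite ?normc0//.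
  exact: le_trans (le_normcD _ _) (lerD ur vs).
apply: ler_sum => i _; rewrite normcM normc_real ler_wpM2r ?normc_ge0//.
exact: mx_coord_le.
Qed.

(** Evaluations scaled by x^((2 + alpha) / 2) tend to 0 on each f along escaping points:
    [eval_bound] combined with [cvg_int_leaving]. *)
Lemma weighted_eval_cvg0 f (X Y : nat -> R) : (forall k, 0 < X k) ->
  (forall p, right_half p -> \forall k \near \oo, ~ sq (X k) (Y k) (X k / 2) p) ->
  forall e : R, 0 < e -> exists K, forall k, (K <= k)%N ->
    normc (ext0 f (X k +i* Y k)) * Num.sqrt (X k `^ (2 + alpha)) <= e.
Proof.
move=> X0 lv e e0; have fA := bergmanA f.
have mF k : measurable (sq (X k) (Y k) (X k / 2)) by exact: measurable_sq.
have := cvg_int_leaving fA mF lv.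
have Ik0 k : (0 <= \int[leb2]_(p in sq (X k) (Y k) (X k / 2)) (dens alpha f p)%:E)%E.
  by apply: integral_ge0 => p _; rewrite lee_fin dens_ge0.
have Ikf k : (\int[leb2]_(p in sq (X k) (Y k) (X k / 2)) (dens alpha f p)%:E)%E \is a fin_num.
  rewrite ge0_fin_numE//; apply: le_lt_trans (proj2 fA); rewrite bergman_intE.
  apply: (ge0_subset_integral leb2 (mF k) measurableT (measurable_dens alpha (proj1 fA))) => //.
  by move=> p _; rewrite lee_fin dens_ge0.
have d0 : 0 < e ^+ 2 / evalC alpha by rewrite divr_gt0 ?evalC_gt0// exprn_gt0.
move=> /fine_cvgP[_ /cvgrPdist_lt /(_ _ d0)] [K _ HK].
exists K => k Kk; have := HK k Kk; rewrite /= sub0r normrN ger0_norm ?fine_ge0// => h.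
have := eval_bound alpha (Y k) (proj1 fA) (X0 k).
rewrite -(fineK (Ikf k)) -EFinM lee_fin => h2.
rewrite -(@ler_pXn2r _ 2) ?nnegrE ?mulr_ge0 ?normc_ge0 ?sqrtr_ge0 ?(ltW e0)//.
rewrite exprMn sqr_sqrtr ?powR_ge0//; apply: le_trans h2 _.
by rewrite mulrC -ler_pdivlMr ?evalC_gt0// ltW.
Qed.

Lemma weighted_sum_cvg0 d (e : 'I_d -> V) (X Y : nat -> R) : (forall k, 0 < X k) ->
  (forall p, right_half p -> \forall k \near \oo, ~ sq (X k) (Y k) (X k / 2) p) ->
  forall t : R, 0 < t -> exists K, forall k, (K <= k)%N ->
    (\sum_i normc (ext0 (e i) (X k +i* Y k))) * Num.sqrt (X k `^ (2 + alpha)) <= t.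
Proof.
move=> X0 lv t t0; have d1 : 0 < (d%:R + 1 : R) by rewrite ltr_wpDl.
have /choice[K HK] : forall i, exists K, forall k, (K <= k)%N ->
    normc (ext0 (e i) (X k +i* Y k)) * Num.sqrt (X k `^ (2 + alpha)) <= t / (d%:R + 1).
  by move=> i; apply: weighted_eval_cvg0 => //; exact: divr_gt0.
exists (\max_i K i) => k Kk; rewrite mulr_suml.
apply: (@le_trans _ _ (\sum_(i < d) (t / (d%:R + 1)))).
  by apply: ler_sum => i _; apply: HK; apply: leq_trans Kk; exact: leq_bigmax.
rewrite sumr_const card_ord -[leLHS]mulr_natl; apply: mul_frac_le => //; exact: ltW.
Qed.

(** The real part of the orbit tends to 0 if a < 1 and to infinity if a > 1; for a = 1 the orbit
    moves vertically by the nonzero step Im b. *)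
Lemma orbit_leaves (a : R) (b w : R[i]) : 0 < a -> complex.Re b = 0 -> (a, b) <> (1, 0) ->
  0 < complex.Re w ->
  let z k := (a ^+ k)%:C * w + offset a b k in
  forall p, right_half p ->
    \forall k \near \oo, ~ sq (complex.Re (z k)) (complex.Im (z k)) (complex.Re (z k) / 2) p.
Proof.
move=> a0 b0 ab w0 z [p1 p2] /= p0.
have zR k : complex.Re (z k) = a ^+ k * complex.Re w.
  by rewrite /z ReD Re_realM Re_offset b0 mulr0 addr0.
have [a1|a1|a1] := ltgtP a 1.
- have ai : 1 < a^-1 by rewrite invf_gt1.
  have [K HK] := expn_large (2 * complex.Re w / p1) ai.
  exists K => // k /= /HK h [/= + _]; rewrite in_itv/= zR => /andP[_ h2].
  have ak : 0 < a ^+ k by rewrite exprn_gt0.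
  move: h; rewrite exprVn ler_pdivrMr// => h.
  have {}h := ler_wpM2l (ltW ak) h; rewrite mulVKf ?gt_eqF// in h.
  have : 0 < a ^+ k * complex.Re w by rewrite mulr_gt0.
  by move: h h2; move: (complex.Re w) (a ^+ k) => u v h h2 h3; lra.
- have [K HK] := expn_large (2 * (p1 + 1) / complex.Re w) a1.
  exists K => // k /= /HK h [/= + _]; rewrite in_itv/= zR => /andP[h2 _].
  move: h; rewrite ler_pdivrMr// => h.
  by move: h h2; move: (complex.Re w) (a ^+ k) => u v h h2; lra.
- have b10 : complex.Im b != 0.
    apply/eqP => bI; apply: ab; rewrite a1; congr (_, _).
    by apply/eqP; rewrite eq_complex b0 bI !eqxx.
  have zI k : complex.Im (z k) = complex.Im w + k%:R * complex.Im b.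
    rewrite /z ImD ImM /= mul0r addr0 a1 expr1n mul1r; congr (_ + _).
    rewrite /offset ImM /= mul0r addr0; congr (_ * _).
    under eq_bigr do rewrite expr1n; by rewrite sumr_const card_ord.
  pose M := (`|p2| + `|complex.Im w| + complex.Re w + 1) / `|complex.Im b|.
  exists (Num.truncn M).+1 => // k /= Mk [/= _]; rewrite in_itv/= zR zI a1 expr1n mul1r.
  have bI : 0 < `|complex.Im b| by rewrite normr_gt0.
  have h : M <= k%:R by apply: le_trans (ltW (truncnS_gt M)) _; rewrite ler_nat.
  move: h; rewrite ler_pdivrMr//.
  have -> : k%:R * `|complex.Im b| = `|k%:R * complex.Im b| by rewrite normrM ger0_norm.
  move: (k%:R * _) => u; move: w0; move: (complex.Re w) (complex.Im w) => x y x0 h /andP[h1 h2].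
  move: h; rewrite leNgt => /negP; apply.
  apply: (@le_lt_trans _ _ (`|u + y - p2| + `|p2| + `|y|)).
    rewrite {1}(_ : u = (u + y - p2) + p2 - y); last by ring.
    apply: le_trans (ler_normB _ _) _; rewrite lerD2r; exact: ler_normD.
  have : `|u + y - p2| <= x / 2 by rewrite ler_norml; apply/andP; split; lra.
  by move: (`|p2|) (`|y|) (`|_|) => r s t; lra.
Qed.

(** The k-th iterate multiplies norms by exactly a^(-k (2 + alpha) / 2), which up to a constant is
    the reciprocal of the scaling in [weighted_sum_cvg0] at the orbit point. *)
Lemma not_supercyclic_automorphism n a b : 0 < a -> complex.Re b = 0 -> (a, b) <> (1, 0) ->
  ~ n_supercyclic n (compV a b : V -> V).
Proof.
move=> a0 b0 ab; have b0' : 0 <= complex.Re b by rewrite b0.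
move=> /(supercyclic_approx alpha1 a0 b0')[e ef ae].
have [f [w w0 fw]] := bergman_point alpha1.
apply: (eval_contra ae w0 fw) => eta eta0.
have [c c0 Hc] := rfree_bound ef.
pose z k := (a ^+ k)%:C * w + offset a b k.
have zR k : complex.Re (z k) = a ^+ k * complex.Re w.
  by rewrite /z ReD Re_realM Re_offset b0 mulr0 addr0.
have zp k : 0 < complex.Re (z k) by rewrite zR mulr_gt0// exprn_gt0.
pose u := Num.sqrt (complex.Re w `^ (2 + alpha)).
have u0 : 0 < u by rewrite sqrtr_gt0 powR_gt0.
have t0 : 0 < eta * c * u by rewrite !mulr_gt0.
have [K HK] := weighted_sum_cvg0 e zp (orbit_leaves a0 b0 ab w0) t0.
exists K => k Kk x; have := HK k Kk.
rewrite (iter_compV alpha1 k _ a0 b0').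
have ak : 0 < a ^+ k by exact: exprn_gt0.
have bk := Re_offset_ge0 k (ltW a0) b0'.
rewrite (ext0_compV alpha1 _ ak bk w0) (nrm_compV alpha1 _ ak bk) -/(z k).
have -> : complex.Re (z k) +i* complex.Im (z k) = z k by case: (z k).
have -> : complex.Re (offset a b k) = 0 by rewrite Re_offset b0 mulr0.
rewrite (compV1 alpha1) zR powRM ?(ltW ak) ?(ltW w0)// sqrtrM ?powR_ge0//.
rewrite powRN sqrtrV ?powR_ge0// -/u.
set s := Num.sqrt _; have s0 : 0 < s by rewrite sqrtr_gt0 powR_gt0.
rewrite mulrA ler_pM2r// => h.
apply: le_trans (normc_ext0_comb e x (z k)) _.
rewrite mulrA mulrAC ler_pdivlMr// -mulrA mulrC.
apply: (@le_trans _ _ (eta * c * `|x|)); first by rewrite ler_wpM2r.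
by rewrite -mulrA ler_pM2l.
Qed.

(** The orbit of E is E itself. More free vectors than dim E, each approximated in E, admit a
    combination whose approximant is 0, contrary to [rfree_bound]. *)
Lemma not_supercyclic_identity n : ~ n_supercyclic n (compV 1 0 : V -> V).
Proof.
have z0 : 0 <= complex.Re (0 : R[i]) by [].
move=> /(supercyclic_approx alpha1 ltr01 z0)[e ef ae].
pose d := (n + n)%N.
have [e1 e1f] := bergman_infinite_dim alpha1 d.+1.
have e1r := realify_free e1f.
have [c c0 Hc] := rfree_bound e1r.
pose N := (d.+1 + d.+1)%N.
have N1 : 0 < (N%:R + 1 : R) by rewrite ltr_wpDl.
(* The N approximation errors then add up to at most c / 2. *)
pose t := c / (2 * (N%:R + 1)).
have t0 : 0 < t by rewrite divr_gt0// mulr_gt0.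
have /choice[X HX] : forall i : 'I_N, exists x : 'rV[R]_d, nrm (realify e1 i - comb e x) <= t.
  move=> i; have [k _ [x Hx]] := ae 0%N (realify e1 i) t t0; exists x.
  move: Hx; rewrite (iter_compV alpha1 k _ ltr01 z0) expr1n.
  by rewrite /offset mulr0 (compV1 alpha1).
pose M : 'M[R]_(N, d) := \matrix_i X i.
have [y y0 yM] : exists2 y : 'rV[R]_N, y != 0 & y *m M = 0.
  have k0 : kermx M != 0.
    rewrite -mxrank_eq0 mxrank_ker subn_eq0 -ltnNge.
    by apply: leq_ltn_trans (rank_leq_col M) _; rewrite /N addSn ltnS leq_addr.
  have [i ki] : exists i, row i (kermx M) != 0.
    apply/existsP; apply: contraR k0; rewrite negb_exists => /forallP h.
    apply/eqP/row_matrixP => i; have := h i; rewrite negbK => /eqP ->.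
    by rewrite row0.
  exists (row i (kermx M)) => //; apply/sub_kermxP; exact: row_sub.
have E : comb (realify e1) y = comb (fun i => realify e1 i - comb e (X i)) y.
  have -> : comb (fun i => realify e1 i - comb e (X i)) y =
      comb (realify e1) y - comb (fun i => comb e (row i M)) y.
    rewrite /comb -sumrB; apply: eq_bigr => i _; rewrite scalerBr; congr (_ - _ *: _).
    by rewrite /M rowK.
  by rewrite comb_mul yM comb0 subr0.
have := Hc y; rewrite E => /le_trans /(_ (nrm_comb_le _ _)).
have ny : 0 < `|y| by rewrite normr_gt0.
rewrite ler_pM2r// => h.
have h2 : \sum_i nrm (realify e1 i - comb e (X i)) <= \sum_(i < N) t by apply: ler_sum => i _.
have := le_trans h h2; rewrite sumr_const card_ord -mulr_natl.
have h3 : N%:R * t <= c / 2.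
  have -> : N%:R * t = N%:R * (c / (N%:R + 1)) / 2 by rewrite /t; field; rewrite gt_eqF.
  by rewrite ler_pM2r ?invr_gt0//; exact: mul_frac_le (ler0n _ _) (ltW c0).
move=> /le_trans /(_ h3); rewrite leNgt => /negP; apply.
by rewrite ltr_pdivrMr// ltr_pMr// ltr1n.
Qed.

(* Density turns the approximate annihilator into an exact one: a polynomial of
   the shift by Re b vanishes, so the shift has an eigenvalue 0 < r < 1.
   Dilating the eigenvector by an integer k gives the eigenvalue r^k, and the
   polynomial would have infinitely many roots. *)
Lemma not_supercyclic_parabolic n b : 0 < complex.Re b ->
  ~ n_supercyclic n (compV 1 b : V -> V).
Proof.
move=> b0 /(supercyclic_approx alpha1 ltr01 (ltW b0))[e ef ae].
(* With half of Re b, the shift by Re b is [sg 2], the square of [sg 1], and the k-th iterate has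
   the norms of [sg (k + k)]. *)
pose h := complex.Re b / 2; have h0 : 0 < h by rewrite divr_gt0.
pose sg (k : nat) : V -> V := compV 1 (k%:R * h)%:C.
have kh k : 0 <= k%:R * h by rewrite mulr_ge0// ltW.
have kh' k : 0 <= complex.Re ((k%:R * h)%:C : R[i]) by exact: kh.
have sgD k f g : sg k (f + g) = sg k f + sg k g by rewrite /sg (compVD alpha1 f g ltr01 (kh' k)).
have sgZ k (r : R) f : sg k (r%:C *: f) = r%:C *: sg k f.
  by rewrite /sg (compVZ alpha1 _ f ltr01 (kh' k)).
have sgS j k f : sg j (sg k f) = sg (j + k)%N f.
  by rewrite /sg (shiftD alpha1 f (kh j) (kh k)) -mulrDl natrD.
have ipsg k f g : ip (sg k f) g = ip f (sg k g) by rewrite /sg (ip_shift alpha1 f g (kh k)).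
have sg_le k f : nsq (sg k f) <= nsq f by apply: (nsq_shift_le alpha1 f (kh k)).
have sg_inj k f : sg k f = 0 -> f = 0 by apply: (shift_eq0 alpha1 (kh k)).
have [rs Hrs] := approximate_annihilator sgD sgZ sgS ipsg sg_le sg_inj ef.
have [B B0 HB] := nrm_qops sg_le rs.
have ofE k : complex.Re (offset 1 b k) = (k + k)%N%:R * h.
  rewrite Re_offset; under eq_bigr do rewrite expr1n.
  by rewrite sumr_const card_ord /h natrD; field.
have of0 k := Re_offset_ge0 k (@ler01 R) (ltW b0).
have nT k f : nrm (iter k (compV 1 b) f) = nrm (sg (k + k)%N f).
  rewrite (iter_compV alpha1 k f ltr01 (ltW b0)) expr1n (nrm_compV alpha1 f ltr01 (of0 k)).
  by rewrite powR1 sqrtr1 mul1r ofE.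
have sgT j k f : sg j (iter k (compV 1 b) f) = iter k (compV 1 b) (sg j f).
  rewrite !(iter_compV alpha1 k _ ltr01 (ltW b0)) expr1n /sg.
  rewrite (compV_comp alpha1 f ltr01 (kh' j) ltr01 (of0 k)).
  by rewrite (compV_comp alpha1 f ltr01 (of0 k) ltr01 (kh' j)) !mul1r addrC.
have qT k f : qops sg rs (iter k (compV 1 b) f) = iter k (compV 1 b) (qops sg rs f).
  elim: (rs) => //= r rs' ->; rewrite /qop sgT.
  rewrite !(iter_compV alpha1 k _ ltr01 (ltW b0)) expr1n.
  by rewrite (compVB alpha1 _ _ ltr01 (of0 k)) (compVZ alpha1 _ _ ltr01 (of0 k)).
have qsg k f : qops sg rs (sg k f) = sg k (qops sg rs f).
  elim: (rs) => //= r rs' ->; rewrite /qop (sgB sgD sgZ) sgZ !sgS.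
  by rewrite addnC.
(* The polynomial commutes with the iterates, so its smallness on the [sg] orbit of the span carries
   over to vectors approximating f. *)
have q0 f : qops sg rs f = 0.
  apply: nrm_eq0; apply/le_anti; rewrite nrm_ge0 andbT.
  apply/ler_addgt0Pr => eps eps0; rewrite add0r.
  have n1 : 0 < nrm f + 1 by rewrite ltr_wpDl ?nrm_ge0.
  have e2 : 0 < eps / 2 by rewrite divr_gt0.
  have [K HK] := Hrs _ (divr_gt0 e2 n1).
  pose t := Num.min 1 (eps / 2 / B).
  have t0 : 0 < t by rewrite lt_min ltr01 divr_gt0.
  have [k Kk [x fx]] := ae K f t t0.
  set y := iter k _ _ in fx.
  have ny : nrm y <= nrm f + 1.
    have -> : y = f - (f - y) by rewrite opprB addrC subrK.
    apply: le_trans (nrmB _ _) _; rewrite lerD2l; apply: le_trans fx _.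
    by rewrite ge_min lexx.
  have qy : nrm (qops sg rs y) <= eps / 2.
    rewrite /y qT nT -qsg.
    apply: le_trans (HK (k + k)%N (leq_trans Kk (leq_addr _ _)) x) _.
    rewrite -nT -/y mulrAC ler_pdivrMr// ler_wpM2l ?(ltW e2)//.
  have -> : f = (f - y) + y by rewrite subrK.
  rewrite (qopsD sgD); apply: le_trans (nrmD _ _) _; rewrite [leRHS]splitr lerD//.
  apply: le_trans (HB _) _; rewrite mulrC -ler_pdivlMr//; apply: le_trans fx _.
  by rewrite ge_min lexx orbT.
have [f f0] := bergman_neq0 alpha1.
have [r rrs [y y0 ry]] := qops_eigen f0 (q0 f).
have sg2 g : sg 2 g = compV 1 (complex.Re b)%:C g.
  by rewrite /sg /h; congr (compV 1 _%:C g); field.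
have ny : 0 < nsq y.
  by rewrite lt_neqAle nsq_ge0 andbT eq_sym; apply: contra y0 => /eqP /nsq_eq0 ->.
(* <sg 2 y, y> is the squared norm of [sg 1 y], positive by injectivity. *)
have r0 : 0 < r.
  have : ip (sg 2 y) y = nsq (sg 1 y) by rewrite -ipff ipsg ipsg sgS.
  rewrite ry ipZl ipff => E; rewrite -(pmulr_lgt0 _ ny) E lt_neqAle nsq_ge0 andbT eq_sym.
  by apply: contra y0 => /eqP /nsq_eq0 /sg_inj ->.
have rl1 : r < 1.
  rewrite lt_neqAle; apply/andP; split.
    apply: contra y0 => /eqP r1; apply/eqP.
    by apply: (periodic_eq0 alpha1 b0); rewrite -sg2 ry r1 scale1r.
  have := sg_le 2%N y; rewrite ry nsqZ => h1.
  have : r ^+ 2 <= 1 by rewrite -(ler_pM2r ny) mul1r.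
  by rewrite -[leRHS](expr1n _ 2) ler_pXn2r ?nnegrE ?(ltW r0).
(* The dilation D by k + 1 satisfies S_c D = D S_((k+1) c), so D y is an eigenvector for r^(k+1). *)
have rk k : r ^+ k.+1 \in rs.
  have k0 : 0 < (k.+1%:R : R) by [].
  have z0 : 0 <= complex.Re (0 : R[i]) by [].
  pose D : V -> V := compV k.+1%:R 0.
  have Dinj g : D g = 0 -> g = 0.
    move=> Dg; have := congr1 (@nrm R alpha) Dg; rewrite /D (nrm_compV alpha1 g k0 z0).
    rewrite (compV1 alpha1) nrm0 => /eqP; rewrite mulf_eq0 sqrtr_eq0 leNgt powR_gt0//=.
    by move=> /eqP /nrm_eq0.
  have it j : compV 1 (j%:R * complex.Re b)%:C y = (r ^+ j)%:C *: y.
    have jb i : 0 <= i%:R * complex.Re b by rewrite mulr_ge0// ltW.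
    elim: j => [|j IH]; first by rewrite mul0r expr0 scale1r (compV1 alpha1).
    rewrite -natr1 mulrDl mul1r -(shiftD alpha1 y (jb j) (ltW b0)) -sg2 ry.
    rewrite (compVZ alpha1 _ y ltr01 (jb j : 0 <= complex.Re ((j%:R * complex.Re b)%:C : R[i]))) IH.
    by rewrite scalerA -rmorphM -exprS.
  have eD : sg 2 (D y) = (r ^+ k.+1)%:C *: D y.
    rewrite sg2 /D -(compVZ alpha1 _ y k0 z0) -it.
    have b0' : 0 <= complex.Re ((complex.Re b)%:C : R[i]) by exact: ltW.
    have b1' : 0 <= complex.Re ((k.+1%:R * complex.Re b)%:C : R[i]) by rewrite /= mulr_ge0// ltW.
    rewrite (compV_comp alpha1 y ltr01 b0' k0 z0) (compV_comp alpha1 y k0 z0 ltr01 b1').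
    by rewrite mulr1 mul1r addr0 mulr0 add0r rmorphM.
  have := q0 (D y); rewrite (qops_on_eigen sgZ rs eD) => /eqP.
  rewrite scaler_eq0 => /orP[|/eqP /Dinj y00]; last by rewrite y00 eqxx in y0.
  rewrite -[0](rmorph0 (real_complex R)) (inj_eq (@complexI R)) prodf_seq_eq0 => /hasP[s srs /=].
  by rewrite subr_eq0 => /eqP ->.
pose s := [seq r ^+ i.+1 | i <- iota 0 (size rs).+1].
have us : uniq s.
  rewrite map_inj_uniq ?iota_uniq// => i j E.
  have mono p q : (p < q)%N -> r ^+ q.+1 < r ^+ p.+1.
    by move=> pq; rewrite ltr_iXn2l.
  by case: (ltngtP i j) => // /mono; rewrite E ltxx.
have := uniq_leq_size us (s2 := rs).
rewrite size_map size_iota ltnn => /(_ _)/negP; apply=> //.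
by move=> _ /mapP[i _ ->]; exact: rk.
Qed.

End NotSupercyclic.

(** * Separability *)

Section Separability.
Variables (R : realType) (alpha : R).
Hypothesis alpha1 : -1 < alpha.
Local Notation C := R[i]^o.
Local Notation leb := (@lebesgue_measure R).
Local Notation leb2 := (leb \x leb)%E.
Local Notation V := (bergman alpha).
Implicit Types f g h : V.

(** One Lipschitz constant for the whole region Re z >= x0, so that a single mesh serves a whole
    box. *)
Lemma lipschitz_bound f (x0 : R) : 0 < x0 -> exists2 L : R, 0 <= L &
  forall z h : C, x0 <= complex.Re z -> normc h <= x0 / 4 ->
    normc (ext0 f (z + h) - ext0 f z) <= L * normc h.
Proof.
move=> x00; have x02 : 0 < x0 / 2 by rewrite divr_gt0.
have x04 : 0 < x0 / 4 by rewrite divr_gt0.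
pose A := estC R * (ptC alpha (x0 / 2) * nrm f) / (x0 / 2) ^+ 2.
have A0 : 0 <= A.
  by rewrite divr_ge0 ?sqr_ge0// mulr_ge0 ?(ltW (estC_gt0 R))// mulr_ge0 ?ptC_ge0 ?nrm_ge0.
pose B := ptC alpha x0 * nrm f.
have B0 : 0 <= B by rewrite mulr_ge0 ?ptC_ge0 ?nrm_ge0.
(* Bounds the linear coefficient of the expansion, by testing the estimate on the real increment x0
   / 4, where both values are at most B. *)
pose l0 := (B + B + A * (x0 / 4) ^+ 2) / (x0 / 4).
have l00 : 0 <= l0 by rewrite divr_ge0 ?(ltW x04)// !addr_ge0// mulr_ge0 ?sqr_ge0.
exists (l0 + A * (x0 / 4)); first by rewrite addr_ge0// mulr_ge0// ltW.
move=> [x y] h /= x0x hx0; have xp : 0 < x by exact: lt_le_trans x0x.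
have [l Hl0] := bergman_estimate alpha1 f y xp.
have Hl (k : C) : normc k <= x0 / 4 ->
    normc (ext0 f ((x +i* y) + k) - ext0 f (x +i* y) - l * k) <= A * normc k ^+ 2.
  move=> hh; have hx : normc k <= x / 4 by apply: le_trans hh _; rewrite ler_pM2r.
  apply: le_trans (Hl0 k hx) _; rewrite ler_wpM2r ?sqr_ge0//.
  have xx : x0 / 2 <= x / 2 by rewrite ler_pM2r.
  have e0 := ltW (estC_gt0 R).
  apply: ler_pM.
  - by apply: mulr_ge0 => //; apply: mulr_ge0; [exact: ptC_ge0|exact: nrm_ge0].
  - by rewrite invr_ge0 sqr_ge0.
  - by rewrite ler_wpM2l// ler_wpM2r ?nrm_ge0// ptC_le.
  rewrite lef_pV2 ?posrE ?exprn_gt0 ?(lt_le_trans x02 xx)//.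
  by rewrite ler_pXn2r ?nnegrE ?(ltW x02) ?(le_trans (ltW x02) xx).
have ll : normc l <= l0.
  have hq : normc ((x0 / 4)%:C : C) = x0 / 4 by rewrite normc_real gtr0_norm.
  have h0 : normc ((x0 / 4)%:C : C) <= x0 / 4 by rewrite hq.
  have h1 := Hl _ h0.
  rewrite /l0 ler_pdivlMr// -{1}hq -normcM.
  set u := ext0 f _ in h1; set v := ext0 f _ in h1; rewrite hq in h1.
  have -> : l * (x0 / 4)%:C = u - v - (u - v - l * (x0 / 4)%:C) by ring.
  apply: le_trans (le_normcD _ _) _; rewrite normcN; apply: lerD => //.
  apply: le_trans (le_normcD _ _) _; rewrite normcN; apply: lerD.
    apply: pt_bound2 => //; rewrite ReD /=; apply: le_trans x0x _.
    by rewrite lerDl ltW.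
  exact: pt_bound2.
have -> : ext0 f ((x +i* y) + h) - ext0 f (x +i* y) =
    (ext0 f ((x +i* y) + h) - ext0 f (x +i* y) - l * h) + l * h by rewrite subrK.
apply: le_trans (le_normcD _ _) _; rewrite mulrDl addrC normcM; apply: lerD.
  by rewrite ler_wpM2r ?normc_ge0.
apply: le_trans (Hl h hx0) _; rewrite expr2 [leLHS]mulrA ler_wpM2r ?normc_ge0//.
by rewrite ler_wpM2l.
Qed.

Definition box (N : nat) : set (R * R) :=
  `[N.+1%:R^-1, N.+1%:R] `*` `[- N.+1%:R, N.+1%:R].

Lemma measurable_box N : measurable (box N).
Proof. by apply: measurableX; exact: measurable_itv. Qed.

Lemma box_finite N : (leb2 (box N) < +oo)%E.
Proof.
rewrite /box product_measure1E; [|exact: measurable_itv|exact: measurable_itv].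
set A := `[_, _]%classic; set B := `[_, _]%classic.
have fA (a b : R) : exists r : R, leb `[a, b]%classic = r%:E.
  by rewrite lebesgue_measure_itv /=; case: ifP => _; [exists (b - a)|exists 0].
change ((leb A * leb B < +oo)%E).
have [r ->] := fA N.+1%:R^-1 N.+1%:R; have [s ->] := fA (- N.+1%:R) N.+1%:R.
by rewrite -EFinM ltry.
Qed.

Lemma box_exhaust p : right_half p -> \forall k \near \oo, ~ (~` box k) p.
Proof.
case: p => x y /= x0; near=> k; suff h : box k (x, y) by move=> /(_ h).
rewrite /box /setX /=; split; rewrite in_itv/=.
  rewrite -[x in _ <= x <= _]invrK lef_pV2 ?posrE ?invr_gt0// invrK; apply/andP; split.
    apply: (@le_trans _ _ k%:R); last by rewrite ler_nat.
    by near: k; exact: nbhs_infty_ger.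
  apply: (@le_trans _ _ k%:R); last by rewrite ler_nat.
  by near: k; exact: nbhs_infty_ger.
rewrite -ler_norml; apply: (@le_trans _ _ k%:R); last by rewrite ler_nat.
by near: k; exact: nbhs_infty_ger.
Unshelve. all: by end_near. Qed.

Definition tail f N : \bar R := (\int[leb2]_(p in ~` box N) (dens alpha f p)%:E)%E.

Lemma tail_small f (t : R) : 0 < t -> exists N, (tail f N <= t%:E)%E.
Proof.
move=> t0; have mF k : measurable (~` box k) by apply: measurableC; exact: measurable_box.
have := cvg_int_leaving (bergmanA f) mF box_exhaust.
have Ik0 k : (0 <= tail f k)%E by apply: integral_ge0 => p _; rewrite lee_fin dens_ge0.
have Ikf k : tail f k \is a fin_num.
  rewrite ge0_fin_numE//; apply: le_lt_trans (proj2 (bergmanA f)); rewrite bergman_intE.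
  apply: (ge0_subset_integral leb2 (mF k) measurableT (measurable_dens alpha (proj1 (bergmanA f)))) => //.
  by move=> p _; rewrite lee_fin dens_ge0.
move=> /fine_cvgP[_ /cvgrPdist_lt /(_ _ t0)] [K _ /(_ K (leqnn K))] /=.
rewrite -/(tail f K) sub0r normrN ger0_norm ?fine_ge0// => h.
by exists K; rewrite -(fineK (Ikf K)) lee_fin ltW.
Qed.

Definition cell (N M : nat) (p : R * R) : nat * nat :=
  (Num.truncn (p.1 * M.+1%:R), Num.truncn ((p.2 + N.+1%:R) * M.+1%:R)).

(** Abscissas are rounded up ([i.+1]), which keeps nodes at real part at least 1 / (N + 1). *)
Definition node (N M i j : nat) : R[i] := (i.+1%:R / M.+1%:R) +i* (j%:R / M.+1%:R - N.+1%:R).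

Lemma node_close N M p : box N p ->
  N.+1%:R^-1 <= complex.Re (node N M (cell N M p).1 (cell N M p).2) /\
  normc ((p.1 +i* p.2) - node N M (cell N M p).1 (cell N M p).2) <= 2 / M.+1%:R.
Proof.
case: p => x y [/= + +]; rewrite !in_itv/= => /andP[x1 x2] /andP[y1 y2].
have M0 : 0 < (M.+1%:R : R) by [].
have x0 : 0 <= x * M.+1%:R by rewrite mulr_ge0// (le_trans _ x1)// invr_ge0.
have y0 : 0 <= (y + N.+1%:R) * M.+1%:R by rewrite mulr_ge0// -lerBlDr sub0r.
have /andP[i1 i2] := truncn_itv x0; have /andP[j1 j2] := truncn_itv y0.
rewrite /node /=; set i := Num.truncn _ in i1 i2 *; set j := Num.truncn _ in j1 j2 *.
have ix : x <= i.+1%:R / M.+1%:R by rewrite ler_pdivlMr// ltW.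
split; first exact: le_trans ix.
apply: le_trans (normc_Complex _ _) _.
have -> : 2 / M.+1%:R = M.+1%:R^-1 + M.+1%:R^-1 :> R by field; rewrite gt_eqF.
apply: lerD.
  rewrite distrC ger0_norm ?subr_ge0// lerBlDr ler_pdivrMr//.
  by rewrite mulrDl mulVf ?gt_eqF// -natr1 [leLHS]addrC lerD2l.
have -> : y - (j%:R / M.+1%:R - N.+1%:R) = ((y + N.+1%:R) * M.+1%:R - j%:R) / M.+1%:R.
  by field; rewrite gt_eqF.
rewrite ger0_norm ?divr_ge0 ?subr_ge0// ler_pdivrMr// mulVf ?gt_eqF//.
by rewrite lerBlDr [leRHS]addrC natr1 ltW.
Qed.

(* A function is encoded by a box carrying most of its norm, a mesh, and its
   values at the nodes rounded down to multiples of the mesh. *)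
Definition code : Type := (nat * nat * seq (seq (int * int)))%type.

Definition entry (tab : seq (seq (int * int))) (i j : nat) : int * int :=
  nth (0, 0) (nth [::] tab i) j.

Definition step (c : code) (p : R * R) : R[i] :=
  let: (N, M, tab) := c in
  let t := entry tab (cell N M p).1 (cell N M p).2 in
  ((t.1)%:~R / M.+1%:R) +i* ((t.2)%:~R / M.+1%:R).

Lemma floor_close (u : R) (M : nat) : `|u - (Num.floor (u * M.+1%:R))%:~R / M.+1%:R| <= M.+1%:R^-1.
Proof.
have M0 : 0 < (M.+1%:R : R) by [].
have /andP[h1 h2] := floor_itv (u * M.+1%:R).
have -> : u - (Num.floor (u * M.+1%:R))%:~R / M.+1%:R =
    (u * M.+1%:R - (Num.floor (u * M.+1%:R))%:~R) / M.+1%:R by field; rewrite gt_eqF.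
rewrite ger0_norm ?divr_ge0 ?subr_ge0// ler_pdivrMr// mulVf ?gt_eqF//.
by rewrite lerBlDr addrC; apply/ltW; rewrite -[1]/(1%:~R) -intrD.
Qed.

Lemma step_approx f N (eta : R) : 0 < eta -> exists M tab, forall p, box N p ->
  normc (ext0 f (p.1 +i* p.2) - step (N, M, tab) p) <= eta.
Proof.
move=> eta0; pose x0 : R := N.+1%:R^-1; have x00 : 0 < x0 by rewrite invr_gt0.
have [L L0 HL] := lipschitz_bound f x00.
(* The first bound puts the node within x0 / 4, the range of the Lipschitz estimate; the second
   covers 2 L / (M + 1) for moving to the node and 2 / (M + 1) for rounding. *)
pose M := Num.truncn (Num.max (8 / x0) (2 * (L + 1) / eta)).
have M0 : 0 < (M.+1%:R : R) by [].
have hM : Num.max (8 / x0) (2 * (L + 1) / eta) <= M.+1%:R by exact: ltW (truncnS_gt _).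
have M1 : 2 / M.+1%:R <= x0 / 4.
  have : 8 / x0 <= M.+1%:R by apply: le_trans hM; rewrite le_max lexx.
  by rewrite !ler_pdivrMr// => h; rewrite mulrAC ler_pdivlMr//; move: h; move: (M.+1%:R) (x0) => u v; lra.
have M2 : 2 * (L + 1) / M.+1%:R <= eta.
  have : 2 * (L + 1) / eta <= M.+1%:R by apply: le_trans hM; rewrite le_max lexx orbT.
  by move=> h; rewrite ler_pdivrMr// [leRHS]mulrC -ler_pdivrMr.
(* Successors, because cell indices run up to the index of the far edge inclusive. *)
pose I := (Num.truncn (N.+1%:R * M.+1%:R : R)).+1.
pose J := (Num.truncn ((N.+1%:R + N.+1%:R) * M.+1%:R : R)).+1.
pose fl (u : R) : int := Num.floor (u * M.+1%:R).
pose F i j := (fl (complex.Re (ext0 f (node N M i j))), fl (complex.Im (ext0 f (node N M i j)))).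
pose tab := mkseq (fun i => mkseq (F i) J) I.
exists M, tab => p pN; have [n1 n2] := node_close M pN.
have iI : ((cell N M p).1 < I)%N.
  rewrite ltnS le_truncn// ler_wpM2r//.
  by case: pN => /=; rewrite in_itv/= => /andP[].
have jJ : ((cell N M p).2 < J)%N.
  rewrite ltnS le_truncn// ler_wpM2r// lerD2r.
  by case: pN => _ /=; rewrite in_itv/= => /andP[].
rewrite /step /entry nth_mkseq// nth_mkseq// /F /=.
set q := node _ _ _ _ in n1 n2 *.
have h1 : normc (ext0 f (p.1 +i* p.2) - ext0 f q) <= L * (2 / M.+1%:R).
  have := HL q ((p.1 +i* p.2) - q) n1 (le_trans n2 M1); rewrite subrKC => /le_trans; apply.
  by rewrite ler_wpM2l.
set w := (_ / _) +i* _; have -> : ext0 f (p.1 +i* p.2) - w =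
  (ext0 f (p.1 +i* p.2) - ext0 f q) + (ext0 f q - w) by rewrite addrA subrK.
have h2 : normc (ext0 f q - w) <= M.+1%:R^-1 + M.+1%:R^-1.
  rewrite /w; case: (ext0 f q) => u v; apply: le_trans (normc_Complex _ _) _.
  by apply: lerD; exact: floor_close.
have E : L * (2 / M.+1%:R) + (M.+1%:R^-1 + M.+1%:R^-1) = 2 * (L + 1) / M.+1%:R.
  by field; rewrite gt_eqF.
apply: le_trans (le_normcD _ _) _; apply: le_trans M2; rewrite -E; exact: lerD.
Qed.

(** An upper bound for the integral of x^alpha over the box, where x lies between 1 / (N + 1) and N
    + 1. *)
Definition weight (N : nat) : R := N.+1%:R `^ `|alpha| * fine (leb2 (box N)).

Lemma weight_ge0 N : 0 <= weight N.
Proof. by rewrite mulr_ge0 ?powR_ge0// fine_ge0. Qed.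

(** The two conditions bound, each by 1 / (n + 1), the squared norm lost outside the box and the
    squared error made inside it. *)
Definition fits (cn : code * nat) f := let: (c, n) := cn in
  (tail f c.1.1 <= (n.+1%:R^-1)%:E)%E /\
  exists2 eta : R, eta ^+ 2 * weight c.1.1 <= n.+1%:R^-1 &
    0 <= eta /\ forall p, box c.1.1 p -> normc (ext0 f (p.1 +i* p.2) - step c p) <= eta.

Lemma fits_ex f n : exists c : code, fits (c, n) f.
Proof.
have n0 : 0 < (n.+1%:R^-1 : R) by rewrite invr_gt0.
have [N HN] := tail_small f n0.
have w1 : 0 < weight N + 1 by rewrite ltr_wpDl// weight_ge0.
pose eta := Num.min 1 (n.+1%:R^-1 / (weight N + 1)).
have eta0 : 0 < eta by rewrite lt_min ltr01 divr_gt0.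
have [M [tab H]] := step_approx f N eta0.
exists (N, M, tab); split=> //; exists eta => //=; last by split=> //; exact: ltW.
apply: (@le_trans _ _ (eta * weight N)).
  by rewrite ler_wpM2r ?weight_ge0// expr2 ler_piMl ?(ltW eta0)// ge_min lexx.
apply: (@le_trans _ _ ((n.+1%:R^-1 / (weight N + 1)) * weight N)).
  by rewrite ler_wpM2r ?weight_ge0// ge_min lexx orbT.
by rewrite mulrC; apply: mul_frac_le; [exact: weight_ge0|exact: ltW].
Qed.

Lemma sqr_normcB_le (a b c : R[i]) (s t : R) : normc (a - c) <= s -> normc (b - c) <= t ->
  normc (a - b) ^+ 2 <= 2 * s ^+ 2 + 2 * t ^+ 2.
Proof.
move=> h1 h2; have h : normc (a - b) <= s + t.
  have -> : a - b = (a - c) - (b - c) by ring.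
  by apply: le_trans (le_normcD _ _) _; rewrite normcN; exact: lerD.
have st : 0 <= s + t by exact: le_trans (normc_ge0 _) h.
apply: (@le_trans _ _ ((s + t) ^+ 2)); first by rewrite ler_pXn2r ?nnegrE ?normc_ge0.
by rewrite -subr_ge0; have := sqr_ge0 (s - t); congr (_ <= _); ring.
Qed.

Lemma dens_B_le f g p : dens alpha (f - g) p <= 2 * dens alpha f p + 2 * dens alpha g p.
Proof.
rewrite /dens vB_ext; set w := _ `^ _; set a := normc (ext0 f _); set b := normc (ext0 g _).
have -> : 2 * (a ^+ 2 * w) + 2 * (b ^+ 2 * w) = (2 * a ^+ 2 + 2 * b ^+ 2) * w by ring.
rewrite ler_wpM2r ?powR_ge0//.
apply: (@sqr_normcB_le _ _ 0); rewrite subr0//.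
Qed.

(** By (s + t)^2 <= 2 s^2 + 2 t^2, the box and its complement contribute at most 4 / (n + 1)
    each. *)
Lemma fits_close cn f g : fits cn f -> fits cn g -> nsq (f - g) <= 8 / cn.2.+1%:R.
Proof.
case: cn => c n [tf [s sw [s0 sf]]] [tg [t tw [t0 tg']]] /=; set N := c.1.1 in tf tg sf sw tg' tw.
have mB := @measurable_box N; have mC : measurable (~` box N) by exact: measurableC.
have md h := measurable_dens alpha (proj1 (bergmanA h)).
have d0 h p : (0 <= (dens alpha h p)%:E)%E by rewrite lee_fin dens_ge0.
rewrite -lee_fin nsqE bergman_intE -(setUv (box N)).
rewrite ge0_integral_setU//; last 2 first.
- by apply: measurable_funTS; exact: md.
- by rewrite disj_set2E setICr.
pose k := 2 * s ^+ 2 + 2 * t ^+ 2.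
have k0 : 0 <= k by rewrite addr_ge0// mulr_ge0// sqr_ge0.
have I1 : (\int[leb2]_(p in box N) (dens alpha (f - g) p)%:E <= (4 / n.+1%:R)%:E)%E.
  apply: (@le_trans _ _ (\int[leb2]_(p in box N) (cst (k * N.+1%:R `^ `|alpha|)%:E p))%E).
    apply: ge0_le_integral => //.
    - by apply: measurable_funTS; exact: md.
    move=> [x y] xy; rewrite lee_fin /dens; apply: ler_pM; rewrite ?sqr_ge0 ?powR_ge0//.
      by rewrite vB_ext; apply: sqr_normcB_le; [exact: sf|exact: tg'].
    case: xy => /=; rewrite in_itv/= => /andP[x1 x2] _.
    have N1 : 1 <= (N.+1%:R : R) by rewrite ler1n.
    have x0 : 0 < x by apply: lt_le_trans x1; rewrite invr_gt0.
    have := @powR_comparable R alpha N.+1%:R x 1 N1 x0; rewrite powR1 mulr1; apply.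
    apply/andP; split; first by rewrite ler_pdivrMr// mul1r.
    by rewrite mulrC -ler_pdivrMr// div1r.
  have bf : leb2 (box N) = (fine (leb2 (box N)))%:E.
    by rewrite fineK// ge0_fin_numE ?box_finite.
  have -> : (\int[leb2]_(p in box N) (cst (k * N.+1%:R `^ `|alpha|)%:E p) =
      (k * N.+1%:R `^ `|alpha|)%:E * leb2 (box N))%E by exact: integral_cst.
  rewrite bf.
  rewrite -EFinM lee_fin -mulrA -/(weight N) /k.
  rewrite (_ : (_ + _) * weight N = 2 * (s ^+ 2 * weight N) + 2 * (t ^+ 2 * weight N)); last by ring.
  have -> : 4 / n.+1%:R = 2 * n.+1%:R^-1 + 2 * n.+1%:R^-1 :> R by ring.
  by rewrite lerD// ler_wpM2l.
have I2 : (\int[leb2]_(p in ~` box N) (dens alpha (f - g) p)%:E <= (4 / n.+1%:R)%:E)%E.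
  pose F h p := ((2 : R)%:E * (dens alpha h p)%:E)%E.
  have F0 h p : (0 <= F h p)%E by rewrite mule_ge0.
  have mF h : measurable_fun (~` box N) (F h).
    by apply: measurable_funeM; apply: measurable_funTS; exact: md.
  apply: (@le_trans _ _ (\int[leb2]_(p in ~` box N) (F f p + F g p))%E).
    apply: ge0_le_integral => //.
    - by apply: measurable_funTS; exact: md.
    - exact: (emeasurable_funD (mF f) (mF g)).
    by move=> p _; rewrite /F -!EFinM -EFinD lee_fin dens_B_le.
  rewrite (ge0_integralD leb2 mC (fun p _ => F0 f p) (mF f) (fun p _ => F0 g p) (mF g)).
  have IF h : (tail h N <= (n.+1%:R^-1)%:E)%E ->
      (\int[leb2]_(p in ~` box N) F h p <= (2 * n.+1%:R^-1)%:E)%E.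
    move=> th; rewrite (ge0_integralZl_EFin leb2 mC (fun p _ => d0 h p) _ (ler0n R 2)).
      by rewrite EFinM; apply: lee_wpmul2l.
    by apply: measurable_funTS; exact: md.
  have -> : 4 / n.+1%:R = 2 * n.+1%:R^-1 + 2 * n.+1%:R^-1 :> R by ring.
  by rewrite EFinD; apply: leeD; exact: IF.
have -> : 8 / n.+1%:R = 4 / n.+1%:R + 4 / n.+1%:R :> R by ring.
by rewrite EFinD; exact: leeD I1 I2.
Qed.

(** Codes are countable. A step function is not holomorphic, so each code is represented by some
    function that fits it. *)
Theorem bergman_separable : exists D : nat -> V, forall f (e : R), 0 < e -> exists n, nrm (f - D n) <= e.
Proof.
have /choice[G HG] : forall cn : code * nat, exists g : V, (exists f, fits cn f) -> fits cn g.
  move=> cn; have [[f ff]|h] := pselect (exists f, fits cn f); first by exists f.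
  by exists 0 => /h.
exists (fun n => if unpickle n is Some cn then G cn else 0) => f e e0.
pose n := Num.truncn (8 / e ^+ 2).
have [c cf] := fits_ex f n; exists (pickle (c, n)); rewrite pickleK.
have := fits_close cf (HG (c, n) (ex_intro _ f cf)); rewrite -sqr_nrm /= => h.
rewrite -(@ler_pXn2r _ 2) ?nnegrE ?nrm_ge0 ?(ltW e0)//; apply: le_trans h _.
have e2 : 0 < e ^+ 2 by rewrite exprn_gt0.
by rewrite ler_pdivrMr// mulrC -ler_pdivrMr// ltW// truncnS_gt.
Qed.

End Separability.

(** * Symbols of type II *)

Section Expanding.
Variables (R : realType) (alpha : R).
Hypothesis alpha1 : -1 < alpha.
Local Notation C := R[i]^o.
Local Notation V := (bergman alpha).
Implicit Types f g h : V.

Section Transitivity.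
Variables (a : R) (b : R[i]).
Hypotheses (a1 : 1 < a) (b0 : 0 < complex.Re b).

Let a0 : 0 < a. Proof. exact: lt_trans a1. Qed.
Let ak k : 0 < a ^+ k. Proof. exact: exprn_gt0. Qed.
Let off0 k : 0 <= complex.Re (offset a b k).
Proof. exact: Re_offset_ge0 (ltW a0) (ltW b0). Qed.

(* The fixed point b / (1 - a) of the symbol has real part - s, so the functions
   in the range of the shift by s extend beyond it and can be composed with the
   iterates of the inverse symbol. *)
Let s : R := complex.Re b / (a - 1).
Let s0 : 0 <= s. Proof. by rewrite divr_ge0 ?(ltW b0)// subr_ge0 ltW. Qed.
Let sigma : R := Num.sqrt (a `^ (2 + alpha)).
Let sigma0 : 0 < sigma. Proof. by rewrite sqrtr_gt0 powR_gt0. Qed.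

Lemma Re_offset_le k : complex.Re (offset a b k) <= s * a ^+ k.
Proof.
rewrite Re_offset; have a10 : 0 < a - 1 by rewrite subr_gt0.
rewrite /s mulrAC ler_pdivlMr// mulrAC mulrC ler_wpM2l ?(ltW b0)//.
by rewrite -[a - 1]opprB mulrN geometric_sum opprB gerBl.
Qed.

Lemma Re_offset_ge k : k%:R * complex.Re b <= complex.Re (offset a b k).
Proof.
rewrite Re_offset ler_wpM2r ?(ltW b0)//.
elim: k => [|k IH]; first by rewrite big_ord0.
by rewrite big_ord_recr /= -natr1 lerD// exprn_ege1// ltW.
Qed.

Lemma nrm_orbit k f :
  nrm (iter k (compV a b) f) = sigma^-1 ^+ k * nrm (compV 1 (complex.Re (offset a b k))%:C f).
Proof.
rewrite (iter_compV alpha1 k f a0 (ltW b0)) (nrm_compV alpha1 f (ak k) (off0 k)).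
by rewrite (sqrt_powR_neg _ _ a0).
Qed.

(** The inverse of the k-th iterate leaves the half-plane, but followed by the translation by s it
    maps it into itself: [Re_offset_le] says that Re c >= 0. *)
Lemma orbit_preimage k g : exists2 u, iter k (compV a b) u = compV 1 s%:C g & nrm u <= sigma ^+ k * nrm g.
Proof.
pose c : R[i] := s%:C - (a ^- k)%:C * offset a b k.
have c0 : 0 <= complex.Re c.
  rewrite /c ReB Re_realM /= subr_ge0 mulrC ler_pdivrMr//; exact: Re_offset_le.
have iak : 0 < a ^- k by rewrite invr_gt0.
exists (compV (a ^- k) c g).
  rewrite (iter_compV alpha1 k _ a0 (ltW b0)) (compV_comp alpha1 g (ak k) (off0 k) iak c0).
  by rewrite mulVf ?gt_eqF// /c addrC subrK.
apply: le_trans (nrm_compV_le alpha1 g iak c0) _; rewrite ler_wpM2r ?nrm_ge0//.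
rewrite -exprVn sqrt_powR_neg ?invr_gt0// exprVn -exprVn.
rewrite -powR_inv1 ?(ltW a0)// -powRrM mulN1r powRN sqrtrV ?powR_ge0//.
by rewrite invrK.
Qed.

(** Iterates decay like sigma^-k and preimages grow at most like sigma^k. These rates cancel; what
    remains is the norm of a large shift of f, which tends to 0. *)
Lemma projective_transitivity f (v : V) (e : R) : 0 < e -> exists k (l : R) (x : V),
  nrm (f - x) <= e /\ nrm (v - l%:C *: iter k (compV a b) x) <= e.
Proof.
move=> e0; have e20 : 0 < e / 2 by rewrite divr_gt0.
have [g vg] := shift_range_dense alpha1 v s0 e20.
have g1 : 0 < nrm g + 1 by rewrite ltr_wpDl ?nrm_ge0.
have d0 : 0 < e / 2 * (e / (nrm g + 1)) by apply: mulr_gt0 => //; exact: divr_gt0.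
have [r0 r00 Hr] := shift_vanish alpha1 f d0.
pose k := (Num.truncn (r0 / complex.Re b)).+1.
have rk : r0 <= complex.Re (offset a b k).
  apply: le_trans (Re_offset_ge k); rewrite -ler_pdivrMr//.
  exact: ltW (truncnS_gt _).
have [u uE nu] := orbit_preimage k g.
(* For x = f + c u, the correction c u has norm at most e, while the k-th iterate of f divided by c
   has norm (nrm g + 1) / e times that of a shift of f, at most e / 2. *)
pose c := e / (nrm g + 1) * sigma^-1 ^+ k.
have c0 : 0 < c by rewrite mulr_gt0 ?divr_gt0// exprn_gt0// invr_gt0.
have ss : sigma^-1 ^+ k * sigma ^+ k = 1 by rewrite -exprMn mulVf ?gt_eqF// expr1n.
exists k, c^-1, (f + c%:C *: u); split.
  rewrite opprD addrA subrr add0r nrmN nrmZ normc_real gtr0_norm//.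
  apply: le_trans (ler_wpM2l (ltW c0) nu) _.
  have -> : c * (sigma ^+ k * nrm g) = (sigma^-1 ^+ k * sigma ^+ k) * (nrm g * (e / (nrm g + 1))).
    by rewrite /c [X in X * _]mulrC mulrACA; congr (_ * _); exact: mulrC.
  rewrite ss mul1r.
  exact: mul_frac_le (nrm_ge0 g) (ltW e0).
rewrite (iter_compV alpha1 k _ a0 (ltW b0)) (compVD alpha1 f _ (ak k) (off0 k)).
rewrite (compVZ alpha1 _ u (ak k) (off0 k)) -!(iter_compV alpha1 k _ a0 (ltW b0)) uE.
rewrite scalerDr scalerA -rmorphM mulVf ?gt_eqF// scale1r.
rewrite [_ *: _ + _]addrC opprD addrA; apply: le_trans (nrmB _ _) _.
rewrite [leRHS]splitr lerD// nrmZ normc_real gtr0_norm ?invr_gt0// nrm_orbit.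
rewrite mulrC ler_pdivrMr// /c mulrA [leRHS]mulrC ler_wpM2l//.
  by rewrite exprn_ge0// invr_ge0 ltW.
exact: Hr.
Qed.

Lemma bounded_multiple k (l : R) : exists2 B : R, 0 < B & forall x y : V,
  nrm (l%:C *: iter k (compV a b) x - l%:C *: iter k (compV a b) y) <= B * nrm (x - y).
Proof.
pose c := Num.sqrt ((a ^+ k) `^ (- (2 + alpha))).
exists (`|l| * c + 1); first by rewrite ltr_wpDl// mulr_ge0// sqrtr_ge0.
move=> x y; rewrite -scalerBr nrmZ normc_real !(iter_compV alpha1 k _ a0 (ltW b0)).
rewrite -(compVB alpha1 x y (ak k) (off0 k)) mulrDl mul1r -mulrA.
apply: (@le_trans _ _ (`|l| * (c * nrm (x - y)))); last by rewrite lerDl nrm_ge0.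
by rewrite ler_wpM2l//; exact: (nrm_compV_le alpha1 _ (ak k) (off0 k)).
Qed.

(* Birkhoff's argument: nested balls, the n-th of which lies in the set of points some
   multiple of whose orbit hits the n-th target. *)
Lemma supercyclic_vector : exists x : V, forall v (e : R), 0 < e -> exists k (l : R),
  nrm (v - l%:C *: iter k (compV a b) x) <= e.
Proof.
have [D HD] := bergman_separable alpha1.
(* Every pair of a target index and a precision index is [tgt n] for some n; (0, 0) serves the n
   that encode no pair. *)
pose tgt n : nat * nat := odflt (0, 0)%N (unpickle n).
pose eps n : R := (tgt n).2.+1%:R^-1.
have eps0 n : 0 < eps n by rewrite invr_gt0.
pose hit n y := exists k (l : R), nrm (D (tgt n).1 - l%:C *: iter k (compV a b) y) <= eps n.
have /choice[F HF] : forall st : nat * (V * R), exists st' : V * R, 0 < st.2.2 ->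
    [/\ 0 < st'.2, st'.2 <= st.2.2 / 2, nrm (st.2.1 - st'.1) <= st.2.2 / 2 &
        forall y, nrm (st'.1 - y) <= st'.2 -> hit st.1 y].
  (* The pair (0, 0) is reached only for nonpositive radii, which [st0] excludes along the
     sequence. *)
  move=> [n [x r]] /=; have [r0|r0] := boolP (0 < r); last by exists (0, 0).
  pose d := Num.min (r / 2) (eps n / 2).
  have d0 : 0 < d by rewrite lt_min !divr_gt0.
  have [k [l [x1 [xx1 vx1]]]] := projective_transitivity x (D (tgt n).1) d0.
  have [B B0 HB] := bounded_multiple k l.
  (* Over a ball of this radius [bounded_multiple] changes the approximant by at most eps n / 2. *)
  pose r1 := Num.min (r / 2) (eps n / 2 / B).
  exists (x1, r1) => _; split => /=.
  - by rewrite lt_min !divr_gt0.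
  - by rewrite ge_min lexx.
  - by apply: le_trans xx1 _; rewrite ge_min lexx.
  move=> y xy; exists k, l.
  have -> : D (tgt n).1 - l%:C *: iter k (compV a b) y =
      (D (tgt n).1 - l%:C *: iter k (compV a b) x1) +
      (l%:C *: iter k (compV a b) x1 - l%:C *: iter k (compV a b) y) by rewrite addrA subrK.
  apply: le_trans (nrmD _ _) _; rewrite [leRHS]splitr lerD//.
    by apply: le_trans vx1 _; rewrite ge_min lexx orbT.
  apply: le_trans (HB _ _) _; rewrite mulrC -ler_pdivlMr//; apply: le_trans xy _.
  by rewrite ge_min lexx orbT.
pose fix st n : V * R := if n is n'.+1 then F (n', st n') else (0, 1).
have st0 n : 0 < (st n).2.
  by elim: n => [|n IH] //=; have [] := HF (n, st n) IH.
have stS n := HF (n, st n) (st0 n).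
have r2 n : (st n).2 <= 2^-1 ^+ n.
  elim: n => [|n IH]; first by rewrite expr0.
  have [_ h _ _] := stS n; apply: le_trans h _.
  by rewrite exprSr ler_pM2r.
(* The radius at stage n absorbs both the drift of the centres and the later radius: the balls are
   nested. *)
have nest n m : nrm ((st n).1 - (st (n + m)%N).1) + (st (n + m)%N).2 <= (st n).2.
  elim: m => [|m IH]; first by rewrite addn0 subrr nrm0 add0r.
  rewrite addnS; have [_ h1 h2 _] := stS (n + m)%N.
  apply: le_trans IH; rewrite [X in _ <= _ + X]splitr addrA lerD//.
  apply: le_trans (lerD (lexx _) h2).
  rewrite -[X in nrm X](_ : ((st n).1 - (st (n + m)%N).1) +
    ((st (n + m)%N).1 - (st (n + m).+1).1) = _); first exact: nrmD.
  by rewrite addrA subrK.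
have near_ n m : nrm ((st n).1 - (st (n + m)%N).1) <= (st n).2.
  by apply: le_trans (nest n m); rewrite lerDl ltW.
have cs : cauchy_nrm (fun n => (st n).1).
  move=> e e0; have e20 : 0 < e / 2 by rewrite divr_gt0.
  have h12 : 1 < (2 : R) by rewrite ltr1n.
  have [N HN] := expn_large (e / 2)^-1 h12.
  exists N => n m /subnKC <- /subnKC <-.
  have rN : (st N).2 <= e / 2.
    apply: le_trans (r2 N) _; rewrite exprVn -[leRHS]invrK lef_pV2 ?posrE ?exprn_gt0 ?invr_gt0//.
    exact: HN.
  set p := (n - N)%N; set q := (m - N)%N.
  have -> : (st (N + p)%N).1 - (st (N + q)%N).1 =
      ((st N).1 - (st (N + q)%N).1) - ((st N).1 - (st (N + p)%N).1).
    by rewrite [RHS]subrACA subrr sub0r opprB.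
  apply: le_trans (nrmB _ _) _; rewrite [leRHS]splitr lerD//; exact: le_trans (near_ _ _) rN.
have [x Hx] := bergman_complete alpha1 cs.
have xn n : nrm ((st n).1 - x) <= (st n).2.
  apply/ler_addgt0Pr => e e0; have [N HN] := Hx e e0.
  have -> : (st n).1 - x = ((st n).1 - (st (n + N)%N).1) + ((st (n + N)%N).1 - x).
    by rewrite addrA subrK.
  by apply: le_trans (nrmD _ _) _; rewrite lerD// HN// leq_addl.
exists x => v e e0; have e20 : 0 < e / 2 by rewrite divr_gt0.
have [i vi] := HD v _ e20.
pose j := Num.truncn (e / 2)^-1.
pose n := pickle (i, j).
have tn : tgt n = (i, j) by rewrite /tgt /n pickleK.
have [_ _ _ /(_ x (xn n.+1))[k [l]]] := stS n.
rewrite /eps tn /= => h; exists k, l.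
rewrite -(subrK (D i) v) -addrA; apply: le_trans (nrmD _ _) _; rewrite [leRHS]splitr lerD//.
apply: le_trans h _; rewrite -[leRHS]invrK lef_pV2 ?posrE ?invr_gt0//.
exact: ltW (truncnS_gt _).
Qed.

End Transitivity.

Lemma lin_span_proper n (e : 'I_n -> V) : exists y : V, ~ lin_span e y.
Proof.
apply: contrapT => h; have [e1 e1f] := bergman_infinite_dim alpha1 n.+1.
have /choice[X HX] : forall i : 'I_n.+1, exists c : 'I_n -> R[i], \sum_(j < n) c j *: e j = e1 i.
  move=> i; have : lin_span e (e1 i) by apply: contrapT => he; apply: h; exists (e1 i).
  by case=> c _ cE; exists c.
pose M : 'M[R[i]]_(n.+1, n) := \matrix_(i, j) X i j.
have k0 : kermx M != 0.
  by rewrite -mxrank_eq0 mxrank_ker subn_eq0 -ltnNge ltnS rank_leq_col.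
have [i ki] : exists i, row i (kermx M) != 0.
  apply/existsP; apply: contraR k0; rewrite negb_exists => /forallP hk.
  apply/eqP/row_matrixP => i; have := hk i; rewrite negbK => /eqP ->.
  by rewrite row0.
move/eqP: ki; apply; apply/rowP => j; rewrite [RHS]mxE.
have yM : row i (kermx M) *m M = 0 by apply/sub_kermxP; exact: row_sub.
apply: (e1f (fun j => row i (kermx M) ord0 j)).
under eq_bigr do rewrite -HX scaler_sumr.
rewrite exchange_big big1// => l _.
have := congr1 (fun A : 'rV_n => A ord0 l) yM; rewrite !mxE => E.
rewrite -[RHS](scale0r (e l)) -E scaler_suml; apply: eq_bigr => m _.
by rewrite scalerA !mxE.
Qed.

(** The definition asks for a subspace of dimension exactly n, so the line of a supercyclic vector
    has to be enlarged. *)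
Lemma extend_independent (x : V) n : x != 0 ->
  exists2 e : 'I_n.+1 -> V, lin_independent e & lin_span e x.
Proof.
move=> x0; elim: n => [|n [e ef [c _ cE]]].
  exists (fun=> x); last by exists (fun=> 1) => //; rewrite big_ord1 scale1r.
  move=> c; rewrite big_ord1 => /eqP; rewrite scaler_eq0 (negbTE x0) orbF => /eqP c0 i.
  by rewrite (ord1 i).
have [y yE] := lin_span_proper e.
pose e' (i : 'I_n.+2) := if unlift ord0 i is Some j then e j else y.
have sumE (d : 'I_n.+2 -> R[i]) :
    \sum_(i < n.+2) d i *: e' i = d ord0 *: y + \sum_(i < n.+1) d (lift ord0 i) *: e i.
  rewrite big_ord_recl /e' unlift_none; congr (_ + _).
  by apply: eq_bigr => i _; rewrite liftK.
exists e'; last first.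
  exists (fun i => if unlift ord0 i is Some j then c j else 0) => //.
  rewrite sumE unlift_none scale0r add0r -cE; apply: eq_bigr => i _.
  by rewrite liftK.
move=> d; rewrite sumE => d0.
have [dy|dy] := eqVneq (d ord0) 0.
  move: d0; rewrite dy scale0r add0r => /ef h i.
  by case: (unliftP ord0 i) => [j ->|->] //; exact: h.
exfalso; apply: yE; exists (fun i => - (d ord0)^-1 * d (lift ord0 i)) => //.
under eq_bigr do rewrite -scalerA.
rewrite -scaler_sumr; move/eqP: d0; rewrite addrC addr_eq0 => /eqP ->.
by rewrite scalerN scaleNr opprK scalerA mulVf// scale1r.
Qed.

Theorem typeII_supercyclic n (a : R) (b : R[i]) : 1 < a -> 0 < complex.Re b ->
  n_supercyclic n.+1 (compV a b : V -> V).
Proof.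
move=> a1 b0; have [x Hx] := supercyclic_vector a1 b0.
have a0 : 0 < a by exact: lt_trans a1.
have x0 : x != 0.
  have [f f0] := bergman_neq0 alpha1; apply: contra f0 => /eqP x0.
  apply/eqP/nrm_eq0/le_anti; rewrite nrm_ge0 andbT; apply/ler_addgt0Pr => e e0.
  rewrite add0r; have [k [l]] := Hx f e e0.
  have T0 : iter k (compV a b) (0 : V) = 0.
    have ak : 0 < a ^+ k by exact: exprn_gt0.
    have bk := Re_offset_ge0 k (ltW a0) (ltW b0).
    by rewrite (iter_compV alpha1 k _ a0 (ltW b0)) -[0 in LHS](subrr (0 : V)) (compVB alpha1 _ _ ak bk) subrr.
  by rewrite x0 T0 scaler0 subr0.
have [e ef [c _ cE]] := extend_independent n x0.
exists (lin_span e); first by exists e.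
move=> O [v Ov] oO; have /nbhs_ballP[t /= t0 tO] := open_nbhs_nbhs (conj oO Ov).
have [r r0 rt] : exists2 r : R, 0 < r & t = r%:C.
  case: t t0 {tO} => t1 t2; rewrite ltcE /= => /andP[/eqP -> t10].
  by exists t1.
have r20 : 0 < r / 2 by rewrite divr_gt0.
have [k [l kl]] := Hx v _ r20.
exists (l%:C *: iter k (compV a b) x); split.
  apply: tO; rewrite rt; apply/(ball_nrm v _ r0); apply: le_lt_trans kl _.
  by rewrite ltr_pdivrMr// ltr_pMr// ltr1n.
(* The scalar l is absorbed by the subspace, which contains all multiples of x. *)
exists k => //; exists (l%:C *: x).
  exists (fun i => l%:C * c i) => //; rewrite -cE scaler_sumr.
  by apply: eq_bigr => i _; rewrite scalerA.
have ak : 0 < a ^+ k by exact: exprn_gt0.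
have bk := Re_offset_ge0 k (ltW a0) (ltW b0).
by rewrite !(iter_compV alpha1 k _ a0 (ltW b0)) (compVZ alpha1 _ x ak bk).
Qed.

End Expanding.

Theorem theorem9 (R : realType) (alpha : R) (n : nat) (a : R) (b : R[i])
    (a_gt0 : 0 < a) (b_ge0 : 0 <= complex.Re b) :
  -1 < alpha -> (2 <= n)%N ->
  n_supercyclic n (@composition_op R alpha (affine_symbol a_gt0 b_ge0)) <->
  hyperbolic_typeII a b.
Proof.
move=> alpha1; case: n => // n _; rewrite (composition_opE alpha a_gt0 b_ge0).
split=> [sc|[_ nauto a1]].
  (* Re b = 0 is excluded first, for all a at once: this covers the automorphisms with a > 1, which
     are not of type II. *)
  have b0 : 0 < complex.Re b.
    rewrite lt_neqAle b_ge0 andbT eq_sym; apply/eqP => b0.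
    have [[a1 b1]|ab] := pselect ((a, b) = (1, 0)).
      by move: sc; rewrite a1 b1; exact: not_supercyclic_identity.
    by have := not_supercyclic_automorphism alpha1 a_gt0 b0 ab sc.
  have [a1|a1|a1] := ltgtP a 1.
  - by have := not_supercyclic_attracting alpha1 a_gt0 a1 b0 sc.
  - split=> //; first by rewrite /hyperbolic gt_eqF.
    by case=> _ b00; rewrite b00 ltxx in b0.
  - by move: sc; rewrite a1 => /(not_supercyclic_parabolic alpha1 b0).
apply: typeII_supercyclic => //; rewrite lt_neqAle b_ge0 andbT eq_sym.
by apply/eqP => b0; apply: nauto; split=> //; rewrite /hyperbolic gt_eqF.
Qed.
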